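(* Let $(A,V,\chi,\mathcal F,\nu)$ be a crossed product system with preunit in which $\mathcal F$ is a cocycle satisfying the twisted module condition, let $E$ be the associated unitary crossed product, and let $K$ be a subalgebra of $A$ that is stable under $\chi$ and such that $1_E\in K\otimes_kV$. Let $X_n:=\bigoplus_{r+s=n}X_{rs}$ and $$d_n(\mathbf x):=\begin{cases}\sum_{l=1}^nd^l_{0n}(\mathbf x)&\text{if }\mathbf x\in X_{0n},\\ \sum_{l=0}^{n-r}d^l_{r,n-r}(\mathbf x)&\text{if }\mathbf x\in X_{r,n-r}\text{ with }r>0.\end{cases}$$ Then the chain complex $E\xleftarrow{\ \overline\mu_E\ }X_0\xleftarrow{\ d_1\ }X_1\xleftarrow{\ d_2\ }X_2\xleftarrow{\ d_3\ }\cdots$, where $\overline\mu_E\colon X_0=E\otimes_KE\to E$ is induced by multiplication, is a $\Upsilon$-relative projective resolution of $E$ as an $E$-bimodule, where $\Upsilon$ is the family of all epimorphisms of $E$-bimodules that split as maps of $(E,K)$-bimodules.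
   Context: SETTING. All vector spaces and maps are over a field $k$; algebras are associative. In tensor products of maps, an object denotes its identity map. $A$ is a unital algebra (multiplication $\mu_A$, unit $\eta_A$), $V$ a vector space, and $\chi\colon V\otimes_kA\to A\otimes_kV$ satisfies $\chi\circ(V\otimes\mu_A)=(\mu_A\otimes V)\circ(A\otimes\chi)\circ(\chi\otimes A)$. Then $A\otimes_kV$ is a (not necessarily unital) $A$-bimodule via $a'\cdot(a\otimes v)=a'a\otimes v$, $(a\otimes v)\cdot a'=a\cdot\chi(v\otimes a')$; $\nabla_\chi(\mathbf x):=\mathbf x\cdot1_A$ is an idempotent endomorphism with image $A\times V$. $(A,V,\chi,\mathcal F,\nu)$ is a crossed product system with preunit if $\mathcal F\colon V\otimes_kV\to A\otimes_kV$ has image in $A\times V$ and $\nu\colon k\to A\otimes_kV$ satisfies $(\mu_A\otimes V)(A\otimes\mathcal F)(\chi\otimes V)(V\otimes\nu)=\nabla_\chi(\eta_A\otimes V)=(\mu_A\otimes V)(A\otimes\mathcal F)(\nu\otimes V)$ and $(\mu_A\otimes V)(A\otimes\chi)(\nu\otimes A)=(\mu_A\otimes V)(A\otimes\nu)$. Twisted module condition: $(\mu_A\otimes V)(A\otimes\chi)(\mathcal F\otimes A)=(\mu_A\otimes V)(A\otimes\mathcal F)(\chi\otimes V)(V\otimes\chi)$. Cocycle: $(\mu_A\otimes V)(A\otimes\mathcal F)(\mathcal F\otimes V)=(\mu_A\otimes V)(A\otimes\mathcal F)(\chi\otimes V)(V\otimes\mathcal F)$. Under these conditions $E:=A\times V$,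 with product induced by $(\mu_A\otimes V)(\mu_A\otimes\mathcal F)(A\otimes\chi\otimes V)$, is a unital associative algebra with $1_E=\nu(1_k)$ (the unitary crossed product). Put $\jmath_\nu\colon A\to E$, $\jmath_\nu(a)=a\cdot\nu(1_k)$ (a unital algebra map inducing the $A$-bimodule structure of $E$) and $\gamma\colon V\to E$, $\gamma(v)=\nabla_\chi(1_A\otimes v)$. $K$ stable under $\chi$ means $\chi(V\otimes_kK)\subseteq K\otimes_kV$. Write $\otimes=\otimes_K$, $\overline A=A/K$, $\widetilde E=E/\jmath_\nu(A)$; bars and tildes denote classes. RESOLUTION. $Y_s=E\otimes_A\widetilde E^{\otimes_As}\otimes_AE$ and $X_{rs}=E\otimes_A\widetilde E^{\otimes_As}\otimes\overline A^{\otimes r}\otimes E$ (empty tensor powers are omitted: $Y_0=E\otimes_AE$, $X_{r0}=E\otimes\overline A^{\otimes r}\otimes E$, $X_{0s}=E\otimes_A\widetilde E^{\otimes_As}\otimes E$). $\upsilon_s\colon X_{0s}\to Y_s$ is the canonical surjection; $\partial_s\colon Y_s\to Y_{s-1}$ is the normalized bar differential of the $A$-algebra $E$, $\sum_{i=0}^s(-1)^i(\text{multiply factors }i,i+1)$; $d^0_{rs}\colon X_{rs}\to X_{r-1,s}$ ($r\ge1$) is $(-1)^s$ times $E\otimes_A\widetilde E^{\otimes_As}\otimes_A(\text{normalized bar differential of the }K\text{-algebra }A)\otimes_AE$. Left $E$-linear maps $\sigma^0_{0s}\colon Y_s\to X_{0s}$, $\sigma^0_{r+1,s}\colon X_{rs}\to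 X_{r+1,s}$: if $x_{s+1}=\sum_la_{(l)}\otimes_kv_{(l)}$, then $\sigma^0_{0s}(x_0\otimes_A\widetilde x_1\otimes_A\cdots\otimes_A\widetilde x_s\otimes_Ax_{s+1})=\sum_lx_0\otimes_A\widetilde x_1\otimes_A\cdots\otimes_A\widetilde x_s\cdot a_{(l)}\otimes\gamma(v_{(l)})$ and $\sigma^0_{r+1,s}(\mathbf y\otimes x_{s+1})=(-1)^{r+s+1}\sum_l\mathbf y\otimes\overline{a_{(l)}}\otimes\gamma(v_{(l)})$ for $\mathbf y\in E\otimes_A\widetilde E^{\otimes_As}\otimes\overline A^{\otimes r}$. The $E$-bimodule maps $d^l_{rs}\colon X_{rs}\to X_{r+l-1,s-l}$ ($1\le l\le s$) are defined recursively on elements $\mathbf z=\mathbf y\otimes1_E$ by: $d^1=\sigma^0\partial\upsilon$ if $r=0$; $d^1=-\sigma^0d^1d^0$ if $r>0$; for $l>1$, $d^l=-\sum_{j=1}^{l-1}\sigma^0d^{l-j}d^j$ if $r=0$ and $d^l=-\sum_{j=0}^{l-1}\sigma^0d^{l-j}d^j$ if $r>0$. *)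

(* Defs.v *)
From HB Require Import structures.
From mathcomp Require Import all_boot all_algebra.
From mathcomp Require Import boolp.
Set Implicit Arguments.
Unset Strict Implicit.
Unset Printing Implicit Defensive.
Import GRing.Theory.
Local Open Scope ring_scope.
Local Open Scope quotient_scope.

(* A unital associative k-algebra, possibly zero, as a ring with a central
   ring morphism from k. MathComp's [algType] requires 1 != 0, which fails for
   the crossed product E when, for instance, V = 0. *)
Record kalg (k : fieldType) := Kalg {
  kcar :> pzRingType;
  kemb : {rmorphism k -> kcar};
  kembC : forall c x, kemb c * x = x * kemb c }.

Record khom (k : fieldType) (A B : kalg k) := Khom {
  kfun :> {rmorphism A -> B};
  kfun_emb : forall c, kfun (kemb A c) = kemb B c }.

Definition kself (k : fieldType) : kalg k :=
  @Kalg k k idfun (fun c x => mulrC c x).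

Definition kunit (k : fieldType) (A : kalg k) : khom (kself k) A :=
  @Khom k (kself k) A (kemb A) (fun=> erefl).

Definition kid (k : fieldType) (A : kalg k) : khom A A :=
  @Khom k A A idfun (fun=> erefl).

(* (L, R)-bimodules over k-algebras, with the two k-actions equal; for
   L = R = k these are the k-vector spaces, and [bhom] is then k-linearity. *)
Record bimod_laws (k : fieldType) (L R : kalg k) (M : zmodType)
    (l : L -> M -> M) (r : M -> R -> M) : Prop := BimodLaws {
  _ : forall a b m, l (a + b) m = l a m + l b m;
  _ : forall a m n, l a (m + n) = l a m + l a n;
  _ : forall m, l 1 m = m;
  _ : forall a b m, l a (l b m) = l (a * b) m;
  _ : forall m n b, r (m + n) b = r m b + r n b;
  _ : forall m a b, r m (a + b) = r m a + r m b;
  _ : forall m, r m 1 = m;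
  _ : forall m a b, r (r m a) b = r m (a * b);
  _ : forall a m b, r (l a m) b = l a (r m b);
  _ : forall c m, l (kemb L c) m = r m (kemb R c) }.

Record bimod (k : fieldType) (L R : kalg k) := Bimod {
  bcar :> zmodType;
  lact : L -> bcar -> bcar;
  ract : bcar -> R -> bcar;
  blaws : bimod_laws lact ract }.

Declare Scope bimod_scope.
Notation "a *l m" := (lact a m) (at level 40, left associativity) : bimod_scope.
Notation "m *r b" := (ract m b) (at level 40, left associativity) : bimod_scope.
Local Open Scope bimod_scope.

Record bhom (k : fieldType) (L R : kalg k) (M N : bimod L R) := Bhom {
  bfun :> M -> N;
  bfunD : {morph bfun : x y / x + y};
  bfunl : forall a x, bfun (a *l x) = a *l bfun x;
  bfunr : forall x b, bfun (x *r b) = bfun x *r b }.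

Section BimodTheory.
Variables (k : fieldType) (L R : kalg k) (M N : bimod L R).
Implicit Types (m n : M) (f : bhom M N).

Lemma lactDl a b m : (a + b) *l m = a *l m + b *l m.
Proof. by case: (blaws M). Qed.
Lemma lactDr a m n : a *l (m + n) = a *l m + a *l n.
Proof. by case: (blaws M). Qed.
Lemma lact1 m : 1 *l m = m.
Proof. by case: (blaws M). Qed.
Lemma lactA a b m : a *l (b *l m) = (a * b) *l m.
Proof. by case: (blaws M). Qed.
Lemma ractDl m n b : (m + n) *r b = m *r b + n *r b.
Proof. by case: (blaws M). Qed.
Lemma ractDr m a b : m *r (a + b) = m *r a + m *r b.
Proof. by case: (blaws M). Qed.
Lemma ract1 m : m *r 1 = m.
Proof. by case: (blaws M). Qed.
Lemma ractA m a b : m *r a *r b = m *r (a * b).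
Proof. by case: (blaws M). Qed.
Lemma lractA a m b : a *l m *r b = a *l (m *r b).
Proof. by case: (blaws M). Qed.
Lemma bcentral c m : kemb L c *l m = m *r kemb R c.
Proof. by case: (blaws M). Qed.

Lemma lact0 a : a *l (0 : M) = 0.
Proof. by apply: (addIr (a *l (0 : M))); rewrite -lactDr !add0r. Qed.
Lemma ract0 b : (0 : M) *r b = 0.
Proof. by apply: (addIr ((0 : M) *r b)); rewrite -ractDl !add0r. Qed.
Lemma lactN a m : a *l (- m) = - (a *l m).
Proof. by apply: (addIr (a *l m)); rewrite -lactDr !addNr lact0. Qed.
Lemma ractN m b : (- m) *r b = - (m *r b).
Proof. by apply: (addIr (m *r b)); rewrite -ractDl !addNr ract0. Qed.
Lemma lact_sum a I (s : seq I) (F : I -> M) :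
  a *l (\sum_(i <- s) F i) = \sum_(i <- s) a *l F i.
Proof. exact: (big_morph _ (lactDr a) (lact0 a)). Qed.
Lemma ract_sum b I (s : seq I) (F : I -> M) :
  (\sum_(i <- s) F i) *r b = \sum_(i <- s) F i *r b.
Proof.
by apply: (big_morph (fun x => x *r b) _ (ract0 b)) => x y; rewrite ractDl.
Qed.
Lemma bfun0 f : f 0 = 0.
Proof. by apply: (addIr (f 0)); rewrite -bfunD !add0r. Qed.
Lemma bfunN f m : f (- m) = - f m.
Proof. by apply: (addIr (f m)); rewrite -bfunD !addNr bfun0. Qed.
Lemma bfun_sum f I (s : seq I) (F : I -> M) :
  f (\sum_(i <- s) F i) = \sum_(i <- s) f (F i).
Proof. exact: (big_morph _ (bfunD f) (bfun0 f)). Qed.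
End BimodTheory.

Section BasicBimod.
Variables (k : fieldType).

Lemma breg_laws (A : kalg k) : bimod_laws (fun a m : A => a * m) (fun m b => m * b).
Proof.
by split=> *; rewrite ?(mulrDl, mulrDr, mul1r, mulr1, mulrA) // kembC.
Qed.
Definition breg (A : kalg k) : bimod A A := Bimod (breg_laws A).

Lemma bres_laws (L' L R' R : kalg k) (f : khom L' L) (g : khom R' R)
    (M : bimod L R) :
  bimod_laws (fun a (m : M) => f a *l m) (fun m b => m *r g b).
Proof.
split=> *; rewrite ?rmorphD ?rmorph1 ?rmorphM.
- exact: lactDl.
- exact: lactDr.
- exact: lact1.
- exact: lactA.
- exact: ractDl.
- exact: ractDr.
- exact: ract1.
- exact: ractA.
- exact: lractA.
- by rewrite !kfun_emb bcentral.
Qed.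
Definition bres (L' L R' R : kalg k) (f : khom L' L) (g : khom R' R)
    (M : bimod L R) : bimod L' R' := Bimod (bres_laws f g M).

Lemma bvect_laws (V : lmodType k) :
  @bimod_laws k (kself k) (kself k) V (fun c v => c *: v) (fun v c => c *: v).
Proof.
split=> //= *; rewrite ?(scalerDl, scalerDr, scale1r) // !scalerA // mulrC //.
Qed.
Definition bvect (V : lmodType k) : bimod (kself k) (kself k) :=
  Bimod (bvect_laws V).
End BasicBimod.

Section Ext.
Variables (G Z : zmodType) (I : Type) (gen : I -> G) (b : I -> Z).

(* The additive map determined by gen i |-> b i when the gen i span G; it has
   the expected values whenever such an additive map exists ([addext_eq]). *)
Definition addext (x : G) : Z :=
  match pselect (exists s : seq I, x = \sum_(i <- s) gen i) with
  | left h => \sum_(i <- sval (cid h)) b i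
  | right _ => 0
  end.

Lemma addext_eq x (s : seq I) :
  (forall s1 s2, \sum_(i <- s1) gen i = \sum_(i <- s2) gen i ->
     \sum_(i <- s1) b i = \sum_(i <- s2) b i) ->
  x = \sum_(i <- s) gen i -> addext x = \sum_(i <- s) b i.
Proof.
move=> bP xE; rewrite /addext; case: pselect => [h|[]]; last by exists s.
by case: cid => /= t tE; apply: bP; rewrite -tE -xE.
Qed.
End Ext.

Section Tensor.
Variables (k : fieldType) (L R S : kalg k) (M : bimod L R) (N : bimod R S).

(* M (x)_R N: formal sums of pairs modulo the congruence generated by
   biadditivity and R-balancing. *)
Inductive teq : seq (M * N) -> seq (M * N) -> Prop :=
| teq_refl s : teq s s
| teq_sym s t : teq s t -> teq t s
| teq_trans s t u : teq s t -> teq t u -> teq s u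
| teq_cat s s' t t' : teq s s' -> teq t t' -> teq (s ++ t) (s' ++ t')
| teq_swap p q : teq [:: p; q] [:: q; p]
| teq0 n : teq [:: (0, n)] [::]
| teqDl m m' n : teq [:: (m + m', n)] [:: (m, n); (m', n)]
| teqDr m n n' : teq [:: (m, n + n')] [:: (m, n); (m, n')]
| teq_bal m r n : teq [:: (m *r r, n)] [:: (m, r *l n)].

Lemma teq_sum (Z : zmodType) (b : M -> N -> Z) s t :
    (forall m m' n, b (m + m') n = b m n + b m' n) ->
    (forall m n n', b m (n + n') = b m n + b m n') ->
    (forall m r n, b (m *r r) n = b m (r *l n)) ->
  teq s t -> \sum_(p <- s) b p.1 p.2 = \sum_(p <- t) b p.1 p.2.
Proof.
move=> bDl bDr bB; elim=> {s t} //.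
- by move=> s t u _ -> _ ->.
- by move=> s s' t t' _ e _ e'; rewrite !big_cat /= e e'.
- by move=> p q; rewrite !big_cons addrCA.
- move=> n; rewrite big_seq1 big_nil /=.
  by apply: (addIr (b 0 n)); rewrite -bDl !add0r.
- by move=> *; rewrite !big_cons !big_nil /= !addr0 bDl.
- by move=> *; rewrite !big_cons !big_nil /= !addr0 bDr.
- by move=> *; rewrite !big_seq1 /= bB.
Qed.

Lemma teq_catC s t : teq (s ++ t) (t ++ s).
Proof.
elim: s t => [|p s IH] t; first by rewrite cats0; exact: teq_refl.
suff h : teq ([:: p] ++ t) (t ++ [:: p]).
  rewrite /= -cat1s; apply: teq_trans (teq_cat (teq_refl _) (IH t)) _.
  by rewrite -[p :: s]cat1s !catA; apply: teq_cat h (teq_refl s).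
elim: t => [|q t {}IH] /=; first exact: teq_refl.
rewrite -[[:: p, q & t]]/([:: p; q] ++ t).
apply: teq_trans (teq_cat (teq_swap p q) (teq_refl t)) _.
by rewrite -[_ ++ t]/([:: q] ++ (p :: t)) -[q :: _]cat1s; apply: teq_cat (teq_refl _) IH.
Qed.

Lemma teq_map (f : M -> M) (s t : seq (M * N)) :
    (forall m m', f (m + m') = f m + f m') ->
    (forall m r, f (m *r r) = f m *r r) ->
  teq s t -> teq [seq (f p.1, p.2) | p <- s] [seq (f p.1, p.2) | p <- t].
Proof.
move=> fD fr; elim=> {s t} /=.
- move=> s; exact: teq_refl.
- by move=> s t _; apply: teq_sym.
- by move=> s t u _ h _; apply: teq_trans.
- by move=> s s' t t' _ h _ h'; rewrite !map_cat; apply: teq_cat.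
- by move=> *; apply: teq_swap.
- move=> n; suff -> : f 0 = 0 by exact: teq0.
  by apply: (addIr (f 0)); rewrite -fD !add0r.
- by move=> *; rewrite fD; apply: teqDl.
- by move=> *; apply: teqDr.
- by move=> *; rewrite fr; apply: teq_bal.
Qed.

Lemma teqN s : teq ([seq (- p.1, p.2) | p <- s] ++ s) [::].
Proof.
elim: s => [|[m n] s IH]; first exact: teq_refl.
have h : teq [:: (- m, n); (m, n)] [::].
  by apply: teq_trans (teq_sym (teqDl _ _ _)) _; rewrite addNr; apply: teq0.
rewrite [map _ _]/= -cat1s -[(m, n) :: s]cat1s -catA.
apply: teq_trans (teq_cat (teq_refl _) (teq_catC _ _)) _.
rewrite -catA [in X in teq X _]catA -[[::]]cat0s.
apply: teq_cat h _; exact: teq_trans (teq_catC _ _) IH.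
Qed.

Definition teqb (s t : seq (M * N)) : bool := `[< teq s t >].
Lemma teqb_equiv : equiv_class_of teqb.
Proof.
split=> [s|s t|s t u]; rewrite /teqb.
- by apply/asboolP; apply: teq_refl.
- by apply/asboolP/asboolP; apply: teq_sym.
- by move=> /asboolP h /asboolP h'; apply/asboolP; apply: teq_trans h h'.
Qed.
Canonical teqb_equivrel := EquivRelPack teqb_equiv.
Canonical teqb_encModRel := defaultEncModRel teqb.

Definition tcar := {eq_quot teqb}.
HB.instance Definition _ := Choice.on tcar.

Definition tcls (s : seq (M * N)) : tcar := \pi_tcar s.

Lemma tclsP s t : tcls s = tcls t <-> teq s t.
Proof. by split=> [/eqmodP/asboolP|h] //; apply/eqmodP/asboolP. Qed.

Lemma tcls_repr x : tcls (repr x) = x.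
Proof. exact: reprK. Qed.

Definition tzero : tcar := tcls [::].
Definition tadd (x y : tcar) : tcar := tcls (repr x ++ repr y).
Definition topp (x : tcar) : tcar := tcls [seq (- p.1, p.2) | p <- repr x].

Lemma taddE s t : tadd (tcls s) (tcls t) = tcls (s ++ t).
Proof. by apply/tclsP; apply: teq_cat; apply/tclsP; rewrite tcls_repr. Qed.

Lemma toppE s : topp (tcls s) = tcls [seq (- p.1, p.2) | p <- s].
Proof.
apply/tclsP/(@teq_map -%R); [exact: opprD|by move=> *; rewrite ractN|].
by apply/tclsP; rewrite tcls_repr.
Qed.

Lemma tind (P : tcar -> Prop) : (forall s, P (tcls s)) -> forall x, P x.
Proof. by move=> h x; rewrite -[x]tcls_repr. Qed.

Lemma taddA : associative tadd.
Proof. by elim/tind=> s; elim/tind=> t; elim/tind=> u; rewrite !taddE catA. Qed.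
Lemma taddC : commutative tadd.
Proof.
by elim/tind=> s; elim/tind=> t; rewrite !taddE; apply/tclsP/teq_catC.
Qed.
Lemma tadd0 : left_id tzero tadd.
Proof. by elim/tind=> s; rewrite taddE. Qed.
Lemma taddN : left_inverse tzero topp tadd.
Proof. by elim/tind=> s; rewrite toppE taddE; apply/tclsP/teqN. Qed.

HB.instance Definition _ := GRing.isZmodule.Build tcar taddA taddC tadd0 taddN.

Lemma tclsD s t : tcls s + tcls t = tcls (s ++ t).
Proof. exact: taddE. Qed.

Definition tpure (m : M) (n : N) : tcar := tcls [:: (m, n)].

Lemma tcls_sum s : tcls s = \sum_(p <- s) tpure p.1 p.2.
Proof.
elim: s => [|[m n] s IH]; first by rewrite big_nil.
by rewrite big_cons -IH [RHS]taddE.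
Qed.

Lemma tpureDl m m' n : tpure (m + m') n = tpure m n + tpure m' n.
Proof. by rewrite [RHS]taddE; apply/tclsP/teqDl. Qed.
Lemma tpureDr m n n' : tpure m (n + n') = tpure m n + tpure m n'.
Proof. by rewrite [RHS]taddE; apply/tclsP/teqDr. Qed.
Lemma tpure_bal m r n : tpure (m *r r) n = tpure m (r *l n).
Proof. by apply/tclsP/teq_bal. Qed.

Lemma tpure_ind (P : tcar -> Prop) :
  P 0 -> (forall x y, P x -> P y -> P (x + y)) ->
  (forall m n, P (tpure m n)) -> forall x, P x.
Proof.
move=> P0 PD Pp; elim/tind=> s; rewrite tcls_sum.
by elim: s => [|p s IH]; rewrite ?big_nil ?big_cons //; apply: PD.
Qed.

Section Lift.
Variables (Z : zmodType) (b : M -> N -> Z).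
Definition tlift : tcar -> Z :=
  addext (fun p : M * N => tpure p.1 p.2) (fun p => b p.1 p.2).

Hypotheses (bDl : forall m m' n, b (m + m') n = b m n + b m' n)
  (bDr : forall m n n', b m (n + n') = b m n + b m n')
  (bB : forall m r n, b (m *r r) n = b m (r *l n)).

Lemma tlift_cls s : tlift (tcls s) = \sum_(p <- s) b p.1 p.2.
Proof.
apply: addext_eq; last exact: tcls_sum.
by move=> s1 s2; rewrite -!tcls_sum => /tclsP; apply: teq_sum.
Qed.
Lemma tlift_pure m n : tlift (tpure m n) = b m n.
Proof. by rewrite tlift_cls big_seq1. Qed.
Lemma tliftD x y : tlift (x + y) = tlift x + tlift y.
Proof.
by elim/tind: x => s; elim/tind: y => t; rewrite tclsD !tlift_cls big_cat.
Qed.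
End Lift.

Definition tlact (a : L) : tcar -> tcar := tlift (fun m n => tpure (a *l m) n).
Definition tract (x : tcar) (b : S) : tcar := tlift (fun m n => tpure m (n *r b)) x.

Lemma tlactE a m n : tlact a (tpure m n) = tpure (a *l m) n.
Proof.
by apply: tlift_pure => *; rewrite ?lactDr ?tpureDl ?tpureDr ?lractA // -lractA tpure_bal.
Qed.
Lemma tlactD a x y : tlact a (x + y) = tlact a x + tlact a y.
Proof.
by apply: tliftD => *; rewrite ?lactDr ?tpureDl ?tpureDr // -tpure_bal lractA.
Qed.
Lemma tractE m n b : tract (tpure m n) b = tpure m (n *r b).
Proof.
by apply: (tlift_pure (b := fun m n => tpure m (n *r b))) => *; rewrite ?ractDl ?tpureDl ?tpureDr // tpure_bal lractA.
Qed.
Lemma tractD x y b : tract (x + y) b = tract x b + tract y b.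
Proof.
by apply: (tliftD (b := fun m n => tpure m (n *r b))) => *; rewrite ?ractDl ?tpureDl ?tpureDr // tpure_bal lractA.
Qed.
Lemma tlact0 a : tlact a 0 = 0.
Proof. by apply: (addIr (tlact a 0)); rewrite -tlactD !add0r. Qed.
Lemma tract0 b : tract 0 b = 0.
Proof. by apply: (addIr (tract 0 b)); rewrite -tractD !add0r. Qed.

Lemma tens_laws : bimod_laws tlact tract.
Proof.
split.
- move=> a b; elim/tpure_ind=> [|x y ex ey|m n]; rewrite ?tlact0 ?addr0 //.
    by rewrite !tlactD ex ey addrACA.
  by rewrite !tlactE lactDl tpureDl.
- exact: tlactD.
- elim/tpure_ind=> [|x y ex ey|m n]; rewrite ?tlact0 //.
    by rewrite !tlactD ex ey.
  by rewrite tlactE lact1.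
- move=> a b; elim/tpure_ind=> [|x y ex ey|m n]; rewrite ?tlact0 //.
    by rewrite !tlactD ex ey.
  by rewrite !tlactE lactA.
- exact: tractD.
- move=> x a b; elim/tpure_ind: x=> [|x y ex ey|m n]; rewrite ?tract0 ?addr0 //.
    by rewrite !tractD ex ey addrACA.
  by rewrite !tractE ractDr tpureDr.
- elim/tpure_ind=> [|x y ex ey|m n]; rewrite ?tract0 //.
    by rewrite !tractD ex ey.
  by rewrite tractE ract1.
- move=> x a b; elim/tpure_ind: x=> [|x y ex ey|m n]; rewrite ?tract0 //.
    by rewrite !tractD ex ey.
  by rewrite !tractE ractA.
- move=> a x b; elim/tpure_ind: x=> [|x y ex ey|m n];
    rewrite ?tlact0 ?tract0 ?tlact0 //.
    by rewrite !(tlactD, tractD) ex ey.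
  by rewrite !(tlactE, tractE).
- move=> c; elim/tpure_ind=> [|x y ex ey|m n]; rewrite ?tlact0 ?tract0 //.
    by rewrite !(tlactD, tractD) ex ey.
  by rewrite !(tlactE, tractE) bcentral tpure_bal bcentral.
Qed.
Definition tens : bimod L S := Bimod tens_laws.
End Tensor.

Section KerCoker.
Variables (k : fieldType) (L R : kalg k).

Section Ker.
Variables (M N : bimod L R) (f : bhom M N).

Definition kerp : {pred M} := fun x => f x == 0.
Lemma kerp_zmod : zmod_closed kerp.
Proof.
split=> [|x y]; rewrite !unfold_in ?bfun0 // bfunD bfunN => /eqP-> /eqP->.
by rewrite subr0.
Qed.
HB.instance Definition _ := GRing.isZmodClosed.Build M kerp kerp_zmod.

Record kcarrier := KCarrier { kval :> M; kvalP : kval \in kerp }.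
HB.instance Definition _ := [isSub for kval].
HB.instance Definition _ := [Choice of kcarrier by <:].
HB.instance Definition _ := [SubChoice_isSubZmodule of kcarrier by <:].

Lemma kval_inj : injective kval.
Proof. exact: val_inj. Qed.

Lemma klactP a (x : kcarrier) : a *l kval x \in kerp.
Proof. by rewrite unfold_in bfunl (eqP (kvalP x)) lact0. Qed.
Lemma kractP (x : kcarrier) b : kval x *r b \in kerp.
Proof. by rewrite unfold_in bfunr (eqP (kvalP x)) ract0. Qed.

Lemma bker_laws :
  bimod_laws (fun a x => KCarrier (klactP a x)) (fun x b => KCarrier (kractP x b)).
Proof.
split=> *; apply: kval_inj; rewrite /=.
- exact: lactDl.
- exact: lactDr.
- exact: lact1.
- exact: lactA.
- exact: ractDl.
- exact: ractDr.
- exact: ract1.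
- exact: ractA.
- exact: lractA.
- exact: bcentral.
Qed.
Definition bker : bimod L R := Bimod bker_laws.

Variables (P : bimod L R) (g : bhom P M) (fg0 : forall x, f (g x) = 0).
Lemma bcorestrP x : g x \in kerp. Proof. by rewrite unfold_in fg0. Qed.
Definition bcorestr : bhom P bker.
Proof.
exists (fun x => KCarrier (bcorestrP x) : bker) => x y; apply: kval_inj => /=.
- exact: bfunD.
- exact: bfunl.
- exact: bfunr.
Defined.
End Ker.

Section Coker.
Variables (M N : bimod L R) (f : bhom M N).

Definition ckeq (x y : N) : bool := `[< exists m, x - y = f m >].
Lemma ckeq_equiv : equiv_class_of ckeq.
Proof.
have sy x y : ckeq x y -> ckeq y x.
  by move=> /asboolP[m e]; apply/asboolP; exists (- m); rewrite bfunN -e opprB.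
split=> [x|x y|y x z].
- by apply/asboolP; exists 0; rewrite subrr bfun0.
- by apply/idP/idP; apply: sy.
- move=> /asboolP[m e] /asboolP[n e']; apply/asboolP; exists (m + n).
  by rewrite bfunD -e -e' addrA subrK.
Qed.
Canonical ckeq_equivrel := EquivRelPack ckeq_equiv.
Canonical ckeq_encModRel := defaultEncModRel ckeq.

Definition ckcar := {eq_quot ckeq}.
HB.instance Definition _ := Choice.on ckcar.

Definition ckcls (x : N) : ckcar := \pi_ckcar x.
Lemma ckclsP x y : ckcls x = ckcls y <-> exists m, x - y = f m.
Proof. by split=> [/eqmodP/asboolP|h] //; apply/eqmodP/asboolP. Qed.
Lemma ckcls_repr x : ckcls (repr x) = x.
Proof. exact: reprK. Qed.
Lemma ckind (P : ckcar -> Prop) : (forall s, P (ckcls s)) -> forall x, P x.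
Proof. by move=> h x; rewrite -[x]ckcls_repr. Qed.

Definition ckop (h : N -> N) (x : ckcar) : ckcar := ckcls (h (repr x)).
Lemma ckopE (h : N -> N) x :
    (forall x y, h (x - y) = h x - h y) ->
    (forall m, exists m', h (f m) = f m') ->
  ckop h (ckcls x) = ckcls (h x).
Proof.
move=> hB hf; apply/ckclsP; rewrite -hB.
by have /ckclsP[m ->] := ckcls_repr (ckcls x).
Qed.

Definition ckadd (x y : ckcar) := ckcls (repr x + repr y).
Definition ckopp := ckop -%R.
Lemma ckaddE x y : ckadd (ckcls x) (ckcls y) = ckcls (x + y).
Proof.
apply/ckclsP.
have /ckclsP[m e] := ckcls_repr (ckcls x).
have /ckclsP[n e'] := ckcls_repr (ckcls y).
by exists (m + n); rewrite bfunD -e -e' opprD addrACA.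
Qed.
Lemma ckoppE x : ckopp (ckcls x) = ckcls (- x).
Proof.
by apply: ckopE => [*|m]; [rewrite opprD | exists (- m); rewrite bfunN].
Qed.
Lemma ckaddA : associative ckadd.
Proof. by elim/ckind=> x; elim/ckind=> y; elim/ckind=> z; rewrite !ckaddE addrA. Qed.
Lemma ckaddC : commutative ckadd.
Proof. by elim/ckind=> x; elim/ckind=> y; rewrite !ckaddE addrC. Qed.
Lemma ckadd0 : left_id (ckcls 0) ckadd.
Proof. by elim/ckind=> x; rewrite !ckaddE add0r. Qed.
Lemma ckaddN : left_inverse (ckcls 0) ckopp ckadd.
Proof. by elim/ckind=> x; rewrite ckoppE !ckaddE addNr. Qed.
HB.instance Definition _ := GRing.isZmodule.Build ckcar ckaddA ckaddC ckadd0 ckaddN.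

Lemma ckclsD x y : ckcls x + ckcls y = ckcls (x + y).
Proof. exact: ckaddE. Qed.

Definition cklact a := ckop (fun x => a *l x).
Definition ckract (x : ckcar) b := ckop (fun x => x *r b) x.
Lemma cklactE a x : cklact a (ckcls x) = ckcls (a *l x).
Proof.
by apply: ckopE => [*|m]; [rewrite lactDr lactN | exists (a *l m); rewrite bfunl].
Qed.
Lemma ckractE x b : ckract (ckcls x) b = ckcls (x *r b).
Proof.
by apply: (ckopE (h := fun x => x *r b)) => [*|m];
  [rewrite ractDl ractN | exists (m *r b); rewrite bfunr].
Qed.

Lemma bcoker_laws : bimod_laws cklact ckract.
Proof.
split.
- by move=> a b; elim/ckind=> x; rewrite !cklactE ckclsD lactDl.
- move=> a; elim/ckind=> x; elim/ckind=> y.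
  by rewrite ckclsD !cklactE ckclsD lactDr.
- by elim/ckind=> x; rewrite cklactE lact1.
- by move=> a b; elim/ckind=> x; rewrite !cklactE lactA.
- elim/ckind=> x; elim/ckind=> y b.
  by rewrite ckclsD !ckractE ckclsD ractDl.
- by elim/ckind=> x a b; rewrite !ckractE ckclsD ractDr.
- by elim/ckind=> x; rewrite ckractE ract1.
- by elim/ckind=> x a b; rewrite !ckractE ractA.
- by move=> a; elim/ckind=> x b; rewrite !(ckractE, cklactE) lractA.
- by move=> c; elim/ckind=> x; rewrite !(ckractE, cklactE) bcentral.
Qed.
Definition bcoker : bimod L R := Bimod bcoker_laws.
End Coker.

Section Dsum.
Variables (I : finType) (M : I -> bimod L R).

(* I is finite, so the product is the direct sum. *)
Definition dscar := forall i, M i.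
HB.instance Definition _ := gen_eqMixin dscar.
HB.instance Definition _ := gen_choiceMixin dscar.

Definition dsadd (x y : dscar) : dscar := fun i => x i + y i.
Definition dsopp (x : dscar) : dscar := fun i => - x i.
Lemma dsaddA : associative dsadd.
Proof. by move=> x y z; apply: functional_extensionality_dep => i; apply: addrA. Qed.
Lemma dsaddC : commutative dsadd.
Proof. by move=> x y; apply: functional_extensionality_dep => i; apply: addrC. Qed.
Lemma dsadd0 : left_id (fun=> 0) dsadd.
Proof. by move=> x; apply: functional_extensionality_dep => i; apply: add0r. Qed.
Lemma dsaddN : left_inverse (fun=> 0) dsopp dsadd.
Proof. by move=> x; apply: functional_extensionality_dep => i; apply: addNr. Qed.
HB.instance Definition _ := GRing.isZmodule.Build dscar dsaddA dsaddC dsadd0 dsaddN.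

Definition dslact a (x : dscar) : dscar := fun i => a *l x i.
Definition dsract (x : dscar) b : dscar := fun i => x i *r b.
Lemma bdsum_laws : bimod_laws dslact dsract.
Proof.
split=> *; apply: functional_extensionality_dep => i.
- exact: lactDl.
- exact: lactDr.
- exact: lact1.
- exact: lactA.
- exact: ractDl.
- exact: ractDr.
- exact: ract1.
- exact: ractA.
- exact: lractA.
- exact: bcentral.
Qed.
Definition bdsum : bimod L R := Bimod bdsum_laws.
End Dsum.
End KerCoker.

Section RelativeResolution.
Variables (k : fieldType) (L R : kalg k).
(* Relative homological algebra with respect to a class U of epimorphisms: a
   complex N <- X 0 <- X 1 <- ... is a U-resolution when the augmentation and
   each corestriction X (n+1) -> ker are in U. *)
Variable U : forall M N : bimod L R, bhom M N -> Prop.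

Definition rel_projective (P : bimod L R) : Prop :=
  forall (M N : bimod L R) (g : bhom M N), U g ->
  forall f : bhom P N, exists h : bhom P M, forall x, g (h x) = f x.

Definition rel_projective_resolution (N : bimod L R) (X : nat -> bimod L R)
    (eps : bhom (X 0%N) N) (d : forall n, bhom (X n.+1) (X n)) : Prop :=
  [/\ forall n, rel_projective (X n),
      U eps,
      exists e : forall x, eps (d 0%N x) = 0, U (bcorestr e) &
      forall n, exists e : forall x, d n (d n.+1 x) = 0, U (bcorestr e)].
End RelativeResolution.

(* Epimorphisms of (L, R)-bimodules that split over L and K, for i : K -> R. *)
Definition split_epi (k : fieldType) (L R K : kalg k) (i : khom K R)
    (M N : bimod L R) (f : bhom M N) : Prop :=
  (forall y, exists x, f x = y) /\
  exists g : bhom (bres (kid L) i N) (bres (kid L) i M), forall y, f (g y) = y.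

Section Subalgebra.
Variables (k : fieldType) (A : kalg k).

Record subkalg := Subkalg {
  skpred :> {pred A};
  sk_ring : subring_closed skpred;
  sk_emb : forall c, kemb A c \in skpred }.

Variable K : subkalg.
HB.instance Definition _ := GRing.isSubringClosed.Build A (skpred K) (sk_ring K).
Record skcar := SkCar { skval :> A; skvalP : skval \in skpred K }.
HB.instance Definition _ := [isSub for skval].
HB.instance Definition _ := [Choice of skcar by <:].
HB.instance Definition _ := GRing.SubChoice_isSubPzRing.Build A (skpred K) skcar (sk_ring K).

Definition skembf (c : k) : skcar := SkCar (sk_emb K c).
Fact skembf_zmod : zmod_morphism skembf.
Proof. by move=> x y; apply: val_inj; rewrite /= !rmorphB. Qed.
Fact skembf_monoid : monoid_morphism skembf.
Proof. by split=> [|x y]; apply: val_inj; rewrite /= ?rmorph1 ?rmorphM. Qed.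
HB.instance Definition _ := GRing.isZmodMorphism.Build k skcar skembf skembf_zmod.
HB.instance Definition _ := GRing.isMonoidMorphism.Build k skcar skembf skembf_monoid.

Fact skembfC c (x : skcar) : skembf c * x = x * skembf c.
Proof. by apply: val_inj; apply: kembC. Qed.
Definition sk_alg : kalg k := Eval unfold reverse_coercion in @Kalg k skcar skembf skembfC.
Definition sk_incl : khom sk_alg A := @Khom k sk_alg A \val (fun=> erefl).
End Subalgebra.

Section CrossedProduct.
Variables (k : fieldType) (A : kalg k) (V : lmodType k).

Local Notation kk := (kself k).
Local Notation bA := (bres (kid A) (kunit A) (breg A)).

Definition AV : bimod A kk := tens bA (bvect V).
Definition AVk : bimod kk kk := bres (kunit A) (kid kk) AV.
Definition VA : bimod kk kk := tens (bvect V) (bres (kunit A) (kid kk) bA).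
Definition VV : bimod kk kk := tens (bvect V) (bvect V).

Definition av (a : A) (v : V) : AV := tpure (M := bA) (N := bvect V) a v.
Definition va (v : V) (a : A) : VA :=
  tpure (M := bvect V) (N := bres (kunit A) (kid kk) bA) v a.
Definition vv (v w : V) : VV := tpure (M := bvect V) (N := bvect V) v w.

Section Structure.
Variables (chi : bhom VA AVk) (F : bhom VV AVk).

(* [avlift g] on a (x) v is g a v; for g := fun a v => a *l h v this is
   (mu_A (x) V) o (A (x) h). *)
Definition avlift (Z : zmodType) (g : A -> V -> Z) : AV -> Z :=
  tlift (M := bA) (N := bvect V) g.

(* [avr t a] = (mu_A (x) V)(A (x) chi)(t (x) a), the right A-action;
   [avF t w] = (mu_A (x) V)(A (x) F)(t (x) w);
   [vavF v t] = (mu_A (x) V)(A (x) F)(chi (x) V)(v (x) t);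
   [avM t u] = (mu_A (x) V)(mu_A (x) F)(A (x) chi (x) V)(t (x) u). *)
Definition avr (t : AV) (a : A) : AV := avlift (fun b v => b *l (chi (va v a) : AV)) t.
Definition nabla (t : AV) : AV := avr t 1.
Definition avF (t : AV) (w : V) : AV := avlift (fun b v => b *l (F (vv v w) : AV)) t.
Definition vavF (v : V) (t : AV) : AV := avlift (fun b w => avF (chi (va v b)) w) t.
Definition avM (t u : AV) : AV := avlift (fun b w => avF (avr t b) w) u.
End Structure.

(* Crossed product systems with preunit. The identities between composites of
   maps are written on pure tensors. *)
Record cpsystem := CPSystem {
  chi : bhom VA AVk;
  cpF : bhom VV AVk;
  nu : bhom (breg kk) AVk;
  chi_mul : forall v a b, chi (va v (a * b)) = avr chi (chi (va v a)) b;
  cpF_im : forall x, exists t, cpF x = nabla chi t;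
  nu_r : forall v, vavF chi cpF v (nu 1) = nabla chi (av 1 v);
  nu_l : forall v, avF cpF (nu 1) v = nabla chi (av 1 v);
  nu_comm : forall a, avr chi (nu 1) a = a *l (nu 1 : AV) }.

Variable C : cpsystem.

Definition twisted_module : Prop := forall v w a,
  avr (chi C) (cpF C (vv v w)) a = vavF (chi C) (cpF C) v (chi C (va w a)).

Definition cocycle : Prop := forall u v w,
  avF (cpF C) (cpF C (vv u v)) w = vavF (chi C) (cpF C) u (cpF C (vv v w)).

Local Notation X := (chi C).
Local Notation F := (cpF C).
Local Notation n1 := (nu C 1 : AV).

Lemma av_ind (P : AV -> Prop) :
  P 0 -> (forall x y, P x -> P y -> P (x + y)) ->
  (forall a v, P (av a v)) -> forall x, P x.
Proof. exact: tpure_ind. Qed.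

Lemma va_Dl v w a : va (v + w) a = va v a + va w a. Proof. exact: tpureDl. Qed.
Lemma va_Dr v a b : va v (a + b) = va v a + va v b. Proof. exact: tpureDr. Qed.
Lemma vv_Dl v w u : vv (v + w) u = vv v u + vv w u. Proof. exact: tpureDl. Qed.
Lemma vv_Dr v a b : vv v (a + b) = vv v a + vv v b. Proof. exact: tpureDr. Qed.
Lemma va_Z c v a : va (c *: v) a = va v (kemb A c * a).
Proof. exact: (tpure_bal (M := bvect V) (N := bres (kunit A) (kid kk) bA) v c a). Qed.
Lemma va_lZ c v a : va (c *: v) a = (c : kk) *l va v a.
Proof. by rewrite [RHS](tlactE (M := bvect V) (N := bres (kunit A) (kid kk) bA)). Qed.
Lemma vv_Z c v w : vv (c *: v) w = (c : kk) *l vv v w.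
Proof. by rewrite [RHS](tlactE (M := bvect V) (N := bvect V)). Qed.
Lemma vv_bal c v w : vv (c *: v) w = vv v (c *: w).
Proof. exact: (tpure_bal (M := bvect V) (N := bvect V) v c w). Qed.
Lemma av_lE a b v : a *l av b v = av (a * b) v.
Proof. exact: (tlactE (M := bA) (N := bvect V)). Qed.

Lemma avlift_av (Z : zmodType) (g : A -> V -> Z) :
    (forall a b v, g (a + b) v = g a v + g b v) ->
    (forall a v w, g a (v + w) = g a v + g a w) ->
    (forall a c v, g (a * kemb A c) v = g a (c *: v)) ->
  (forall a v, avlift g (av a v) = g a v) /\ {morph avlift g : x y / x + y}.
Proof.
move=> gl gr gb; split=> [a v|x y].
  exact: (tlift_pure (M := bA) (N := bvect V)).
exact: (tliftD (M := bA) (N := bvect V)).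
Qed.

Lemma chi_Z c v a : (X (va (c *: v) a) : AV) = kemb A c *l (X (va v a) : AV).
Proof. by rewrite va_lZ; exact: (bfunl X). Qed.
Lemma F_Z c v w : (F (vv (c *: v) w) : AV) = kemb A c *l (F (vv v w) : AV).
Proof. by rewrite vv_Z; exact: (bfunl F). Qed.

Lemma avr_spec a :
  (forall b v, avr X (av b v) a = b *l (X (va v a) : AV)) /\
  {morph avr X ^~ a : x y / x + y}.
Proof.
apply: avlift_av => [b c v|b v w|b c v].
- by rewrite lactDl.
- by rewrite va_Dl bfunD [LHS]lactDr.
- by rewrite chi_Z [RHS]lactA.
Qed.
Lemma avr_av b v a : avr X (av b v) a = b *l (X (va v a) : AV).
Proof. by case: (avr_spec a). Qed.
Lemma avrD a : {morph avr X ^~ a : x y / x + y}.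
Proof. by case: (avr_spec a). Qed.

Lemma avF_spec w :
  (forall b v, avF F (av b v) w = b *l (F (vv v w) : AV)) /\
  {morph avF F ^~ w : x y / x + y}.
Proof.
apply: avlift_av => [b c v|b v u|b c v].
- by rewrite lactDl.
- by rewrite vv_Dl bfunD [LHS]lactDr.
- by rewrite F_Z [RHS]lactA.
Qed.
Lemma avF_av b v w : avF F (av b v) w = b *l (F (vv v w) : AV).
Proof. by case: (avF_spec w). Qed.
Lemma avFD w : {morph avF F ^~ w : x y / x + y}.
Proof. by case: (avF_spec w). Qed.

Lemma add_eq0 (G H : zmodType) (f : G -> H) : {morph f : x y / x + y} -> f 0 = 0.
Proof. by move=> fD; apply: (addIr (f 0)); rewrite -fD !add0r. Qed.
Lemma avr0 a : avr X 0 a = 0.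
Proof. exact: (add_eq0 (f := fun t => avr X t a) (@avrD a)). Qed.
Lemma avF0 w : avF F 0 w = 0.
Proof. exact: (add_eq0 (f := fun t => avF F t w) (@avFD w)). Qed.

Lemma avr_l b t a : avr X (b *l t) a = b *l avr X t a.
Proof.
elim/av_ind: t => [|x y ex ey|c v]; first by rewrite !(lact0, avr0).
  by rewrite lactDr !avrD lactDr ex ey.
by rewrite av_lE !avr_av [RHS]lactA.
Qed.
Lemma avF_l b t w : avF F (b *l t) w = b *l avF F t w.
Proof.
elim/av_ind: t => [|x y ex ey|c v]; first by rewrite !(lact0, avF0).
  by rewrite lactDr !avFD lactDr ex ey.
by rewrite av_lE !avF_av [RHS]lactA.
Qed.
Lemma avr_Dr t a b : avr X t (a + b) = avr X t a + avr X t b.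
Proof.
elim/av_ind: t => [|x y ex ey|c v]; first by rewrite !avr0 addr0.
  by rewrite !avrD ex ey addrACA.
by rewrite !avr_av va_Dr bfunD [LHS]lactDr.
Qed.
Lemma avF_Dr t v w : avF F t (v + w) = avF F t v + avF F t w.
Proof.
elim/av_ind: t => [|x y ex ey|c u]; first by rewrite !avF0 addr0.
  by rewrite !avFD ex ey addrACA.
by rewrite !avF_av vv_Dr bfunD [LHS]lactDr.
Qed.
Lemma avr_A t a b : avr X (avr X t a) b = avr X t (a * b).
Proof.
elim/av_ind: t => [|x y ex ey|c u]; first by rewrite !avr0.
  by rewrite !avrD ex ey.
by rewrite !avr_av chi_mul avr_l.
Qed.
Lemma avr_Z t c a : avr X t (kemb A c * a) = kemb A c *l avr X t a.
Proof.
elim/av_ind: t => [|x y ex ey|b u]; first by rewrite !avr0 lact0.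
  by rewrite !avrD ex ey lactDr.
by rewrite !avr_av -va_Z chi_Z [LHS]lactA [RHS]lactA kembC.
Qed.
Lemma avF_Z t c v : avF F t (c *: v) = kemb A c *l avF F t v.
Proof.
elim/av_ind: t => [|x y ex ey|b u]; first by rewrite !avF0 lact0.
  by rewrite !avFD ex ey lactDr.
by rewrite !avF_av -vv_bal F_Z [LHS]lactA [RHS]lactA kembC.
Qed.

Lemma avM_spec t :
  (forall b w, avM X F t (av b w) = avF F (avr X t b) w) /\
  {morph avM X F t : x y / x + y}.
Proof.
apply: avlift_av => [b c v|b v w|b c v].
- by rewrite avr_Dr avFD.
- by rewrite avF_Dr.
- by rewrite -kembC avr_Z avF_l avF_Z.
Qed.
Lemma avM_av t b w : avM X F t (av b w) = avF F (avr X t b) w.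
Proof. by case: (avM_spec t). Qed.
Lemma avMD t : {morph avM X F t : x y / x + y}.
Proof. by case: (avM_spec t). Qed.
Lemma avM0 t : avM X F t 0 = 0. Proof. exact: add_eq0 (@avMD t). Qed.
Lemma avM_Dl s t u : avM X F (s + t) u = avM X F s u + avM X F t u.
Proof.
elim/av_ind: u => [|x y ex ey|b u]; first by rewrite !avM0 addr0.
  by rewrite !avMD ex ey addrACA.
by rewrite !avM_av avrD avFD.
Qed.
Lemma avM_l a t u : avM X F (a *l t) u = a *l avM X F t u.
Proof.
elim/av_ind: u => [|x y ex ey|b u]; first by rewrite !avM0 lact0.
  by rewrite !avMD ex ey lactDr.
by rewrite !avM_av avr_l avF_l.
Qed.
Lemma avM_mid t a u : avM X F t (a *l u) = avM X F (avr X t a) u.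
Proof.
elim/av_ind: u => [|x y ex ey|b u]; first by rewrite lact0 !avM0.
  by rewrite lactDr !avMD ex ey.
by rewrite av_lE !avM_av avr_A.
Qed.
Lemma avM_0l u : avM X F 0 u = 0.
Proof. by apply: (add_eq0 (f := fun t => avM X F t u)) => s t; rewrite avM_Dl. Qed.

Lemma vavFE v t : vavF X F v t = avM X F (av 1 v) t.
Proof.
rewrite /vavF /avM; congr (avlift _ t).
apply: functional_extensionality_dep => b; apply: functional_extensionality_dep => w.
by rewrite avr_av lact1.
Qed.

Lemma av1E a v : av a v = a *l av 1 v. Proof. by rewrite av_lE mulr1. Qed.

Lemma nablaE a v : nabla X (av a v) = a *l nabla X (av 1 v).
Proof. by rewrite av1E /nabla avr_l. Qed.
Lemma avM_nu t : avM X F t n1 = nabla X t.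
Proof.
elim/av_ind: t => [|x y ex ey|a v]; first by rewrite avM_0l /nabla avr0.
  by rewrite avM_Dl /nabla avrD ex ey.
by rewrite nablaE av1E avM_l -nu_r vavFE.
Qed.
Lemma nu_avM t : avM X F n1 t = nabla X t.
Proof.
elim/av_ind: t => [|x y ex ey|a v]; first by rewrite avM0 /nabla avr0.
  by rewrite avMD /nabla avrD ex ey.
by rewrite avM_av nablaE nu_comm avF_l nu_l.
Qed.

(* A x V, the image of nabla. *)
Definition in_AxV : {pred AV} := fun t => `[< exists u, t = nabla X u >].
Lemma in_AxVP t : reflect (nabla X t = t) (t \in in_AxV).
Proof.
apply: (iffP idP) => [/asboolP[u ->]|<-]; last by apply/asboolP; exists t.
by rewrite /nabla avr_A mulr1.
Qed.
Lemma in_AxV_zmod : zmod_closed in_AxV.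
Proof.
split=> [|x y /in_AxVP ex /in_AxVP ey]; apply/in_AxVP; first by rewrite /nabla avr0.
have e : nabla X (- y) = - y.
  rewrite -[in RHS]ey; apply: (addIr (nabla X y)).
  by rewrite addNr /nabla -avrD addNr avr0.
by rewrite -[in RHS]ex -[in RHS]e /nabla -avrD.
Qed.
HB.instance Definition _ := GRing.isZmodClosed.Build AV in_AxV in_AxV_zmod.

Record ecar := ECar { eval :> AV; evalP : eval \in in_AxV }.
HB.instance Definition _ := [isSub for eval].
HB.instance Definition _ := [Choice of ecar by <:].
HB.instance Definition _ := [SubChoice_isSubZmodule of ecar by <:].

Lemma eval_inj : injective eval. Proof. exact: val_inj. Qed.

Lemma nabla_in t : nabla X t \in in_AxV.
Proof. by apply/asboolP; exists t. Qed.
Definition enabla (t : AV) : ecar := ECar (nabla_in t).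

Lemma in_AxV_l a t : t \in in_AxV -> a *l t \in in_AxV.
Proof. by move/in_AxVP=> e; apply/in_AxVP; rewrite /nabla avr_l [avr _ _ _]e. Qed.
Lemma nu_in : n1 \in in_AxV.
Proof. by apply/in_AxVP; rewrite /nabla nu_comm lact1. Qed.
Lemma F_in v w : (F (vv v w) : AV) \in in_AxV.
Proof. by have [u e] := cpF_im C (vv v w); apply/asboolP; exists u. Qed.
Lemma avM_in t u : avM X F t u \in in_AxV.
Proof.
elim/av_ind: u => [|x y ex ey|b w]; first by rewrite avM0 rpred0.
  by rewrite avMD rpredD.
rewrite avM_av; elim/av_ind: (avr X t b) => [|x y ex ey|c v].
- by rewrite avF0 rpred0.
- by rewrite avFD rpredD.
- by rewrite avF_av in_AxV_l // F_in.
Qed.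

Definition ecp_of (tw : twisted_module) (co : cocycle) : Type := ecar.

Section Algebra.
Variables (tw : twisted_module) (co : cocycle).

Lemma avr_F t w a : avr X (avF F t w) a = avM X F t (X (va w a)).
Proof.
elim/av_ind: t => [|x y ex ey|b v]; first by rewrite avF0 avr0 avM_0l.
  by rewrite avFD avrD avM_Dl ex ey.
by rewrite avF_av avr_l tw [in RHS]av1E avM_l vavFE.
Qed.
Lemma avF_F t v w : avF F (avF F t v) w = avM X F t (F (vv v w)).
Proof.
elim/av_ind: t => [|x y ex ey|b u]; first by rewrite !avF0 avM_0l.
  by rewrite !avFD avM_Dl ex ey.
by rewrite avF_av avF_l co [in RHS]av1E avM_l vavFE.
Qed.
Lemma avMA s t u : avM X F s (avM X F t u) = avM X F (avM X F s t) u.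
Proof.
elim/av_ind: u => [|x y ex ey|c u]; first by rewrite !avM0.
  by rewrite !avMD ex ey.
elim/av_ind: t => [|x y ex ey|b w]; first by rewrite !(avM0, avM_0l).
  by rewrite !(avMD, avM_Dl) ex ey.
rewrite !avM_av avr_F avr_av avF_l avM_mid.
elim/av_ind: (X (va w c) : AV) => [|x y ex ey|c' w'].
- by rewrite !(avF0, avM0).
- by rewrite !(avFD, avMD) ex ey.
- by rewrite avF_av avM_mid avM_av avF_F.
Qed.

Local Notation E := (ecp_of tw co).
HB.instance Definition _ := GRing.Zmodule.on E.

Definition emul (x y : E) : E := ECar (avM_in (eval x) (eval y)).
Definition eone : E := ECar nu_in.

Lemma emulA : associative emul.
Proof. by move=> x y z; apply: eval_inj; apply: avMA. Qed.
Lemma emul1 : left_id eone emul.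
Proof.
by move=> x; apply: eval_inj; rewrite [LHS]nu_avM; apply/in_AxVP/(evalP x).
Qed.
Lemma emulr1 : right_id eone emul.
Proof.
by move=> x; apply: eval_inj; rewrite [LHS]avM_nu; apply/in_AxVP/(evalP x).
Qed.
Lemma emulDl : left_distributive emul +%R.
Proof. by move=> x y z; apply: eval_inj; apply: avM_Dl. Qed.
Lemma emulDr : right_distributive emul +%R.
Proof. by move=> x y z; apply: eval_inj; apply: avMD. Qed.
HB.instance Definition _ :=
  GRing.Zmodule_isPzRing.Build E emulA emul1 emulr1 emulDl emulDr.

Definition jnuf (a : A) : E := ECar (in_AxV_l a nu_in).
Fact jnu_zmod : zmod_morphism jnuf.
Proof.
move=> a b; apply: eval_inj => /=.
by apply: (addIr (b *l n1)); rewrite -lactDl !subrK.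
Qed.
Lemma jnu_mul a (x : E) : eval (jnuf a * x) = a *l eval x.
Proof. by rewrite [LHS]avM_l nu_avM (in_AxVP _ (evalP x)). Qed.
Lemma mul_jnu a (x : E) : eval (x * jnuf a) = avr X (eval x) a.
Proof. by rewrite [LHS]avM_mid avM_nu /nabla avr_A mulr1. Qed.
Fact jnu_monoid : monoid_morphism jnuf.
Proof.
split=> [|a b]; apply: eval_inj; first exact: lact1.
by rewrite jnu_mul; apply/esym/lactA.
Qed.
HB.instance Definition _ := GRing.isZmodMorphism.Build A E jnuf jnu_zmod.
HB.instance Definition _ := GRing.isMonoidMorphism.Build A E jnuf jnu_monoid.

Fact eembC c (x : E) : jnuf (kemb A c) * x = x * jnuf (kemb A c).
Proof.
apply: eval_inj; rewrite jnu_mul mul_jnu -[in RHS](mulr1 (kemb A c)) avr_Z.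
by rewrite [avr _ _ _](in_AxVP _ (evalP x)).
Qed.

Definition ecp : kalg k :=
  Eval unfold reverse_coercion in @Kalg k E (jnuf \o kemb A) eembC.
Definition jnu : khom A ecp :=
  Eval unfold reverse_coercion in @Khom k A ecp jnuf (fun=> erefl).
Definition gamma (v : V) : ecp := enabla (av 1 v).
End Algebra.
End CrossedProduct.

(* Two-sided normalized bar construction of the R-algebra B (structure map f)
   with coefficients: bar r = M (x)_R (B/f(R))^{(x)_R r} (x)_R N and
   lbar r = M (x)_R (B/f(R))^{(x)_R r}. *)
Section Bar.
Variables (k : fieldType) (R B : kalg k) (f : khom R B).

Definition bhom_of : bhom (breg R) (bres f f (breg B)) :=
  @Bhom k R R (breg R) (bres f f (breg B)) f (rmorphD f) (rmorphM f) (rmorphM f).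

Definition bbar : bimod R R := bcoker bhom_of.
Definition bcls (x : B) : bbar := @ckcls k R R (breg R) (bres f f (breg B)) bhom_of x.

Variables (L S : kalg k) (M : bimod L B) (N : bimod B S).

Fixpoint lbar (r : nat) : bimod L R :=
  if r is r'.+1 then tens (lbar r') bbar else bres (kid L) f M.

Definition rmod : bimod R S := bres f (kid S) N.

Definition bar (r : nat) : bimod L S := tens (lbar r) rmod.

(* Only b 0, ..., b (r-1) matter in [lpure r m b]. *)
Fixpoint lpure (r : nat) (m : M) (b : nat -> B) : lbar r :=
  match r with
  | 0 => m
  | r'.+1 => tpure (lpure r' m b) (bcls (b r'))
  end.

Definition bpure (r : nat) (m : M) (b : nat -> B) (n : N) : bar r :=
  tpure (N := rmod) (lpure r m b) n.

Definition merge_at (i : nat) (b : nat -> B) : nat -> B :=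
  fun j => if (j < i)%N then b j else if j == i then b i * b i.+1 else b j.+1.

(* m (x) b_0 (x) ... (x) b_{r-1} (x) n |-> alternating sum of the products of
   consecutive factors. It is defined on the representatives b_i in B: on the
   quotient B/f(R) only the whole sum makes sense. *)
Definition bar_d (r : nat) : bar r -> bar r.-1 :=
  match r with
  | 0 => fun=> 0
  | r'.+1 =>
    addext (fun p : M * (nat -> B) * N => bpure r'.+1 p.1.1 p.1.2 p.2)
        (fun p => let: (m, b, n) := p in
           bpure r' (m *r b 0%N) (fun j => b j.+1) n
         + \sum_(0 <= i < r') bpure r' m (merge_at i b) n *~ (-1) ^+ i.+1
         + bpure r' m b (b r' *l n) *~ (-1) ^+ r'.+1)
  end.
End Bar.

Section Resolution.
Variables (k : fieldType) (A : kalg k) (V : lmodType k) (C : cpsystem A V).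
Variables (tw : twisted_module C) (co : cocycle C) (K : subkalg A).

Local Notation E := (ecp tw co).
Local Notation j := (jnu tw co).
Local Notation i := (sk_incl K).

Definition jK : khom (sk_alg K) E := @Khom k (sk_alg K) E (j \o i) (fun=> erefl).

(* Pres s = E (x)_A E~^{(x)_A s};  Qres r s = Pres s (x)_K (A/K)^{(x)_K r};
   Yres s = Pres s (x)_A E;  Xres r s = Qres r s (x)_K E. *)
Definition Yres (s : nat) : bimod E E := bar j (breg E) (breg E) s.
Definition Pres (s : nat) : bimod E A := lbar j (breg E) s.
Definition EAE : bimod A E := bres j (kid E) (breg E).
Definition Qres (r s : nat) : bimod E (sk_alg K) := lbar i (Pres s) r.
Definition Xres (r s : nat) : bimod E E := bar i (Pres s) EAE r.

Definition xpure (r s : nat) (y : Qres r s) (x : E) : Xres r s :=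
  tpure (N := rmod i EAE) y x.
Definition ypure (s : nat) (y : Pres s) (x : E) : Yres s :=
  tpure (N := rmod j (breg E)) y x.

Definition ups (s : nat) : Xres 0 s -> Yres s :=
  tlift (fun (y : Qres 0 s) (x : rmod i EAE) => ypure y x).

Definition dY (s : nat) : Yres s -> Yres s.-1 := @bar_d _ _ _ j _ _ (breg E) (breg E) s.

(* With E (x)_A E~^{(x)s} (x)_A A = Pres s and A (x)_A E = E, the map
   E (x)_A E~^{(x)s} (x)_A (bar differential of A over K) (x)_A E is the bar
   differential of A over K with coefficients in Pres s and E. *)
Definition d0 (r s : nat) (x : Xres r s) : Xres r.-1 s :=
  bar_d x *~ (-1) ^+ s.

Definition sig0 (s : nat) : Yres s -> Xres 0 s :=
  tlift (fun (y : Pres s) (x : rmod j (breg E)) =>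
    avlift (fun a v => xpure (r := 0) (y *r a) (gamma tw co v)) (eval x)).

Definition sig (r s : nat) : Xres r s -> Xres r.+1 s :=
  tlift (fun (y : Qres r s) (x : rmod i EAE) =>
    avlift (fun a v => xpure (r := r.+1) (tpure y (bcls i a)) (gamma tw co v)) (eval x)
      *~ (-1) ^+ (r + s).+1).

(* Transport along r = r' and s = s'; zero if the bidegrees differ. *)
Definition Xcast (r s r' s' : nat) (x : Xres r s) : Xres r' s' :=
  match r =P r', s =P s' with
  | ReflectT er, ReflectT es => ecast t (Xres r' t) es (ecast t (Xres t s) er x)
  | _, _ => 0
  end.

(* The right E-linear map that agrees with f on the elements y (x) 1_E. *)
Definition ebilin_ext (r s : nat) (Z : bimod E E) (f : Xres r s -> Z) : Xres r s -> Z :=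
  tlift (fun (y : Qres r s) (x : rmod i EAE) => f (xpure y 1) *r (x : E)).

(* Recursive formula for d^l (l >= 1) on z = y (x) 1_E: the sum starts at m = 1
   if r = 0 and at m = 0 if r > 0; for l = 1 and r > 0 it is - sigma d^1 d^0. *)
Definition dstep (d : forall l r s, Xres r s -> Xres (r + l).-1 (s - l))
    (l r s : nat) (z : Xres r s) : Xres (r + l).-1 (s - l) :=
  if (l == 1%N) && (r == 0%N) then Xcast _ _ (sig0 (dY (ups (Xcast 0 s z))))
  else - \sum_((r == 0%N) <= m < l) Xcast _ _ (sig (d (l - m)%N _ _ (d m _ _ z))).

(* d^l_{rs} calls d^l'_{r's'} only with l' + r' < l + r, so fuel l + r + 1
   suffices; [dmap_0] and [dmap_rec] are the resulting equations. *)
Fixpoint dfuel (n l r s : nat) : Xres r s -> Xres (r + l).-1 (s - l) :=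
  if n is n'.+1 then
    if l is 0 then fun x => Xcast _ _ (d0 x) else ebilin_ext (@dstep (dfuel n') l r s)
  else fun=> 0.

Definition dmap (l r s : nat) : Xres r s -> Xres (r + l).-1 (s - l) :=
  @dfuel (l + r).+1 l r s.

Lemma dstep_eq d d' l r s :
  (forall l' r', (l' + r' < l + r)%N -> @d l' r' = @d' l' r') ->
  (0 < l)%N -> @dstep d l r s = @dstep d' l r s.
Proof.
move=> dd' l0; apply: functional_extensionality_dep => z; rewrite /dstep.
case: ifP => // _; congr (- _); apply: eq_big_nat => m /andP[rm ml].
have mr1 : (0 < r + m)%N by case: (posnP r) rm => [->|]; case: (m) (r) => [|?] [|?].
rewrite (dd' m) ?ltn_add2r // (dd' (l - m)%N) //.
by rewrite -ltnS -addnS prednK // addnCA subnK ?(ltnW ml) // addnC.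
Qed.

Lemma dfuel_stable n n' l r :
  (l + r < n)%N -> (l + r < n')%N -> @dfuel n l r = @dfuel n' l r.
Proof.
elim: n n' l r => [//|n IH] [//|n'] [//|l] r len len'.
apply: functional_extensionality_dep => s.
apply: (congr1 (fun f => ebilin_ext f)); apply: dstep_eq => // l' r' lt.
by apply: IH; apply: leq_trans lt _.
Qed.

Lemma dmap_0 r s (x : Xres r s) : @dmap 0 r s x = Xcast _ _ (d0 x).
Proof. by []. Qed.

Lemma dmap_rec l r s : (0 < l)%N -> @dmap l r s = ebilin_ext (@dstep dmap l r s).
Proof.
case: l => [//|l] _.
have -> : @dmap l.+1 r s = ebilin_ext (@dstep (@dfuel (l.+1 + r)) l.+1 r s) by [].
rewrite (@dstep_eq _ dmap) // => l' r' lt.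
by rewrite (@dfuel_stable _ (l' + r').+1).
Qed.

Definition Xtot (n : nat) : bimod E E :=
  bdsum (fun r : 'I_n.+1 => Xres r (n - r)).

Definition dtot (n : nat) (x : Xtot n) : Xtot n.-1 := fun p =>
  \sum_(r < n.+1) \sum_((r == 0 :> nat) <= l < (n - r).+1)
     Xcast p (n.-1 - p) (@dmap l r (n - r) (x r)).

Definition mubar (x : Xtot 0) : E :=
  tlift (M := Qres 0 0) (N := rmod i EAE) (fun y z : E => y * z) (x ord0).

(* The image of K (x)_k V in A (x)_k V. *)
Definition inKV (t : AV A V) : Prop :=
  exists q : seq (sk_alg K * V), t = \sum_(p <- q) av (i p.1) p.2.

Definition chi_stable : Prop := forall q : seq (V * sk_alg K),
  inKV (chi C (\sum_(p <- q) va p.1 (i p.2))).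
End Resolution.

Section SigmaPure.
Variables (k : fieldType) (A : kalg k) (V : lmodType k) (C : cpsystem A V).
Variables (tw : twisted_module C) (co : cocycle C) (K : subkalg A).

Local Notation E := (ecp tw co).
Local Notation i := (sk_incl K).

Lemma gammaD v w : gamma tw co (v + w) = gamma tw co v + gamma tw co w.
Proof.
apply: eval_inj; rewrite /= -[RHS]avrD; congr (nabla _ _).
exact: (tpureDr (M := bres (kid A) (kunit A) (breg A)) (N := bvect V)).
Qed.

Lemma gammaZ c v : gamma tw co (c *: v) = (kemb E c : E) * gamma tw co v.
Proof.
apply: eval_inj; rewrite [RHS]jnu_mul -[RHS]avr_l av_lE.
congr (nabla _ _); rewrite kembC.
exact/esym/(tpure_bal (M := bres (kid A) (kunit A) (breg A)) (N := bvect V)).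
Qed.

Lemma avlift_gamma (Z : zmodType) (Q : bimod E (sk_alg K))
    (h : A -> Q) (b : Q -> E -> Z) :
    {morph h : x y / x + y} ->
    (forall a c, h (a * kemb A c) = h a *r kemb (sk_alg K) c) ->
    (forall y y' x, b (y + y') x = b y x + b y' x) ->
    (forall y x x', b y (x + x') = b y x + b y x') ->
    (forall y c x, b (y *r c) x = b y ((jK tw co K c : E) * x)) ->
  (forall a v, avlift (fun a v => b (h a) (gamma tw co v)) (av a v)
                = b (h a) (gamma tw co v)) /\
  {morph avlift (fun a v => b (h a) (gamma tw co v)) : x y / x + y}.
Proof.
move=> hD hc bDl bDr bB; apply: avlift_av => *.
- by rewrite hD bDl.
- by rewrite gammaD bDr.
- by rewrite hc bB gammaZ.
Qed.

Lemma xpureDl r s (y y' : Qres tw co K r s) x :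
  xpure (y + y') x = xpure y x + xpure y' x.
Proof. exact: tpureDl. Qed.
Lemma xpureDr r s (y : Qres tw co K r s) x x' :
  xpure y (x + x') = xpure y x + xpure y x'.
Proof. exact: tpureDr. Qed.
Lemma xpure_bal r s (y : Qres tw co K r s) c x :
  xpure (y *r c) x = xpure y ((jK tw co K c : E) * x).
Proof. exact: tpure_bal. Qed.

Lemma ups_pure s (y : Qres tw co K 0 s) x : ups (xpure y x) = ypure y x.
Proof.
apply: (tlift_pure (N := rmod i (EAE tw co))) => *.
- exact: tpureDl.
- exact: tpureDr.
- exact: (tpure_bal (N := rmod (jnu tw co) (breg E))).
Qed.

Lemma sig0_pure s (y : Pres tw co s) x :
  sig0 K (ypure y x) =
  avlift (fun a v => xpure (r := 0) (K := K) (y *r a) (gamma tw co v)) (eval x).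
Proof.
have sp (z : Pres tw co s) := @avlift_gamma (Xres tw co K 0 s) (Qres tw co K 0 s)
  (fun a => z *r a) (@xpure _ _ _ _ _ _ _ 0 s) (ractDr z)
  (fun a c => esym (ractA z a (kemb A c)))
  (@xpureDl 0 s) (@xpureDr 0 s) (@xpure_bal 0 s).
apply: (tlift_pure (N := rmod (jnu tw co) (breg E))) => [m m' n|m n n'|m c n].
- have [e D] := sp (m + m'); have [e1 D1] := sp m; have [e2 D2] := sp m'.
  elim/av_ind: (eval n) => [|t u et eu|a v].
  + by rewrite (add_eq0 D) (add_eq0 D1) (add_eq0 D2) addr0.
  + by rewrite D D1 D2 et eu addrACA.
  + by rewrite e e1 e2 -xpureDl; congr (xpure _ _); exact: (ractDl m m' a).
- by have [_ D] := sp m; apply: D.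
- have [e D] := sp (m *r c); have [e1 D1] := sp m.
  rewrite [X in _ = avlift _ X](@jnu_mul _ _ _ _ tw co c n); elim/av_ind: (eval n) => [|t u et eu|a v].
  + by rewrite lact0 (add_eq0 D) (add_eq0 D1).
  + by rewrite lactDr D D1 et eu.
  + by rewrite av_lE e e1; congr (xpure _ _); exact: (ractA m c a).
Qed.

Lemma bclsD x y : bcls i (x + y) = bcls i x + bcls i y.
Proof. exact/esym/ckclsD. Qed.

Lemma sig_pure r s (y : Qres tw co K r s) x :
  sig (xpure y x) =
  avlift (fun a v => xpure (r := r.+1) (tpure y (bcls i a)) (gamma tw co v))
    (eval x) *~ (-1) ^+ (r + s).+1.
Proof.
have hD (z : Qres tw co K r s) :
    {morph (fun a => tpure z (bcls i a) : Qres tw co K r.+1 s) : a b / a + b}.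
  by move=> a b; rewrite bclsD; apply: tpureDr.
have hc (z : Qres tw co K r s) a c : (tpure z (bcls i (a * kemb A c)) : Qres tw co K r.+1 s)
    = (tpure z (bcls i a) : Qres tw co K r.+1 s) *r kemb (sk_alg K) c.
  rewrite [RHS](tractE (N := bbar i)); congr (tpure _ _).
  exact/esym/(@ckractE _ _ _ _ _ (bhom_of i)).
have sp z := @avlift_gamma (Xres tw co K r.+1 s) (Qres tw co K r.+1 s)
  (fun a => tpure z (bcls i a)) (@xpure _ _ _ _ _ _ _ r.+1 s) (hD z) (hc z)
  (@xpureDl r.+1 s) (@xpureDr r.+1 s) (@xpure_bal r.+1 s).
apply: (tlift_pure (N := rmod i (EAE tw co))) => [m m' n|m n n'|m c n].
- rewrite -mulrzDl; congr (_ *~ _).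
  have [e D] := sp (m + m'); have [e1 D1] := sp m; have [e2 D2] := sp m'.
  elim/av_ind: (eval n) => [|t u et eu|a v].
  + by rewrite (add_eq0 D) (add_eq0 D1) (add_eq0 D2) addr0.
  + by rewrite D D1 D2 et eu addrACA.
  + by rewrite e e1 e2 -xpureDl -tpureDl.
- by rewrite -mulrzDl; congr (_ *~ _); have [_ D] := sp m; apply: D.
- congr (_ *~ _); have [e D] := sp (m *r c); have [e1 D1] := sp m.
  rewrite [X in _ = avlift _ X](@jnu_mul _ _ _ _ tw co (i c) n); elim/av_ind: (eval n) => [|t u et eu|a v].
  + by rewrite lact0 (add_eq0 D) (add_eq0 D1).
  + by rewrite lactDr D D1 et eu.
  + rewrite av_lE e e1 tpure_bal; congr (@xpure _ _ _ _ _ _ _ r.+1 s _ _).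
    by congr (tpure _ _); apply: (@cklactE _ _ _ _ _ (bhom_of i)).
Qed.
End SigmaPure.

(* Main.v *)
(* A tensor power M (x)_R (B/R)^{(x) r} carries the right B-action of
   noncommutative differential forms, which makes the normalized bar differential
   y (x) c (x) n |-> (-1)^r (y c (x) n - y (x) c n). With this formula the rows
   X_{*s} -> Y_s are contracted by sigma^0 and the bar complex Y -> E by
   y (x) x |-> (-1)^{s+1} y (x) x~ (x) 1; stability of K under chi makes sigma^0
   right K-linear.

   The maps d^l are those of the perturbation lemma: on generators y (x) 1_E,
   D l = - sigma^0 sum_{m<l} D (l-m) D m, up to the term sigma^0 partial upsilon
   of d^1_{0s}. Induction on l and on the column index r gives
   sum_{m<=l} D (l-m) D m = 0, so the total differential has square zero. A cycle
   t is a boundary: subtracting the differential of sigma^0 s upsilon t, with s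
   the contraction of Y, kills upsilon t, and then each correction by sigma^0
   lowers the filtration by s. All corrections are (E, K)-linear, whence the
   splitting. Projectivity holds because bimodule maps out of Q (x)_K E are
   (E, K)-bimodule maps out of Q. *)
From HB Require Import structures.
Require Import Defs.
From mathcomp Require Import all_boot all_algebra.
From mathcomp Require Import boolp.
Set Implicit Arguments.
Unset Strict Implicit.
Unset Printing Implicit Defensive.
Import GRing.Theory.
Local Open Scope ring_scope.
Local Open Scope bimod_scope.

(** * Additive maps, pure tensors and signs *)

Section Generalities.
Variables (k : fieldType).

(** The sum of the [b i] over any expression of [x] in the [gen i] equals [h x], so the expression
    picked by [addext] does not matter. This is how [bar_d] becomes a map defined by tensor
    lifts. *)
Lemma addext_additive (G Z : zmodType) (I : Type) (gen : I -> G) (b : I -> Z)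
    (h : G -> Z) :
  {morph h : x y / x + y} -> (forall i, h (gen i) = b i) ->
  (forall x, exists s : seq I, x = \sum_(i <- s) gen i) ->
  addext gen b =1 h.
Proof.
move=> hD hb sp x; have [s xE] := sp x.
have hs t : h (\sum_(i <- t) gen i) = \sum_(i <- t) b i.
  rewrite (big_morph h hD (add_eq0 hD)).
  by apply: eq_bigr => i _; apply: hb.
rewrite (addext_eq (s := s)) // => [|s1 s2 e]; first by rewrite xE hs.
by rewrite -!hs e.
Qed.

Lemma tens_eq (L R S : kalg k) (M : bimod L R) (N : bimod R S) (Z : zmodType)
    (f g : tens M N -> Z) :
  {morph f : x y / x + y} -> {morph g : x y / x + y} ->
  (forall m n, f (tpure m n) = g (tpure m n)) -> f =1 g.
Proof.
move=> fD gD e; elim/tpure_ind=> [|x y ex ey|m n]; last exact: e.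
  by rewrite (add_eq0 fD) (add_eq0 gD).
by rewrite fD gD ex ey.
Qed.

Lemma tpure0l (L R S : kalg k) (M : bimod L R) (N : bimod R S) n :
  tpure (0 : M) n = 0 :> tens M N.
Proof. by apply: (add_eq0 (f := fun m => tpure m n : tens M N)) => x y; exact: (tpureDl x y n). Qed.
Lemma tpure0r (L R S : kalg k) (M : bimod L R) (N : bimod R S) m :
  tpure m (0 : N) = 0 :> tens M N.
Proof. by apply: (add_eq0 (f := fun n => tpure m n : tens M N)) => x y; exact: (tpureDr m x y). Qed.
Lemma tpureNl (L R S : kalg k) (M : bimod L R) (N : bimod R S) m n :
  tpure (- m : M) n = - tpure m n :> tens M N.
Proof. by apply: (addIr (tpure m n)); rewrite -tpureDl !addNr tpure0l. Qed.
Lemma tpureBl (L R S : kalg k) (M : bimod L R) (N : bimod R S) m m' n :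
  tpure (m - m' : M) n = tpure m n - tpure m' n :> tens M N.
Proof. by rewrite tpureDl tpureNl. Qed.
Lemma tpure_suml (L R S : kalg k) (M : bimod L R) (N : bimod R S) n
    (I : Type) (s : seq I) (P : pred I) (F : I -> M) :
  tpure (\sum_(i <- s | P i) F i) n = \sum_(i <- s | P i) tpure (F i) n :> tens M N.
Proof.
by apply: (big_morph (fun m => tpure m n)) => [x y|]; rewrite (tpureDl, tpure0l).
Qed.
Lemma tpure_sumr (L R S : kalg k) (M : bimod L R) (N : bimod R S) m
    (I : Type) (s : seq I) (P : pred I) (F : I -> N) :
  tpure m (\sum_(i <- s | P i) F i) = \sum_(i <- s | P i) tpure m (F i) :> tens M N.
Proof.
by apply: (big_morph (fun n => tpure m n)) => [x y|]; rewrite (tpureDr, tpure0r).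
Qed.

Lemma mulrz_signK (M : zmodType) (x : M) n : x *~ (-1) ^+ n *~ (-1) ^+ n = x.
Proof. by rewrite -mulrzA -expr2 sqrr_sign. Qed.
Lemma mulrz_signS (M : zmodType) (x : M) n : x *~ (-1) ^+ n.+1 = - (x *~ (-1) ^+ n).
Proof. by rewrite exprS mulN1r mulrNz. Qed.
Lemma morphMz (G H : zmodType) (f : G -> H) z :
  {morph f : x y / x + y} -> {morph f : x / x *~ z}.
Proof.
move=> fD x; have f0 := add_eq0 fD.
have fN y : f (- y) = - f y by apply: (addIr (f y)); rewrite -fD !addNr.
have fMn y n : f (y *+ n) = f y *+ n by elim: n => // n IH; rewrite !mulrS fD IH.
by case: z => n; rewrite ?NegzE ?mulrNz ?fN -!pmulrn fMn.
Qed.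
Lemma bfunMz (L R : kalg k) (M N : bimod L R) (f : bhom M N) x z :
  f (x *~ z) = f x *~ z.
Proof. exact: (morphMz z (bfunD f)). Qed.
Lemma bfunB (L R : kalg k) (M N : bimod L R) (f : bhom M N) x y :
  f (x - y) = f x - f y.
Proof. by rewrite bfunD bfunN. Qed.
Lemma lactMz (L R : kalg k) (M : bimod L R) a (x : M) z :
  a *l (x *~ z) = (a *l x) *~ z.
Proof. exact: (morphMz z (lactDr a)). Qed.
Lemma ractMz (L R : kalg k) (M : bimod L R) (x : M) b z :
  (x *~ z) *r b = (x *r b) *~ z.
Proof. by apply: (morphMz z (f := fun x => x *r b)) => m n; rewrite ractDl. Qed.
Lemma lactB (L R : kalg k) (M : bimod L R) a (x y : M) :
  a *l (x - y) = a *l x - a *l y.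
Proof. by rewrite lactDr lactN. Qed.
Lemma ractB (L R : kalg k) (M : bimod L R) (x y : M) b :
  (x - y) *r b = x *r b - y *r b.
Proof. by rewrite ractDl ractN. Qed.
End Generalities.

(** * The normalized bar construction *)

Section BarAction.
Variables (k : fieldType) (R B : kalg k) (f : khom R B) (L : kalg k) (M : bimod L B).

Local Notation bc := (bcls f).

Lemma bcls_add x y : bc (x + y) = bc x + bc y :> bbar f.
Proof. exact/esym/ckclsD. Qed.
Lemma bcls_f c : bc (f c) = 0 :> bbar f.
Proof. exact: ((ckclsP (bhom_of f) (f c) 0).2 (ex_intro _ c (subr0 _))). Qed.
Lemma bcls_l c x : bc (f c * x) = c *l (bc x : bbar f).
Proof. exact/esym/(@cklactE _ _ _ _ _ (bhom_of f)). Qed.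
Lemma bcls_r c x : bc (x * f c) = (bc x : bbar f) *r c.
Proof. exact/esym/(@ckractE _ _ _ _ _ (bhom_of f)). Qed.
Lemma bcls_repr (c : bbar f) : bc (repr c) = c.
Proof. exact: (@ckcls_repr _ _ _ _ _ (bhom_of f)). Qed.
Lemma bcls_ind (P : bbar f -> Prop) : (forall x, P (bc x)) -> forall c, P c.
Proof. exact: (@ckind _ _ _ _ _ (bhom_of f)). Qed.

(** Formulas on B/f(R) are written with [repr]. Such a formula may use any representative as soon as
    it is additive and vanishes on f(R). *)
Lemma bcls_eq_repr x : exists c, repr (bc x : bbar f) = x + f c :> B.
Proof.
have [c e] := (ckclsP (bhom_of f) _ _).1 (bcls_repr (bc x)).
by exists c; rewrite -[X in _ = _ + X]e addrC subrK.
Qed.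

(* (y (x) dc) b = y (x) d(cb) - yc (x) db, where dc is the class of c. *)
Fixpoint bact (r : nat) : lbar f M r -> B -> lbar f M r :=
  match r with
  | 0 => fun m b => (m : M) *r b
  | r'.+1 => fun x b =>
      tlift (fun (y : lbar f M r') (c : bbar f) =>
        (tpure y (bc (repr c * b : B)) : tens (lbar f M r') (bbar f))
        - tpure (bact y (repr c)) (bc b)) x
  end.

(** The two halves go through one induction: the action in degree [r.+1] is well defined because in
    degree [r] the action is associative and extends that of R. *)
Definition bact_laws r := bimod_laws (@lact _ _ _ (lbar f M r)) (@bact r)
  /\ forall y c, bact y (f c) = y *r c :> lbar f M r.

Section Step.
Variables (r : nat) (ih : bact_laws r).
Local Notation P := (lbar f M r).

Let Pb : bimod L B := Bimod ih.1.
Let actDl (x y : P) b : bact (x + y) b = bact x b + bact y b.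
Proof. exact: (@ractDl _ _ _ Pb). Qed.
Let actDr (x : P) a b : bact x (a + b) = bact x a + bact x b.
Proof. exact: (@ractDr _ _ _ Pb). Qed.
Let actA (x : P) a b : bact (bact x a) b = bact x (a * b).
Proof. exact: (@ractA _ _ _ Pb). Qed.
Let actl a (x : P) b : bact (a *l x) b = a *l bact x b.
Proof. exact: (@lractA _ _ _ Pb). Qed.
Let actf (x : P) c : bact x (f c) = x *r c.
Proof. exact: ih.2. Qed.
Let actfl (x : P) c b : bact (x *r c) b = bact x (f c * b).
Proof. by rewrite -actf actA. Qed.

Let beta (y : P) (c b : B) : lbar f M r.+1 :=
  (tpure y (bc (c * b)) : tens P (bbar f)) - tpure (bact y c) (bc b).

(** The two terms agree by balancing over R, as f(c) acts like c. Hence [beta y c b] depends only on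
    the class of [c]. *)
Let betaf (y : P) c b : beta y (f c) b = 0.
Proof.
apply/eqP; rewrite subr_eq0; apply/eqP.
by rewrite actf bcls_l tpure_bal.
Qed.
Let betaD (y : P) c d b : beta y (c + d) b = beta y c b + beta y d b.
Proof.
rewrite /beta mulrDl bcls_add actDr.
rewrite [tpure y _]tpureDr [tpure (_ + _) _]tpureDl.
by rewrite opprD addrACA.
Qed.
Let beta_repr (y : P) c b : beta y (repr (bc c : bbar f)) b = beta y c b.
Proof. by have [d ->] := bcls_eq_repr c; rewrite betaD betaf addr0. Qed.

Let gam b (y : P) (c : bbar f) := beta y (repr c) b.
Let gamDl b y y' c : gam b (y + y') c = gam b y c + gam b y' c.
Proof.
rewrite /gam /beta actDl [tpure (y + y') _]tpureDl.
by rewrite [tpure (_ + _) _]tpureDl opprD addrACA.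
Qed.
Let gamDr b y c d : gam b y (c + d) = gam b y c + gam b y d.
Proof.
elim/bcls_ind: c => c; elim/bcls_ind: d => d.
by rewrite -bcls_add /gam !beta_repr betaD.
Qed.
Let gam_bal b y c d : gam b (y *r c) d = gam b y (c *l d).
Proof.
elim/bcls_ind: d => d; rewrite -bcls_l /gam !beta_repr /beta.
by rewrite actfl -mulrA bcls_l tpure_bal.
Qed.

Let beta_spec b :
  (forall y c, bact (r := r.+1) (tpure y (bc c)) b = beta y c b) /\
  {morph (fun x => bact (r := r.+1) x b) : x y / x + y}.
Proof.
split=> [y c|x y]; first rewrite -beta_repr.
  exact: (tlift_pure (gamDl b) (gamDr b) (gam_bal b) y (bc c)).
exact: (tliftD (gamDl b) (gamDr b) (gam_bal b) x y).
Qed.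

Lemma bactE_step y c b : bact (r := r.+1) (tpure y (bc c)) b =
  (tpure y (bc (c * b)) : lbar f M r.+1) - tpure (bact y c) (bc b).
Proof. by case: (beta_spec b) => + _; apply. Qed.

Lemma bact_laws_step : bact_laws r.+1.
Proof.
have D b : {morph (fun x => bact (r := r.+1) x b) : x y / x + y}.
  by case: (beta_spec b).
have E y c b : bact (r := r.+1) (tpure y (bc c)) b = beta y c b.
  by case: (beta_spec b).
have Z b : bact (r := r.+1) 0 b = 0 by exact: (add_eq0 (D b)).
have B' x y b : bact (r := r.+1) (x - y) b = bact (r := r.+1) x b - bact (r := r.+1) y b.
  by apply: (addIr (bact (r := r.+1) y b)); rewrite -D !subrK.
have ef x c : bact (r := r.+1) x (f c) = x *r c.
  elim/tpure_ind: x => [|x y ex ey|y d]; first by rewrite Z ract0.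
    by rewrite D ex ey ractDl.
  elim/bcls_ind: d => d; rewrite E /beta bcls_f tpure0r subr0 bcls_r.
  exact/esym/tractE.
have eA x a b : bact (r := r.+1) (bact (r := r.+1) x a) b = bact (r := r.+1) x (a * b).
  elim/tpure_ind: x => [|x y ex ey|y d]; first by rewrite !Z.
    by rewrite !D ex ey.
  (* Both y (x) da and yd (x) a yield the term y(da) (x) b, by associativity in degree [r], and the
     two copies cancel. *)
  elim/bcls_ind: d => d; rewrite !E {1}/beta B' !E /beta mulrA actA.
  by rewrite opprB addrA subrK.
split=> //; split.
- exact: lactDl.
- exact: lactDr.
- exact: lact1.
- exact: lactA.
- by move=> x y b; apply: D.
- move=> x a b; elim/tpure_ind: x => [|x y ex ey|y d]; first by rewrite !Z addr0.
    by rewrite !D ex ey addrACA.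
  elim/bcls_ind: d => d; rewrite !E /beta mulrDr !bcls_add.
  by rewrite ![tpure _ (_ + _)]tpureDr opprD addrACA.
- by move=> x; rewrite -(rmorph1 f) ef ract1.
- by move=> x a b; apply: eA.
- move=> a x b; elim/tpure_ind: x => [|x y ex ey|y d]; first by rewrite !(Z, lact0).
    by rewrite !(D, lactDr) ex ey.
  rewrite [a *l _]tlactE; elim/bcls_ind: d => d; rewrite !E /beta lactB actl.
  by congr (_ - _); apply/esym/tlactE.
- by move=> c x; rewrite -(kfun_emb f) ef bcentral.
Qed.
End Step.

Lemma bactP r : bact_laws r.
Proof.
elim: r => [|r /bact_laws_step//]; split=> //.
exact: (blaws M).
Qed.

Definition lbar_bimod r : bimod L B := Bimod (bactP r).1.

Lemma bact_f r (y : lbar f M r) c : bact y (f c) = y *r c.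
Proof. exact: (bactP r).2. Qed.
Lemma bactE r (y : lbar f M r) c b : bact (r := r.+1) (tpure y (bc c)) b =
  (tpure y (bc (c * b)) : lbar f M r.+1) - tpure (bact y c) (bc b).
Proof. exact: (bactE_step (bactP r)). Qed.
Lemma bactDl r (x y : lbar f M r) b : bact (x + y) b = bact x b + bact y b.
Proof. exact: (@ractDl _ _ _ (lbar_bimod r)). Qed.
Lemma bactDr r (x : lbar f M r) a b : bact x (a + b) = bact x a + bact x b.
Proof. exact: (@ractDr _ _ _ (lbar_bimod r)). Qed.
Lemma bactA r (x : lbar f M r) a b : bact (bact x a) b = bact x (a * b).
Proof. exact: (@ractA _ _ _ (lbar_bimod r)). Qed.
Lemma bact_l r a (x : lbar f M r) b : bact (a *l x) b = a *l bact x b.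
Proof. exact: (@lractA _ _ _ (lbar_bimod r)). Qed.
Lemma bact_fl r (x : lbar f M r) c b : bact (x *r c) b = bact x (f c * b).
Proof. by rewrite -bact_f bactA. Qed.
Lemma bact_fr r (x : lbar f M r) c b : bact x b *r c = bact x (b * f c).
Proof. by rewrite -bact_f bactA. Qed.
End BarAction.

(** * The bar differential expressed by the right action *)

Section BarDifferential.
Variables (k : fieldType) (R B : kalg k) (f : khom R B) (L S : kalg k).
Variables (M : bimod L B) (N : bimod B S).

Local Notation bc := (bcls f).
Local Notation rN := (rmod f N).

Lemma lpure_ext r (m : M) (b b' : nat -> B) :
  (forall j, (j < r)%N -> b j = b' j) -> lpure f r m b = lpure f r m b'.
Proof.
elim: r => // r IH e /=; rewrite e //; congr (tpure _ _).
by apply: IH => j jr; apply: e; apply: leqW.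
Qed.


(** Up to the sign (-1)^r, acting by [b r] produces the terms of the bar differential in which the
    last coefficient is not multiplied: m b_0 and the products b_i b_{i+1}. The induction peels off
    the last factor. *)
Lemma bact_lpure r (m : M) (b : nat -> B) :
  bact (lpure f r m b) (b r) =
  (lpure f r (m *r b 0%N) (fun j => b j.+1)
   + \sum_(0 <= i < r) lpure f r m (merge_at i b) *~ (-1) ^+ i.+1) *~ (-1) ^+ r.
Proof.
elim: r => [|r IH]; first by rewrite big_nil addr0.
etransitivity; first exact: (bactE (lpure f r m b) (b r) (b r.+1)).
rewrite IH big_nat_recr //=.
(* The summand of index r puts b_r b_{r+1} in the last place and leaves the earlier places alone; it
   is the first term of [bactE]. For i < r the merge shifts b_{r+1} into place r. *)
rewrite [X in _ = (_ + (_ + tpure _ (bc X) *~ _)) *~ _]/merge_at ltnn eqxx.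
rewrite (@lpure_ext r m (merge_at r b) b); last first.
  by move=> j jr; rewrite /merge_at jr.
set t := tpure (lpure f r m b) _.
rewrite addrA [RHS]mulrzDl [X in _ = _ + X]mulrz_signK [LHS]addrC; congr (_ + _).
have D : {morph (fun y => tpure y (bc (b r.+1)) : lbar f M r.+1) : x y / x + y}.
  by move=> x y; apply: tpureDl.
transitivity ((tpure (lpure f r (m *r b 0%N) (fun j => b j.+1)) (bc (b r.+1))
   + tpure (\sum_(0 <= i < r) lpure f r m (merge_at i b) *~ (-1) ^+ i.+1)
       (bc (b r.+1)) : lbar f M r.+1) *~ (-1) ^+ r.+1).
  by rewrite -D mulrz_signS -(morphMz _ D).
congr ((_ + _) *~ _); etransitivity; first exact: tpure_suml.
apply: eq_big_nat => i /andP[_ ir].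
etransitivity; first exact: (morphMz _ D).
by rewrite /merge_at ltnNge (ltnW ir) /= gtn_eqF.
Qed.

Lemma lpure_span r (y : lbar f M r) : exists s : seq (M * (nat -> B)),
  y = \sum_(p <- s) lpure f r p.1 p.2.
Proof.
elim: r y => [|r IH] y /=; first by exists [:: (y : M, fun=> 0)]; rewrite big_seq1.
elim/tpure_ind: y => [|x y [s ->] [t ->]|y c].
- by exists [::]; rewrite big_nil.
- by exists (s ++ t); rewrite big_cat.
have [s ->] := IH y; elim/bcls_ind: c => c.
(* Place r is free: [lpure] in degree r reads only the places below r. *)
exists [seq (p.1, fun j => if j == r then c else p.2 j) | p <- s].
rewrite big_map [LHS]tpure_suml; apply: eq_bigr => p _ /=; rewrite eqxx.
congr (tpure _ _); apply: lpure_ext => j jr.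
by rewrite ltn_eqF.
Qed.

Lemma bpure_span r (x : bar f M N r) : exists s : seq (M * (nat -> B) * N),
  x = \sum_(p <- s) bpure f r p.1.1 p.1.2 p.2.
Proof.
elim/tpure_ind: x => [|x y [s ->] [t ->]|y n].
- by exists [::]; rewrite big_nil.
- by exists (s ++ t); rewrite big_cat.
have [s ->] := lpure_span y; exists [seq (p, n : N) | p <- s].
by rewrite big_map [LHS]tpure_suml.
Qed.

Section Step.
Variable r : nat.
Local Notation P := (lbar f M r).

Let q (y : P) (c : B) (n : N) : bar f M N r :=
  tpure (N := rN) (bact y c) n - tpure (N := rN) y (c *l n : N).

(** This is the balancing relation over R, and it makes [q] descend to B/f(R) in its middle
    argument. *)
Let q_f y c n : q y (f c) n = 0.
Proof. by apply/eqP; rewrite /q bact_f subr_eq0 tpure_bal. Qed.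
Let qDm y c d n : q y (c + d) n = q y c n + q y d n.
Proof.
rewrite /q bactDr lactDl [tpure (_ + _) _]tpureDl [tpure _ (_ + _)]tpureDr.
by rewrite opprD addrACA.
Qed.
Let q_repr y c n : q y (repr (bc c : bbar f)) n = q y c n.
Proof. by have [d ->] := bcls_eq_repr f c; rewrite qDm q_f addr0. Qed.

Let g n (y : P) (c : bbar f) := q y (repr c) n.
Let gDl n y y' c : g n (y + y') c = g n y c + g n y' c.
Proof.
rewrite /g /q bactDl [tpure (_ + _) _]tpureDl [tpure (_ + _) _]tpureDl.
by rewrite opprD addrACA.
Qed.
Let gDr n y c d : g n y (c + d) = g n y c + g n y d.
Proof.
elim/bcls_ind: c => c; elim/bcls_ind: d => d.
by rewrite -bcls_add /g !q_repr qDm.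
Qed.
Let g_bal n y c d : g n (y *r c) d = g n y (c *l d).
Proof.
elim/bcls_ind: d => d; rewrite -bcls_l /g !q_repr /q bact_fl -lactA.
by congr (_ - _); apply: tpure_bal.
Qed.

Let h (y : lbar f M r.+1) (n : rN) : bar f M N r :=
  tlift (M := P) (N := bbar f) (g n) y.
Let hE y c n : h (tpure y (bc c)) n = q y c n.
Proof. by rewrite -q_repr; exact: (tlift_pure (gDl n) (gDr n) (g_bal n) y (bc c)). Qed.
Let hDl y y' n : h (y + y') n = h y n + h y' n.
Proof. exact: (tliftD (gDl n) (gDr n) (g_bal n) y y'). Qed.
Let h0 n : h 0 n = 0.
Proof. by apply: (add_eq0 (f := fun y => h y n)) => x y; apply: hDl. Qed.
Let hDr y n n' : h y (n + n') = h y n + h y n'.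
Proof.
elim/tpure_ind: y => [|x y ex ey|y c]; first by rewrite !h0 addr0.
  by rewrite !hDl ex ey addrACA.
elim/bcls_ind: c => c; rewrite !hE /q lactDr ![tpure _ (_ + _)]tpureDr.
by rewrite opprD addrACA.
Qed.
Let h_bal y c n : h (y *r c) n = h y (c *l n).
Proof.
elim/tpure_ind: y => [|x y ex ey|y d]; first by rewrite ract0 !h0.
  by rewrite ractDl !hDl ex ey.
rewrite [_ *r c]tractE; elim/bcls_ind: d => d; rewrite -bcls_r !hE /q.
by rewrite -bact_fr tpure_bal -lactA.
Qed.
Let h_l a y n : h (a *l y) n = a *l h y n.
Proof.
elim/tpure_ind: y => [|x y ex ey|y d]; first by rewrite lact0 !h0 lact0.
  by rewrite lactDr !hDl lactDr ex ey.
rewrite [a *l _]tlactE; elim/bcls_ind: d => d; rewrite !hE /q lactB bact_l.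
by congr (_ - _); apply/esym/tlactE.
Qed.
Let h_r y n b : h y (n *r b) = h y n *r b.
Proof.
elim/tpure_ind: y => [|x y ex ey|y d]; first by rewrite !h0 ract0.
  by rewrite !hDl ractDl ex ey.
elim/bcls_ind: d => d; rewrite !hE /q ractB -[_ *l (_ *r b)]lractA.
by congr (_ - _); apply/esym/tractE.
Qed.

Let H (x : bar f M N r.+1) : bar f M N r := tlift (M := lbar f M r.+1) (N := rN) h x.
Let HE y n : H (tpure (N := rN) y n) = h y n.
Proof. exact: (tlift_pure hDl hDr h_bal). Qed.
Let HD : {morph H : x y / x + y}.
Proof. exact: (tliftD hDl hDr h_bal). Qed.

(** On pure tensors [bact_lpure] supplies every term but the last, which is the second term of [q].
    Since [addext] is not additive by construction, linearity of [bar_d] is read off from [H]. *)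
Let bar_dH x : bar_d x = H x *~ (-1) ^+ r.
Proof.
apply: (addext_additive (h := fun x => H x *~ (-1) ^+ r)) => {x}.
- by move=> x y; rewrite HD mulrzDl.
- case=> [[m b] n] /=; rewrite HE hE /q bact_lpure mulrzBl mulrz_signS; congr (_ - _).
  rewrite (morphMz _ (f := fun y => tpure (N := rN) y n : bar f M N r)); last first.
    by move=> x y; apply: tpureDl.
  rewrite mulrz_signK [LHS]tpureDl; congr (_ + _).
  rewrite [LHS]tpure_suml; apply: eq_bigr => i _.
  by apply: (morphMz _ (f := fun y => tpure (N := rN) y n : bar f M N r)) => x y; apply: tpureDl.
- exact: bpure_span.
Qed.

Lemma bar_dE (y : lbar f M r) c (n : N) :
  bar_d (r := r.+1) (tpure (N := rN) (tpure y (bc c) : lbar f M r.+1) n) =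
  (tpure (N := rN) (bact y c) n - tpure (N := rN) y (c *l n : N) : bar f M N r)
    *~ (-1) ^+ r.
Proof. by rewrite bar_dH HE hE. Qed.

Let bar_dD : {morph @bar_d _ _ _ f _ _ M N r.+1 : x y / x + y}.
Proof. by move=> x y; rewrite !bar_dH HD mulrzDl. Qed.
Let H0 : H 0 = 0. Proof. exact: add_eq0 HD. Qed.
Let bar_dl a (x : bar f M N r.+1) : bar_d (a *l x) = a *l bar_d x.
Proof.
rewrite !bar_dH lactMz; congr (_ *~ _).
elim/tpure_ind: x => [|x y ex ey|y n]; first by rewrite lact0 H0 lact0.
  by rewrite lactDr !HD ex ey lactDr.
by rewrite [a *l _]tlactE !HE h_l.
Qed.
Let bar_dr (x : bar f M N r.+1) b : bar_d (x *r b) = bar_d x *r b.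
Proof.
rewrite !bar_dH ractMz; congr (_ *~ _).
elim/tpure_ind: x => [|x y ex ey|y n]; first by rewrite ract0 H0 ract0.
  by rewrite ractDl !HD ex ey ractDl.
by rewrite [_ *r b]tractE !HE h_r.
Qed.

Definition bar_dh : bhom (bar f M N r.+1) (bar f M N r) := Bhom bar_dD bar_dl bar_dr.
End Step.

Lemma bar_ind r (P : bar f M N r.+1 -> Prop) : P 0 ->
  (forall x y, P x -> P y -> P (x + y)) ->
  (forall (y : lbar f M r) c (n : N),
     P (tpure (N := rN) (tpure y (bc c) : lbar f M r.+1) n)) ->
  forall x, P x.
Proof.
move=> P0 PD Pp; elim/tpure_ind=> // y n.
elim/tpure_ind: y => [|x y ex ey|y c]; first by rewrite tpure0l.
  by rewrite [tpure _ _]tpureDl; apply: PD.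
by elim/bcls_ind: c => c; apply: Pp.
Qed.

(** The first application leaves yc (x) n - y (x) cn, so the differential has to be balanced over B
    in its last slot. For y = z (x) d, expanding the action gives two copies of z(dc) (x) n that
    cancel, and what remains is the value at y (x) cn. *)
Lemma bar_dd r (x : bar f M N r.+2) : bar_dh r (bar_dh r.+1 x) = 0.
Proof.
elim/bar_ind: x => [|x y ex ey|y c n]; first by rewrite !bfun0.
  by rewrite !bfunD ex ey addr0.
rewrite [X in bar_dh r X]bar_dE bfunMz bfunB.
suff -> : bar_dh r (tpure (N := rN) (bact y c) n)
        = bar_dh r (tpure (N := rN) y (c *l n : N)) by rewrite subrr mul0rz.
move: y; apply: tens_eq => [x y|x y|y d].
- by rewrite bactDl [tpure (_ + _) _]tpureDl bfunD.
- by rewrite [tpure (_ + _) _]tpureDl bfunD.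
elim/bcls_ind: d => d; rewrite bactE [tpure (_ - _) _]tpureBl bfunB.
rewrite [bar_dh r _]bar_dE [bar_dh r _]bar_dE [RHS]bar_dE.
by rewrite -mulrzBl bactA lactA opprB addrC addrA subrK.
Qed.
End BarDifferential.

(** * Bigraded bimodules *)

Section Product.
Variables (k : fieldType) (L R : kalg k) (I : Type) (M : I -> bimod L R).

Definition pcar := forall i, M i.
HB.instance Definition _ := gen_eqMixin pcar.
HB.instance Definition _ := gen_choiceMixin pcar.

Definition padd (x y : pcar) : pcar := fun i => x i + y i.
Definition popp (x : pcar) : pcar := fun i => - x i.
Lemma paddA : associative padd.
Proof. by move=> x y z; apply: functional_extensionality_dep => i; apply: addrA. Qed.
Lemma paddC : commutative padd.
Proof. by move=> x y; apply: functional_extensionality_dep => i; apply: addrC. Qed.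
Lemma padd0 : left_id (fun=> 0) padd.
Proof. by move=> x; apply: functional_extensionality_dep => i; apply: add0r. Qed.
Lemma paddN : left_inverse (fun=> 0) popp padd.
Proof. by move=> x; apply: functional_extensionality_dep => i; apply: addNr. Qed.
HB.instance Definition _ := GRing.isZmodule.Build pcar paddA paddC padd0 paddN.

Definition plact a (x : pcar) : pcar := fun i => a *l x i.
Definition pract (x : pcar) b : pcar := fun i => x i *r b.
Lemma prod_laws : bimod_laws plact pract.
Proof.
split=> *; apply: functional_extensionality_dep => i.
- exact: lactDl.
- exact: lactDr.
- exact: lact1.
- exact: lactA.
- exact: ractDl.
- exact: ractDr.
- exact: ract1.
- exact: ractA.
- exact: lractA.
- exact: bcentral.
Qed.
Definition bprod : bimod L R := Bimod prod_laws.
End Product.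

Section Linear.
Variables (k : fieldType) (L R K : kalg k) (i : khom K R).

(* Maps of (L, K)-bimodules; i := kid R gives the (L, R)-bimodule maps. *)
Definition klinear (M N : bimod L R) (f : M -> N) : Prop :=
  [/\ {morph f : x y / x + y}, forall a x, f (a *l x) = a *l f x
    & forall x c, f (x *r i c) = f x *r i c].

Definition kbhom (M N : bimod L R) (f : M -> N) (h : klinear f) :
  bhom (bres (kid L) i M) (bres (kid L) i N) :=
  let: And3 hD hl hr := h in
  @Bhom _ _ _ (bres (kid L) i M) (bres (kid L) i N) f hD hl hr.

Lemma kbhomE (M N : bimod L R) (f : M -> N) (h : klinear f) : kbhom h =1 f.
Proof. by case: h. Qed.

Lemma klinear_bhom (M N : bimod L R) (f : bhom M N) : klinear f.
Proof. split=> [x y|a x|x c]; [exact: bfunD|exact: bfunl|exact: bfunr]. Qed.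

Lemma klinear_comp (M N P : bimod L R) (g : N -> P) (f : M -> N) :
  klinear g -> klinear f -> klinear (fun x => g (f x)).
Proof.
by move=> [gD gl gr] [fD fl fr]; split=> [x y|a x|x c] /=; rewrite ?fD ?fl ?fr ?gD ?gl ?gr.
Qed.

Lemma klinearD (M N : bimod L R) (f g : M -> N) :
  klinear f -> klinear g -> klinear (fun x => f x + g x).
Proof.
move=> [fD fl fr] [gD gl gr]; split=> [x y|a x|x c] /=.
- by rewrite fD gD addrACA.
- by rewrite fl gl lactDr.
- by rewrite fr gr ractDl.
Qed.

Lemma klinearN (M N : bimod L R) (f : M -> N) :
  klinear f -> klinear (fun x => - f x).
Proof.
move=> [fD fl fr]; split=> [x y|a x|x c] /=.
- by rewrite fD opprD.
- by rewrite fl lactN.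
- by rewrite fr ractN.
Qed.

Lemma klinear_sum (M N : bimod L R) (J : Type) (s : seq J) (P : pred J) (f : J -> M -> N) :
  (forall j, P j -> klinear (f j)) -> klinear (fun x => \sum_(j <- s | P j) f j x).
Proof.
move=> h; split=> [x y|a x|x c] /=.
- by rewrite -big_split; apply: eq_bigr => j /h[].
- rewrite (big_morph _ (lactDr a) (lact0 N a)).
  by apply: eq_bigr => j /h[].
- rewrite (big_morph (fun y => y *r i c) (fun u v => ractDl u v (i c)) (ract0 N (i c))).
  by apply: eq_bigr => j /h[].
Qed.

Lemma klinear_sum_nat (M N : bimod L R) m n (f : nat -> M -> N) :
  (forall l, (m <= l < n)%N -> klinear (f l)) ->
  klinear (fun x => \sum_(m <= l < n) f l x).
Proof.
move=> h; have -> : (fun x => \sum_(m <= l < n) f l x)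
    = (fun x => \sum_(m <= l < n | (m <= l < n)%N) f l x).
  by apply: functional_extensionality_dep => x; rewrite big_nat.
exact: klinear_sum.
Qed.

Lemma klinearMz (M N : bimod L R) (f : M -> N) z :
  klinear f -> klinear (fun x => f x *~ z).
Proof.
move=> [fD fl fr]; split=> [x y|a x|x c] /=.
- by rewrite fD mulrzDl.
- by rewrite fl lactMz.
- by rewrite fr ractMz.
Qed.

Lemma klinear0 (M N : bimod L R) : klinear (fun _ : M => 0 : N).
Proof. by split=> [x y|a x|x c]; rewrite ?addr0 ?lact0 ?ract0. Qed.

End Linear.

Lemma tlift_klinear (k : fieldType) (L S R K : kalg k) (i : khom K R)
    (M : bimod L S) (N : bimod S R) (Z : bimod L R) (b : M -> N -> Z) :
  (forall m m' n, b (m + m') n = b m n + b m' n) ->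
  (forall m n n', b m (n + n') = b m n + b m n') ->
  (forall m r n, b (m *r r) n = b m (r *l n)) ->
  (forall a m n, b (a *l m) n = a *l b m n) ->
  (forall m n c, b m (n *r i c) = b m n *r i c) ->
  klinear i (tlift b : tens M N -> Z).
Proof.
move=> bDl bDr bB bl br; have D := tliftD bDl bDr bB; have Z0 := add_eq0 D.
split=> [|a|x c]; first exact: D.
- elim/tpure_ind=> [|x y ex ey|m n]; first by rewrite !lact0 Z0 lact0.
    by rewrite lactDr !D lactDr ex ey.
  by rewrite [a *l _]tlactE !tlift_pure.
- elim/tpure_ind: x => [|x y ex ey|m n]; first by rewrite ract0 Z0 ract0.
    by rewrite ractDl !D ractDl ex ey.
  by rewrite [_ *r i c]tractE !tlift_pure.
Qed.

(** Groups composites of two components of a differential by their total weight [c]. *)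
Lemma sum_triangle (Z : zmodType) (F : nat -> nat -> Z) n :
  \sum_(0 <= a < n) \sum_(0 <= b < n - a) F a b =
  \sum_(0 <= c < n) \sum_(0 <= a < c.+1) F a (c - a)%N.
Proof.
elim: n => [|n IH]; first by rewrite !big_nil.
rewrite [RHS]big_nat_recr //= -IH !big_nat_recr //= subnn subSnn big_nat1.
rewrite addrA -big_split /=; congr (_ + _); apply: eq_big_nat => a /andP[_ an].
by rewrite subSn ?(ltnW an) // big_nat_recr.
Qed.

Lemma sum_nat_trunc (Z : zmodType) (F : nat -> Z) m n n' :
  (n <= n')%N -> (forall l, (n <= l)%N -> F l = 0) ->
  \sum_(m <= l < n') F l = \sum_(m <= l < n) F l.
Proof.
move=> nn' F0; case: (leqP m n) => [mn|nm].
  rewrite (big_cat_nat mn nn') /= -[RHS]addr0; congr (_ + _).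
  rewrite big_nat_cond big1 //.
  by move=> l /andP[/andP[nl _] _]; apply: F0.
rewrite [RHS]big_geq ?(ltnW nm) // big_nat_cond big1 // => l /andP[/andP[ml _] _].
by apply: F0; apply: leq_trans (ltnW nm) ml.
Qed.

Section Cast.
Variables (k : fieldType) (L R : kalg k) (X : nat -> nat -> bimod L R).

(** [Xcast] for an arbitrary bigraded family, so that the perturbation argument can be run without
    the crossed product; at [Xres] the two coincide by unfolding. *)
Definition xcast (r s r' s' : nat) (x : X r s) : X r' s' :=
  match r =P r', s =P s' with
  | ReflectT er, ReflectT es => ecast t (X r' t) es (ecast t (X t s) er x)
  | _, _ => 0
  end.

Lemma xcast_id r s (x : X r s) : xcast r s x = x.
Proof.
rewrite /xcast; case: eqP => // er; case: eqP => // es.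
by rewrite (eq_axiomK er) (eq_axiomK es).
Qed.

Lemma xcast_ne r s r' s' (x : X r s) : (r != r') || (s != s') -> xcast r' s' x = 0.
Proof. by rewrite /xcast; case: eqP => // er; case: eqP. Qed.

Lemma klinear_xcast (K : kalg k) (i : khom K R) r s r' s' :
  klinear i (@xcast r s r' s').
Proof.
have [e|ne] := boolP ((r == r') && (s == s')); last first.
  move: ne; rewrite negb_and => ne.
  have z x : @xcast r s r' s' x = 0 by apply: xcast_ne.
  by split=> [x y|a x|x c]; rewrite !z ?addr0 ?lact0 ?ract0.
by case/andP: e => /eqP <- /eqP <-; split=> [x y|a x|x c]; rewrite !xcast_id.
Qed.

Lemma xcastD r s r' s' : {morph @xcast r s r' s' : x y / x + y}.
Proof. by case: (klinear_xcast (kid R) r s r' s'). Qed.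
Lemma xcast0 r s r' s' : xcast r' s' (0 : X r s) = 0.
Proof. exact: add_eq0 (@xcastD r s r' s'). Qed.

(* The product over all bidegrees instead of the direct sum: in each bidegree the
   total differential is a finite sum of the D l, since D l lands in column
   p >= l - 1. *)
Definition bigraded : bimod L R := bprod (fun p => bprod (X p)).

Lemma bigraded_eq (t u : bigraded) : (forall p q, t p q = u p q) -> t = u.
Proof.
move=> e; apply: functional_extensionality_dep => p.
by apply: functional_extensionality_dep => q.
Qed.
Lemma bigraded_sum (I : Type) (s : seq I) (F : I -> bigraded) p q :
  (\sum_(j <- s) F j) p q = \sum_(j <- s) F j p q.
Proof. exact: (big_morph (fun t : bigraded => t p q)). Qed.

(** Placing all elements in one module removes the casts: elements of [X r s] and [X r' s'] whose
    indices are only provably equal can be compared directly, by [embed_cast]. *)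
Definition embed r s (x : X r s) : bigraded := fun p q => xcast p q x.

Lemma embed_id r s (x : X r s) : embed x r s = x.
Proof. exact: xcast_id. Qed.
Lemma embed_ne r s (x : X r s) p q : (r != p) || (s != q) -> embed x p q = 0.
Proof. exact: xcast_ne. Qed.
Lemma klinear_embed (K : kalg k) (i : khom K R) r s : klinear i (@embed r s).
Proof.
split=> [x y|a x|x c]; apply: bigraded_eq => p q; case: (klinear_xcast i r s p q) => hD hl hr.
- exact: hD.
- exact: hl.
- exact: hr.
Qed.
Lemma embedD r s : {morph @embed r s : x y / x + y}.
Proof. by case: (klinear_embed (kid R) r s). Qed.
Lemma embed0 r s : embed (0 : X r s) = 0. Proof. exact: add_eq0 (@embedD r s). Qed.
Lemma embedN r s (x : X r s) : embed (- x) = - embed x.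
Proof. by apply: (addIr (embed x)); rewrite -embedD !addNr embed0. Qed.
Lemma embed_sum r s (I : Type) (S : seq I) (F : I -> X r s) :
  embed (\sum_(j <- S) F j) = \sum_(j <- S) embed (F j).
Proof. exact: (big_morph _ (@embedD r s) (@embed0 r s)). Qed.
Lemma embed_r r s (x : X r s) b : embed (x *r b) = embed x *r b.
Proof. by case: (klinear_embed (kid R) r s) => _ _; apply. Qed.
Lemma embed_cast r s r' s' (x : X r s) : r = r' -> s = s' -> embed (xcast r' s' x) = embed x.
Proof. by move=> <- <-; rewrite xcast_id. Qed.
End Cast.

(** * The perturbation lemma *)

Section Perturbation.
Variables (k : fieldType) (L R K : kalg k) (i : khom K R).
Variables (X : nat -> nat -> bimod L R) (Y : nat -> bimod L R) (N : bimod L R).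
Variables (dl : forall l r s, bhom (X r s) (X (r + l).-1 (s - l)))
  (d0 : forall r s, bhom (X r.+1 s) (X r s))
  (up : forall s, bhom (X 0 s) (Y s))
  (dY : forall s, bhom (Y s.+1) (Y s))
  (mu : bhom (Y 0) N).
Variables (sg0 : forall s, Y s -> X 0 s) (sg : forall r s, X r s -> X r.+1 s)
  (sm : forall s, Y s -> Y s.+1) (sn : N -> Y 0).
(* In the application, gen z means that z = y (x) 1_E. *)
Variable gen : forall r s, X r s -> Prop.

Hypotheses (sg0P : forall s, klinear i (@sg0 s)) (sgP : forall r s, klinear i (@sg r s))
  (smP : forall s, klinear i (@sm s)) (snP : klinear i sn).
Hypotheses
  (gen_ind : forall r s (P : X r s -> Prop), P 0 ->
     (forall x y, P x -> P y -> P (x + y)) ->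
     (forall z b, gen z -> P (z *r b)) -> forall x, P x)
  (d0d0 : forall r s x, d0 r s (d0 r.+1 s x) = 0)
  (upd0 : forall s x, up s (d0 0 s x) = 0)
  (upsg0 : forall s y, up s (sg0 y) = y)
  (hsg0 : forall s (x : X 0 s), d0 0 s (sg x) = x - sg0 (up s x))
  (hsg : forall r s (x : X r.+1 s), d0 r.+1 s (sg x) = x - sg (d0 r s x))
  (dYdY : forall s y, dY s (dY s.+1 y) = 0)
  (mudY : forall y, mu (dY 0 y) = 0)
  (hsm : forall s (y : Y s.+1), dY s.+1 (sm y) = y - sm (dY s y))
  (hsm0 : forall y : Y 0, dY 0 (sm y) = y - sn (mu y))
  (musn : forall x, mu (sn x) = x).
(** In [dlS] the bounds leave out exactly l = 0 and the pair r = 0, l = 1, the cases of [dl0] and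
    [dl1]. *)
Hypotheses
  (dl0 : forall r s (x : X r.+1 s), embed (dl 0 r.+1 s x) = embed (d0 r s x))
  (dl1 : forall s (z : X 0 s.+1), gen z ->
     embed (dl 1 0 s.+1 z) = embed (sg0 (dY s (up s.+1 z))))
  (dlS : forall l r s (z : X r s), gen z -> (0 < l)%N -> (1 < r + l)%N ->
     dl l r s z = - \sum_((r == 0%N) <= m < l)
        xcast _ _ (sg (dl (l - m) _ _ (dl m _ _ z)))).

Local Notation T := (bigraded X).
Local Notation TY := (bprod Y).

(** [dl l] moves (r, s) to (r + l - 1, s - l), so (p, q) is reached from (p + 1 - l, q + l). Under
    the test [l <= p.+1] no subtraction in these indices is truncated. *)
Let DT l (t : T) : T := fun p q =>
  if (l <= p.+1)%N then xcast p q (dl l (p.+1 - l) (q + l) (t (p.+1 - l)%N (q + l)%N))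
  else 0.
Let DTP l : klinear (kid R) (DT l).
Proof.
have h p q := klinear_comp (klinear_xcast X (kid R) _ _ p q)
   (klinear_bhom (kid R) (dl l (p.+1 - l) (q + l))).
split=> [t u|a t|t b]; apply: bigraded_eq => p q; case: (h p q) => hD hl hr.
- rewrite -[RHS]/(DT l t p q + DT l u p q) /DT; case: ifP => _; first exact: hD.
  by rewrite addr0.
- rewrite -[RHS]/(a *l DT l t p q) /DT; case: ifP => _; first exact: hl.
  by rewrite lact0.
- rewrite -[RHS]/(DT l t p q *r b) /DT; case: ifP => _; first exact: hr.
  by rewrite ract0.
Qed.
Let D l : bhom T T := let: And3 hD hl hr := DTP l in Bhom hD hl hr.
Let DE l t : D l t = DT l t. Proof. by rewrite /D; case: (DTP l). Qed.

Let D_big l t p q : (p.+1 < l)%N -> D l t p q = 0.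
Proof. by move=> pl; rewrite DE /DT leqNgt pl. Qed.
Let D_loc l (t u : T) p q : t (p.+1 - l)%N (q + l)%N = u (p.+1 - l)%N (q + l)%N ->
  D l t p q = D l u p q.
Proof. by move=> e; rewrite !DE /DT e. Qed.
Let D_loc0 l (t : T) p q : t (p.+1 - l)%N (q + l)%N = 0 -> D l t p q = 0.
Proof. by move=> e; rewrite (@D_loc l t 0 p q e) bfun0. Qed.

Let D_injE l r s (x : X r s) : (0 < r + l)%N -> (l <= s)%N ->
  D l (embed x) = embed (dl l r s x).
Proof.
move=> rl ls; apply: bigraded_eq => p q; rewrite DE /DT /embed.
have [/andP[/eqP e1 /eqP e2]|ne] := boolP ((p.+1 == (r + l)%N) && ((q + l)%N == s)).
  rewrite e1 leq_addl.
  have : (p.+1 - l)%N = r by rewrite e1 addnK.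
  rewrite e1; move: (r + l - l)%N (q + l)%N e2 => r' s' -> ->.
  by rewrite xcast_id.
rewrite [RHS]xcast_ne; last first.
  move: ne; rewrite -!negb_and; apply: contra => /andP[/eqP <- /eqP <-].
  by rewrite prednK // subnK // !eqxx.
case: ifP => // lp; rewrite [X in dl _ _ _ X]xcast_ne ?bfun0 ?xcast0 //.
move: ne; rewrite -!negb_and; apply: contra => /andP[/eqP -> /eqP ->].
by rewrite subnK // !eqxx.
Qed.

Let D_inj_big l r s (x : X r s) : (s < l)%N -> D l (embed x) = 0.
Proof.
move=> sl; apply: bigraded_eq => p q; apply: D_loc0; apply: embed_ne.
by rewrite orbC neq_ltn (leq_trans sl) // leq_addl.
Qed.

Let D0E (t : T) p q : D 0 t p q = d0 p q (t p.+1 q).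
Proof.
have e := congr1 (fun u : T => u p q) (dl0 (t p.+1 q)).
rewrite DE /DT subn0 leq0n; move: (q + 0)%N (addn0 q) => q' ->.
by rewrite [LHS]e embed_id.
Qed.
Let D0_inj r s (x : X r.+1 s) : D 0 (embed x) = embed (d0 r s x).
Proof. by rewrite D_injE // dl0. Qed.
Let D0_inj0 s (x : X 0 s) : D 0 (embed x) = 0.
Proof.
by apply: bigraded_eq => p q; apply: D_loc0; apply: embed_ne; rewrite subn0.
Qed.

(** Total forms of the given maps: [S] and [S0] for sigma^0 on X and on Y, [U] for upsilon, [dT] for
    the differential of Y and [M] for its contraction. Places that receive nothing are filled with
    zero. *)
Let S (t : T) : T := fun p q =>
  match p return X p q with 0 => 0 | p'.+1 => sg (t p' q) end.
Let SP : klinear i S.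
Proof.
split=> [t u|a t|t b]; apply: bigraded_eq => -[|p] q.
- exact/esym/addr0.
- by case: (sgP p q) => hD _ _; exact: hD.
- exact/esym/lact0.
- by case: (sgP p q) => _ hl _; exact: hl.
- exact/esym/ract0.
- by case: (sgP p q) => _ _ hr; exact: hr.
Qed.
Let SD : {morph S : t u / t + u}. Proof. by case: SP. Qed.
Let S_0 : S 0 = 0. Proof. exact: add_eq0 SD. Qed.
Let S_sum (J : Type) (s : seq J) (F : J -> T) :
  S (\sum_(j <- s) F j) = \sum_(j <- s) S (F j).
Proof. exact: (big_morph S SD S_0). Qed.
Let S_inj r s (x : X r s) : S (embed x) = embed (sg x).
Proof.
have sg_0 p q : sg (0 : X p q) = 0 by case: (sgP p q) => hD _ _; exact: add_eq0 hD.
apply: bigraded_eq => -[|p] q; rewrite /S; first by rewrite embed_ne.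
have [/andP[/eqP <- /eqP <-]|] := boolP ((r == p) && (s == q)); first by rewrite !embed_id.
by rewrite negb_and => ne; rewrite !embed_ne.
Qed.

Let U (t : T) : TY := fun q => up q (t 0%N q).
Let UD : {morph U : t u / t + u}.
Proof. by move=> t u; apply: functional_extensionality_dep => q; exact: bfunD. Qed.
Let Ul a t : U (a *l t) = a *l U t.
Proof. by apply: functional_extensionality_dep => q; exact: bfunl. Qed.
Let Ur t b : U (t *r b) = U t *r b.
Proof. by apply: functional_extensionality_dep => q; exact: bfunr. Qed.
Let U_0 : U 0 = 0. Proof. exact: add_eq0 UD. Qed.
Let U_N t : U (- t) = - U t.
Proof. by apply: (addIr (U t)); rewrite -UD !addNr U_0. Qed.
Let U_sum (J : Type) (s : seq J) (F : J -> T) :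
  U (\sum_(j <- s) F j) = \sum_(j <- s) U (F j).
Proof. exact: (big_morph U UD U_0). Qed.

Let S0 (y : TY) : T := fun p q =>
  match p return X p q with 0 => sg0 (y q) | _ => 0 end.
Let S0P : klinear i S0.
Proof.
split=> [t u|a t|t b]; apply: bigraded_eq => -[|p] q.
- by case: (sg0P q) => hD _ _; exact: hD.
- exact/esym/addr0.
- by case: (sg0P q) => _ hl _; exact: hl.
- exact/esym/lact0.
- by case: (sg0P q) => _ _ hr; exact: hr.
- exact/esym/ract0.
Qed.
Let S0_0 : S0 0 = 0. Proof. by case: S0P => hD _ _; exact: add_eq0 hD. Qed.

Let dT (y : TY) : TY := fun q => dY q (y q.+1).
Let dT_0 : dT 0 = 0.
Proof. by apply: functional_extensionality_dep => q; exact: bfun0. Qed.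
Let dTD : {morph dT : x y / x + y}.
Proof. by move=> t u; apply: functional_extensionality_dep => q; exact: bfunD. Qed.
Let dTr t b : dT (t *r b) = dT t *r b.
Proof. by apply: functional_extensionality_dep => q; exact: bfunr. Qed.
Let dTdT y : dT (dT y) = 0.
Proof. by apply: functional_extensionality_dep => q; exact: dYdY. Qed.

Let M (y : TY) : TY := fun q => match q return Y q with 0 => 0 | q'.+1 => sm (y q') end.
Let MP : klinear i M.
Proof.
split=> [t u|a t|t b]; apply: functional_extensionality_dep => -[|q].
- exact/esym/addr0.
- by case: (smP q) => hD _ _; exact: hD.
- exact/esym/lact0.
- by case: (smP q) => _ hl _; exact: hl.
- exact/esym/ract0.
- by case: (smP q) => _ _ hr; exact: hr.
Qed.

(** In column 0 the term S (D 0 t) is zero and this is [hsg0]; in the other columns S0 (U t) is zero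
    and it is [hsg]. *)
Let D0S t : D 0 (S t) = t - S (D 0 t) - S0 (U t).
Proof.
apply: bigraded_eq => -[|p] q; rewrite D0E /=.
  have -> : (t - S (D 0 t) - S0 (U t)) 0%N q = t 0%N q - 0 - sg0 (up q (t 0%N q)) by [].
  by rewrite subr0; exact: hsg0.
have -> : (t - S (D 0 t) - S0 (U t)) p.+1 q = t p.+1 q - sg (D 0 t p q) - 0 by [].
by rewrite subr0 D0E; exact: hsg.
Qed.
Let D0S0 y : D 0 (S0 y) = 0.
Proof. by apply: bigraded_eq => p q; rewrite D0E; exact: bfun0. Qed.
Let US0 y : U (S0 y) = y.
Proof. by apply: functional_extensionality_dep => q; exact: upsg0. Qed.
Let US t : U (S t) = 0.
Proof. by apply: functional_extensionality_dep => q; exact: bfun0. Qed.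
Let UD0 t : U (D 0 t) = 0.
Proof. by apply: functional_extensionality_dep => q; rewrite /U D0E; exact: upd0. Qed.
Let D0D0 t : D 0 (D 0 t) = 0.
Proof. by apply: bigraded_eq => p q; rewrite !D0E; exact: d0d0. Qed.

(* The recursion for d^l, with the term sigma^0 partial upsilon of d^1_{0s}
   separated; it holds in all bidegrees because D 0 vanishes on X_{0s}. *)
Let D_rec l r s (z : X r s) : (0 < l)%N -> gen z ->
  D l (embed z) = - S (\sum_(0 <= m < l) D (l - m) (D m (embed z)))
    + (if l == 1%N then S0 (dT (U (embed z))) else 0).
Proof.
move=> l0 gz.
have Um r' s' (x : X r'.+1 s') : U (embed x) = 0.
  by apply: functional_extensionality_dep => q; rewrite /U embed_ne // bfun0.
(* For l > s the target row would be negative and both sides vanish; for l = 1 and s = 0 this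
   includes the last term, since [dT] reads row q + 1 > 0. *)
have [ls|sl] := leqP l s; last first.
  rewrite D_inj_big // big_nat_cond big1 => [|m /andP[/andP[_ ml] _]]; last first.
    have [ms|sm'] := leqP m s; last by rewrite (D_inj_big _ sm') bfun0.
    have [/eqP|rm] := posnP (r + m).
      rewrite addn_eq0 => /andP[/eqP r0 /eqP ->]; move: (z); rewrite r0 => z'.
      by rewrite D0_inj0 bfun0.
    by rewrite D_injE // D_inj_big // ltn_sub2r // (leq_ltn_trans ms sl).
  rewrite S_0 oppr0 add0r; case: eqP => // l1.
  have -> : dT (U (embed z)) = 0; last by rewrite S0_0.
  apply: functional_extensionality_dep => q; rewrite /dT /U embed_ne ?bfun0 //.
  by move: sl; rewrite l1 ltnS leqn0 => /eqP->; rewrite orbT.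
have [|] := boolP ((l == 1%N) && (r == 0%N)).
  case/andP=> /eqP l1 /eqP r0; move: z gz ls; rewrite r0 l1 {r0 l1 l0}.
  case: s => // s z gz _; rewrite eqxx big_nat1 D0_inj0 bfun0 S_0 oppr0 add0r.
  rewrite D_injE // dl1 //; apply: bigraded_eq => -[|p] q; last by rewrite embed_ne.
  rewrite /S0 /dT /U; have [e|ne] := eqVneq s q.
    by rewrite -e !embed_id.
  rewrite embed_ne; last by rewrite ne orbT.
  rewrite (embed_ne z) ?eqSS ?ne // !bfun0.
  by case: (sg0P q) => hD _ _; rewrite (add_eq0 hD).
rewrite negb_and => lr.
have -> : (if l == 1%N then S0 (dT (U (embed z))) else 0) = 0.
  case: eqP lr => // _; case: (r) z {gz} => // r' z _.
  by rewrite Um dT_0 S0_0.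
have rl : (1 < r + l)%N.
  by case: (r) lr => [|r'] lr; rewrite ?addSn ?ltnS ?(leq_trans l0) ?leq_addl //; case: (l) l0 lr => [|[]].
rewrite addr0 D_injE ?(ltnW rl) // dlS // embedN embed_sum S_sum; congr (- _).
have -> : \sum_(0 <= m < l) S (D (l - m) (D m (embed z)))
        = \sum_((r == 0%N) <= m < l) S (D (l - m) (D m (embed z))).
  have [r0|//] := posnP r; move: (z); rewrite r0 /= => z'.
  by rewrite big_ltn // D0_inj0 bfun0 S_0 add0r.
apply: eq_big_nat => m /andP[rm ml].
have rm1 : (0 < r + m)%N by move: rm; case: (r) => [|?]; rewrite ?addSn.
have e1 : ((r + m).-1 + (l - m))%N = (r + l).-1.
  by apply: succn_inj; rewrite -addSn !prednK ?(ltnW rl) // -addnA subnKC // ltnW.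
have e0 : (0 < (r + m).-1 + (l - m))%N by rewrite e1 -ltnS prednK // ltnW.
rewrite D_injE ?(leq_trans (ltnW ml)) // D_injE ?leq_sub2r //.
rewrite S_inj; apply: embed_cast; last by rewrite -subnDA subnKC // ltnW.
by rewrite prednK.
Qed.

Let UD_ge2 l t : (1 < l)%N -> U (D l t) = 0.
Proof.
move=> l1; apply: functional_extensionality_dep => q.
by rewrite /U D_big // bfun0.
Qed.
(** By [D_rec], D 1 on a generator is a value of [S], which [U] kills, plus S0 (dT (U z)), which [U]
    sends to dT (U z). Other elements follow by right linearity. *)
Let UD1_embed s (x : X 0 s) : U (D 1 (embed x)) = dT (U (embed x)).
Proof.
elim/gen_ind: x => [|x y ex ey|z b gz].
- by rewrite embed0 bfun0 !U_0 dT_0.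
- by rewrite embedD bfunD !UD dTD ex ey.
- rewrite embed_r bfunr !Ur dTr; congr (_ *r b).
  by rewrite (D_rec _ gz) // UD U_N US oppr0 add0r US0.
Qed.
Let UD1 t : U (D 1 t) = dT (U t).
Proof.
apply: functional_extensionality_dep => q.
have e : D 1 t 0%N q = D 1 (embed (t 0%N q.+1)) 0%N q.
  by apply: D_loc; rewrite subnn addn1 embed_id.
have := congr1 (fun y : TY => y q) (UD1_embed (t 0%N q.+1)).
by rewrite /U /dT embed_id e.
Qed.

(** The weight-l component of the square of the sum of all [D m]. *)
Let DD l (t : T) : T := \sum_(0 <= m < l.+1) D (l - m) (D m t).
Let DDP l : klinear (kid R) (DD l).
Proof.
apply: klinear_sum => m _.
exact: (klinear_comp (klinear_bhom _ (D (l - m))) (klinear_bhom _ (D m))).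
Qed.

(* D 0 and U annihilate Sg := sum_{m<l} D (l-m) D m z, so that applying D 0 to
   D l z = - S Sg + ... gives - Sg. *)
Let DD_gen l r s (z : X r s) : (0 < l)%N -> gen z ->
  (forall l', (l' < l)%N -> forall t, DD l' t = 0) ->
  DD l (D 0 (embed z)) = 0 -> DD l (embed z) = 0.
Proof.
move=> l0 gz IHl IHr.
have D0D n t : DD n t = 0 ->
    D 0 (D n t) = - \sum_(0 <= m < n) D (n - m) (D m t).
  rewrite /DD big_nat_recr //= subnn => e.
  by apply/eqP; rewrite -addr_eq0 addrC e.
rewrite /DD big_nat_recr //= subnn (D_rec l0 gz).
set z' := embed z; set Sg := \sum_(0 <= m < l) _.
(* Only m = l - 1 can reach column 0, through D 1. There U (D 1 u) = dT (U u) with u = D m z, which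
   vanishes because U D 0 = 0, because dT dT = 0, or for m >= 2 because U (D m z) = 0. *)
have U0 : U Sg = 0.
  rewrite U_sum big_nat_cond big1 // => m /andP[/andP[_ ml] _].
  have [lm|] := ltnP 1 (l - m); first exact: UD_ge2.
  rewrite leq_eqVlt ltnS leqn0 subn_eq0 leqNgt ml orbF => /eqP lm.
  rewrite lm UD1; case: m ml lm => [|[|m]] ml lm.
  - by rewrite UD0 dT_0.
  - by rewrite UD1 dTdT.
  - by rewrite UD_ge2 // dT_0.
(* The vanishing of DD (l - m) at D m z rewrites D 0 (D (l - m) (D m z)) without D 0 in front: for m
   > 0 by the induction on l, for m = 0 by the hypothesis [IHr]. Regrouped by n = m + j, the sum
   consists of the terms D (l - n) (DD n z) with n < l. *)
have D0Sg : D 0 Sg = 0.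
  rewrite bfun_sum.
  transitivity (- \sum_(0 <= m < l) \sum_(0 <= j < l - m) D (l - m - j) (D j (D m z'))).
    rewrite -sumrN; apply: eq_big_nat => m /andP[_ ml]; apply: D0D.
    by case: m ml => [|m] ml; [rewrite subn0 | apply: IHl; rewrite ltn_subrL].
  rewrite (sum_triangle (fun m j => D (l - m - j) (D j (D m z')))).
  rewrite big_nat_cond big1 ?oppr0 // => n /andP[/andP[_ nl] _].
  transitivity (D (l - n) (DD n z')); last by rewrite IHl // bfun0.
  rewrite bfun_sum; apply: eq_big_nat => m /andP[_]; rewrite ltnS => mn.
  by rewrite -subnDA subnKC.
rewrite bfunD bfunN D0S D0Sg U0 S_0 S0_0 !subr0.
have -> : D 0 (if l == 1%N then S0 (dT (U z')) else 0) = 0.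
  by case: ifP => _; rewrite ?D0S0 ?bfun0.
by rewrite addr0 subrr.
Qed.

Let DD0 l t : DD l t = 0.
Proof.
elim/ltn_ind: l t => l IHl t.
(* By locality of [D], the value of DD l at (p, q) depends only on the component of t in bidegree (p
   + 2 - l, q + l). *)
suff h r s (x : X r s) : DD l (embed x) = 0.
  apply: bigraded_eq => p q.
  transitivity (DD l (embed (t (p.+2 - l)%N (q + l)%N)) p q); last by rewrite h.
  rewrite /DD !bigraded_sum; apply: eq_big_nat => m /andP[_]; rewrite ltnS => ml.
  have [pl|lp] := ltnP p.+1 (l - m); first by rewrite !D_big.
  apply: D_loc; apply: D_loc.
  have -> : ((p.+1 - (l - m)).+1 - m)%N = (p.+2 - l)%N.
    by rewrite -subSn // -subnDA subnK.
  have -> : (q + (l - m) + m)%N = (q + l)%N by rewrite -addnA subnK.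
  by rewrite embed_id.
case: (posnP l) => [l0|l0].
  by rewrite l0 /DD big_nat1 subnn D0D0.
(* Induction on the column: D 0 kills column 0 and lowers the other columns by one. *)
elim: r s x => [|r IHr] s x; elim/gen_ind: x => [|x y ex ey|z b gz].
1,4: by rewrite embed0; case: (DDP l) => hD _ _; exact: add_eq0 hD.
1,3: by rewrite embedD; case: (DDP l) => hD _ _; rewrite hD ex ey addr0.
all: rewrite embed_r; case: (DDP l) => _ _ hr; rewrite [LHS]hr.
all: rewrite -[RHS](ract0 _ b); congr (_ *r b).
all: apply: DD_gen => //.
- by rewrite D0_inj0; case: (DDP l) => hD _ _; exact: add_eq0 hD.
- by rewrite D0_inj.
Qed.

(** * The total differential and its contraction *)

Let Dtf (t : T) : T := fun p q => \sum_(0 <= l < p.+2) D l t p q.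
Let DtP : klinear (kid R) Dtf.
Proof.
split=> [t u|a t|t b]; apply: bigraded_eq => p q.
- rewrite -[RHS]/(Dtf t p q + Dtf u p q) /Dtf -big_split.
  by apply: eq_bigr => l _; rewrite bfunD.
- rewrite -[RHS]/(a *l Dtf t p q) /Dtf lact_sum.
  by apply: eq_bigr => l _; rewrite bfunl.
- rewrite -[RHS]/(Dtf t p q *r b) /Dtf ract_sum.
  by apply: eq_bigr => l _; rewrite bfunr.
Qed.
Let Dt : bhom T T := let: And3 hD hl hr := DtP in Bhom hD hl hr.
Let DtE t p q : Dt t p q = \sum_(0 <= l < p.+2) D l t p q.
Proof. by rewrite /Dt; case: DtP. Qed.

Let Dt_loc (t u : T) p q :
  (forall p' q', (p' + q' = (p + q).+1)%N -> t p' q' = u p' q') -> Dt t p q = Dt u p q.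
Proof.
move=> e; rewrite !DtE; apply: eq_big_nat => l /andP[_]; rewrite ltnS => lp.
by apply: D_loc; apply: e; rewrite addnCA addnC subnK // addSn addnC.
Qed.

Let DtDt t : Dt (Dt t) = 0.
Proof.
apply: bigraded_eq => p q; rewrite DtE.
(* At column p, [D l] reads column p + 1 - l, where [Dt] is the sum over m < p + 3 - l. Adding the
   zero term l = p + 2 completes the triangle l + m < p + 3. *)
transitivity (\sum_(0 <= l < p.+3) \sum_(0 <= m < p.+3 - l) D l (D m t) p q).
  rewrite [RHS]big_nat_recr //= [X in _ = _ + X]big1 ?addr0; last first.
    by move=> m _; rewrite D_big.
  apply: eq_big_nat => l /andP[_]; rewrite ltnS => lp.
  transitivity (D l (\sum_(0 <= m < p.+3 - l) D m t) p q).
    have -> : (p.+3 - l = (p.+1 - l).+2)%N by rewrite subSn ?(leqW lp) // subSn.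
    by apply: D_loc; rewrite DtE bigraded_sum.
  by rewrite bfun_sum bigraded_sum.
rewrite (sum_triangle (fun l m => D l (D m t) p q)) big_nat_cond big1 // => n _.
transitivity (DD n t p q); last by rewrite DD0.
rewrite /DD bigraded_sum big_nat_rev add0n; apply: eq_big_nat => m /andP[_]; rewrite ltnS => mn.
by rewrite subSS subKn.
Qed.

(** Column 0 receives only D 0 and D 1, and U D 0 = 0. *)
Let UDt t : U (Dt t) = dT (U t).
Proof.
rewrite -UD1 -[RHS]add0r -(UD0 t) -UD; apply: functional_extensionality_dep => q.
by rewrite /U DtE big_nat_recl // big_nat1.
Qed.

(** For l > 0, [D l] at row q reads row q + l > b, where [w] vanishes. *)
Let Dt_top b w p q : (forall p q, (b < q)%N -> w p q = 0) -> (b <= q)%N ->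
  Dt w p q = D 0 w p q.
Proof.
move=> w0 bq; rewrite DtE big_nat_recl // big_nat_cond big1 ?addr0 //.
move=> l _; apply: D_loc0; apply: w0.
by rewrite -addSnnS ltn_addr.
Qed.

Let dTM y : mu (y 0%N) = 0 -> dT y = 0 -> dT (M y) = y.
Proof.
move=> m0 dy; apply: functional_extensionality_dep => -[|q] /=.
  rewrite /dT /= hsm0 m0; case: snP => hD _ _.
  by rewrite (add_eq0 hD) subr0.
rewrite /dT /= hsm; have -> : dY q (y q.+1) = 0 by exact: (congr1 (fun y : TY => y q) dy).
by case: (smP q) => hD _ _; rewrite (add_eq0 hD) subr0.
Qed.

(* The first term makes upsilon of the error t - Dt (contr 0 t) vanish; each
   further step lowers the s-filtration of the error by one. *)
Fixpoint contr n (t : T) : T :=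
  if n is n'.+1 then contr n' t + S (t - Dt (contr n' t)) else S0 (M (U t)).

Let contrP n : klinear i (contr n).
Proof.
elim: n => [|n IH] /=.
  apply: klinear_comp S0P _; apply: klinear_comp MP _.
  by split=> *; [exact: UD | exact: Ul | exact: Ur].
apply: klinearD => //; apply: klinear_comp SP _.
apply: klinearD; first by split.
exact: (klinearN (klinear_comp (klinear_bhom i Dt) IH)).
Qed.

(** In the highest row where the error w may be nonzero, [Dt] acts on w and on S w as D 0. There D 0
    w = Dt w = 0, and U w = 0, so D 0 (S w) = w by [D0S]: adding S w to the contraction clears that
    row. *)
Let contr_spec n k' t : Dt t = 0 -> mu (U t 0%N) = 0 ->
  (forall p q, (n < q)%N -> t p q = 0) ->
  let w := t - Dt (contr k' t) in
  U w = 0 /\ forall p q, (n.+1 < q + k')%N -> w p q = 0.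
Proof.
move=> Dt0 mu0 t0; have dU : dT (U t) = 0 by rewrite -UDt Dt0 U_0.
elim: k' => [|k' [IHU IHF]] /=.
  split; first by rewrite UD U_N UDt US0 dTM // subrr.
  move=> p q; rewrite addn0 => nq.
  (* [M] raises rows by one, so S0 (M (U t)) may reach row n + 1. *)
  have M0 p' q' : (n.+1 < q')%N -> S0 (M (U t)) p' q' = 0.
    case: p' q' => [|p'] // [//|q']; rewrite ltnS => nq'.
    rewrite /= /U t0 // bfun0; case: (smP q') => hD _ _.
    by rewrite (add_eq0 hD); case: (sg0P q'.+1) => hD' _ _; rewrite (add_eq0 hD').
  rewrite -[LHS]/(t p q - Dt (S0 (M (U t))) p q) t0 ?(ltnW nq) //.
  by rewrite (Dt_top _ M0) ?(ltnW nq) // D0S0 subr0.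
set w := t - Dt (contr k' t) in IHU IHF *.
have -> : t - Dt (contr k' t + S w) = w - Dt (S w).
  by rewrite bfunD opprD addrA.
have Dw : Dt w = 0 by rewrite bfunB Dt0 DtDt subr0.
split; first by rewrite UD U_N UDt US dT_0 subr0.
move=> p q; rewrite addnS ltnS => nq.
have wq p' q' : (q < q')%N -> w p' q' = 0.
  by move=> qq; apply: IHF; apply: leq_ltn_trans nq _; rewrite ltn_add2r.
have Sq p' q' : (q < q')%N -> S w p' q' = 0.
  case: p' => [|p'] // qq; rewrite /S wq //.
  by case: (sgP p' q') => hD _ _; exact: add_eq0 hD.
rewrite -[LHS]/(w p q - Dt (S w) p q) (Dt_top _ Sq) // D0S IHU S0_0 subr0.
rewrite -[X in _ - X]/(w p q - S (D 0 w) p q) opprB addrC subrK.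
case: p => [|p] //=; rewrite /S -(Dt_top _ wq) // Dw.
by case: (sgP p q) => hD _ _; exact: add_eq0 hD.
Qed.

(** After n + 2 steps the condition n + 1 < q + (n + 2) for vanishing holds in every row q. *)
Let contrE n t : Dt t = 0 -> mu (U t 0%N) = 0 ->
  (forall p q, (n < q)%N -> t p q = 0) -> Dt (contr n.+2 t) = t.
Proof.
move=> Dt0 mu0 t0; have [_ F] := contr_spec n.+2 Dt0 mu0 t0.
apply/esym/eqP; rewrite -subr_eq0; apply/eqP/bigraded_eq => p q; apply: F.
by rewrite addnS ltnS leq_addl.
Qed.

Local Notation tot n := (bdsum (fun r : 'I_n.+1 => X r (n - r))).

(** [restr] and [emb] identify [tot n] with the families supported in total degree n, on which [Dt]
    is available without degree bookkeeping. *)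
Let restr n (t : T) : tot n := fun r => t r (n - r)%N.
Let restrP n : klinear (kid R) (@restr n).
Proof. by split=> [x y|a x|x c]; apply: functional_extensionality_dep => r. Qed.

Let emb n (x : tot n) : T := \sum_(r < n.+1) embed (x r).
Let embP n : klinear (kid R) (@emb n).
Proof.
apply: (@klinear_sum _ _ _ _ _ (tot n) T _ _ _ (fun r x => embed (x r))) => r _.
case: (klinear_embed X (kid R) r (n - r)%N) => hD hl hr.
by split=> [x y|a x|x c]; [exact: hD | exact: hl | exact: hr].
Qed.

Let emb_restr n t p q : (p + q = n)%N -> emb (@restr n t) p q = t p q.
Proof.
move=> e; have pn : (p < n.+1)%N by rewrite ltnS -e leq_addr.
rewrite /emb bigraded_sum (bigD1 (Ordinal pn)) //= big1 ?addr0 => [|r /eqP rp].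
  rewrite /restr /=; have: (n - p)%N = q by rewrite -e addKn.
  by move: (n - p)%N => q' ->; rewrite embed_id.
apply: embed_ne; apply/orP; left; apply/eqP => rpE; apply: rp.
exact: val_inj.
Qed.
Let emb_out n (x : tot n) p q : (p + q != n)%N -> emb x p q = 0.
Proof.
move=> ne; rewrite /emb bigraded_sum big1 // => r _; apply: embed_ne.
rewrite -negb_and; apply: contra ne => /andP[/eqP <- /eqP <-].
by rewrite subnKC // -ltnS.
Qed.
Let restr_emb n (x : tot n) : @restr n (emb x) = x.
Proof.
apply: functional_extensionality_dep => p; rewrite /restr /emb bigraded_sum (bigD1 p) //=.
rewrite embed_id big1 ?addr0 // => r rp; apply: embed_ne; apply/orP; left.
by apply: contra rp => /eqP e; apply/eqP/val_inj.
Qed.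

Let dtf n (x : tot n.+1) : tot n := @restr n (Dt (emb x)).
Let dtP n : klinear (kid R) (@dtf n).
Proof.
exact: klinear_comp (restrP n) (klinear_comp (klinear_bhom _ Dt) (embP n.+1)).
Qed.
Let dt n : bhom (tot n.+1) (tot n) :=
  let: And3 hD hl hr := @dtP n in Bhom hD hl hr.
Let dtE n x : dt n x = @restr n (Dt (emb x)).
Proof. by rewrite /dt; case: (dtP n). Qed.

Let dt_restr n t : dt n (@restr n.+1 t) = @restr n (Dt t).
Proof.
rewrite dtE; apply: functional_extensionality_dep => p; apply: Dt_loc => p' q' e.
by apply: emb_restr; rewrite e subnKC // -ltnS.
Qed.

Let dt_formula n (x : tot n.+1) p : dt n x p =
  \sum_(r < n.+2) \sum_((r == 0 :> nat) <= l < (n.+1 - r).+1)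
     xcast p (n - p) (dl l r (n.+1 - r) (x r)).
Proof.
rewrite dtE /restr DtE.
under eq_bigr do rewrite /emb bfun_sum bigraded_sum.
rewrite exchange_big /=; apply: eq_bigr => r _.
have z l : ((p.+1 < l) || (n.+1 - r < l))%N -> D l (embed (x r)) p (n - p)%N = 0.
  by case/orP=> lt; [exact: D_big | rewrite D_inj_big].
(* A common upper bound for both ranges of l: for l > p + 1 column p is out of reach, and for l > n
   + 1 - r the target row would be negative. *)
pose m := (maxn p.+2 (n.+1 - r).+1).
rewrite -(@sum_nat_trunc _ _ _ _ m) ?leq_maxl //; last first.
  by move=> l pl; rewrite z // pl.
transitivity (\sum_((r == 0 :> nat) <= l < m) D l (embed (x r)) p (n - p)%N).
  have D00 r' s (y : X r' s) : r' = 0%N -> D 0 (embed y) = 0.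
    by move=> r0; move: y; rewrite r0 => y; exact: D0_inj0.
  have [r0|//] := posnP r; rewrite big_ltn ?(leq_trans _ (leq_maxl _ _)) //.
  by rewrite (D00 _ _ (x r) r0) [LHS]add0r.
rewrite (@sum_nat_trunc _ _ _ (n.+1 - r).+1 m) ?leq_maxr //; last first.
  by move=> l pl; rewrite z // pl orbT.
apply: eq_big_nat => l /andP[rl]; rewrite ltnS => lr.
by rewrite D_injE //; case: (nat_of_ord r) rl => [|?]; rewrite ?addSn.
Qed.

Let epsf (x : tot 0) : N := mu (up 0 (x ord0)).
Let epsP : klinear (kid R) epsf.
Proof.
apply: (klinear_comp (klinear_bhom (kid R) mu)).
by split=> [x y|a x|x c]; [exact: bfunD | exact: bfunl | exact: bfunr].
Qed.
Let eps : bhom (tot 0) N := let: And3 hD hl hr := epsP in Bhom hD hl hr.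
Let epsE x : eps x = mu (up 0 (x ord0)).
Proof. by rewrite /eps; case: epsP. Qed.

Let eps_dt x : eps (dt 0 x) = 0.
Proof.
rewrite epsE dtE; transitivity (mu (U (Dt (emb x)) 0%N)); first by [].
by rewrite UDt; exact: mudY.
Qed.
Let dt_dt n x : dt n (dt n.+1 x) = 0.
Proof.
rewrite [dt n.+1 x]dtE dt_restr DtDt.
by apply: functional_extensionality_dep.
Qed.

Let section_klinear n (M' : bimod L R) (f : M' -> tot n) : klinear i f ->
  klinear i (fun y => @restr n.+1 (contr n.+2 (emb (f y)))).
Proof.
have kr m : klinear i (@restr m) by case: (restrP m) => hD hl hr; split.
have ke m : klinear i (@emb m).
  by case: (embP m) => hD hl hr; split=> // x c; exact: (hr x (i c)).
move=> hf; apply: klinear_comp (kr n.+1) _; apply: klinear_comp (contrP n.+2) _.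
exact: klinear_comp (ke n) hf.
Qed.

Let dt_section n (y : tot n) : Dt (emb y) = 0 -> mu (U (emb y) 0%N) = 0 ->
  dt n (@restr n.+1 (contr n.+2 (emb y))) = y.
Proof.
move=> Dt0 mu0; rewrite dt_restr contrE // ?restr_emb // => p q nq.
by rewrite emb_out // gtn_eqF // ltn_addl.
Qed.

Let kval_klinear (M1 M2 : bimod L R) (f : bhom M1 M2) :
  klinear i (fun y : bker f => kval y : M1).
Proof. by split. Qed.

(** One statement for the kernel of the augmentation and for that of a differential: the hypothesis
    says that its elements are [Dt]-cycles to which [contrE] applies. The section is the contraction
    composed with the inclusion of the kernel. *)
Let split_dt n (M2 : bimod L R) (f : bhom (tot n) M2) (e : forall x, f (dt n x) = 0) :
  (forall y, f y = 0 -> Dt (emb y) = 0 /\ mu (U (emb y) 0%N) = 0) ->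
  split_epi i (bcorestr e).
Proof.
move=> fP; set h := section_klinear (kval_klinear f).
have hE y : bcorestr e (kbhom h y) = y.
  rewrite kbhomE; apply: kval_inj => /=.
  have [Dt0 mu0] := fP (kval y) (eqP (kvalP y)).
  exact: dt_section.
by split=> [y|]; [exists (kbhom h y) | exists (kbhom h)].
Qed.

Theorem perturbation_resolution :
  (forall n, rel_projective (@split_epi k L R K i) (tot n)) ->
  exists (eps : bhom (tot 0) N) (d : forall n, bhom (tot n.+1) (tot n)),
  [/\ forall x, eps x = mu (up 0 (x ord0)),
      forall n (x : tot n.+1) (p : 'I_n.+1), d n x p =
        \sum_(r < n.+2) \sum_((r == 0 :> nat) <= l < (n.+1 - r).+1)
          xcast p (n - p) (dl l r (n.+1 - r) (x r)) &
      rel_projective_resolution (@split_epi k L R K i) eps d].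
Proof.
move=> proj; exists eps, dt; split; [exact: epsE | exact: dt_formula |].
have Dt_emb0 (y : tot 0) : Dt (emb y) = 0.
  apply: bigraded_eq => p q; rewrite (@Dt_loc _ 0) ?bfun0 // => p' q' e.
  by rewrite emb_out // e.
(* [dt n y = 0] gives the vanishing in total degree n; in any other degree Dt (emb y) is zero
   because emb y lives in total degree n + 1 only. *)
have ker_dt n (y : tot n.+1) : dt n y = 0 -> Dt (emb y) = 0.
  move=> dy0; apply: bigraded_eq => p q; have [e|ne] := eqVneq (p + q)%N n.
    transitivity (emb (@restr n (Dt (emb y))) p q); first by rewrite emb_restr.
    by rewrite -dtE dy0; case: (embP n) => hD _ _; rewrite (add_eq0 hD).
  rewrite (@Dt_loc _ 0) ?bfun0 // => p' q' e.
  by rewrite emb_out // e eqSS.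
have Uemb0 (y : tot 0) : U (emb y) 0%N = up 0 (y ord0).
  congr (up 0 _); have := congr1 (fun z : tot 0 => z ord0) (restr_emb y).
  by move=> <-.
split=> //.
(* The augmentation is split by sigma^0 after [sn]. *)
- have h : klinear i (fun x => @restr 0 (embed (sg0 (sn x)))).
    have kr : klinear i (@restr 0) by case: (restrP 0) => hD hl hr; split.
    apply: klinear_comp kr _; apply: klinear_comp (klinear_embed X i 0 0) _.
    exact: klinear_comp (sg0P 0) snP.
  have hE y : eps (kbhom h y) = y.
    rewrite kbhomE epsE; transitivity (mu (up 0 (sg0 (sn y)))).
      by congr (mu (up 0 _)); exact: embed_id.
    by rewrite upsg0 musn.
  by split=> [y|]; [exists (kbhom h y) | exists (kbhom h)].
- exists eps_dt; apply: split_dt => y ey; split; first exact: Dt_emb0.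
  by rewrite Uemb0 -epsE.
- move=> n; exists (@dt_dt n); apply: split_dt => y dy; split; first exact: ker_dt.
  (* An element of positive total degree has no component in bidegree (0, 0). *)
  by rewrite /U emb_out // !bfun0.
Qed.

End Perturbation.

(** * The crossed product *)

Section GammaLift.
Variables (k : fieldType) (A : kalg k) (V : lmodType k) (C : cpsystem A V).
Variables (tw : twisted_module C) (co : cocycle C) (K : subkalg A).

Local Notation E := (ecp tw co).
Local Notation j := (jnu tw co).
Local Notation i := (sk_incl K).
Local Notation jk := (jK tw co K).
Local Notation gam := (gamma tw co).

(** [nabla] fixes [eval x]; applied to a decomposition into tensors a (x) v it gives the values of
    j(a) gamma(v). So the same [q] serves for both expressions. *)
Lemma ecp_span (x : E) : exists q : seq (A * V),
  eval x = \sum_(p <- q) av p.1 p.2 /\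
  x = \sum_(p <- q) (j p.1 : E) * gam p.2.
Proof.
have [q qE] : exists q : seq (A * V), eval x = \sum_(p <- q) av p.1 p.2.
  elim/av_ind: (eval x) => [|t u [q ->] [q' ->]|a v].
  - by exists [::]; rewrite big_nil.
  - by exists (q ++ q'); rewrite big_cat.
  - by exists [:: (a, v)]; rewrite big_seq1.
exists q; split=> //; apply: eval_inj; rewrite -(in_AxVP C _ (evalP x)) qE.
rewrite [RHS](big_morph (@eval _ _ _ C) (fun _ _ => erefl) erefl).
rewrite [LHS](big_morph (fun t => nabla (chi C) t) (@avrD _ _ _ C 1) (avr0 C 1)).
by apply: eq_bigr => p _; rewrite nablaE [RHS]jnu_mul.
Qed.

Variables (R0 : kalg k) (g : khom R0 A) (W : bimod E R0) (r s : nat).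
Variable beta : W -> A -> Qres tw co K r s.
Hypotheses (betaDl : forall y y' a, beta (y + y') a = beta y a + beta y' a)
  (betaDr : forall y a a', beta y (a + a') = beta y a + beta y a')
  (beta_bal : forall y c a, beta (y *r c) a = beta y (g c * a))
  (beta_K : forall y a c, beta y (a * i c) = beta y a *r c)
  (beta_l : forall e y a, beta (e *l y) a = e *l beta y a).

(** Common shape of the two contractions: [sig0] has beta y a = y a with R0 = A, and [sig] has, up
    to sign, y (x) the class of a with R0 = K. *)
Definition gamma_lift (y : W) (x : E) : Xres tw co K r s :=
  avlift (fun a v => xpure (beta y a) (gam v)) (eval x).

Let spec y :
  (forall a v, avlift (fun a v => xpure (beta y a) (gam v)) (av a v)
                = xpure (beta y a) (gam v)) /\
  {morph avlift (fun a v => xpure (beta y a) (gam v)) : x y / x + y}.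
Proof.
apply: (avlift_gamma (K := K) (Q := Qres tw co K r s)
          (b := @xpure _ _ _ _ tw co K r s)).
- exact: betaDr.
- by move=> a c; exact: (beta_K y a (kemb (sk_alg K) c)).
- exact: xpureDl.
- exact: xpureDr.
- exact: xpure_bal.
Qed.

Let glE y (q : seq (A * V)) :
  avlift (fun a v => xpure (beta y a) (gam v)) (\sum_(p <- q) av p.1 p.2)
  = \sum_(p <- q) xpure (beta y p.1) (gam p.2).
Proof.
have [e D] := spec y; rewrite (big_morph _ D (add_eq0 D)).
by apply: eq_bigr => p _; exact: e.
Qed.

Lemma gamma_liftE y x (q : seq (A * V)) : eval x = \sum_(p <- q) av p.1 p.2 ->
  gamma_lift y x = \sum_(p <- q) xpure (beta y p.1) (gam p.2).
Proof. by move=> xE; rewrite /gamma_lift xE glE. Qed.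

Lemma gamma_liftDl y y' x : gamma_lift (y + y') x = gamma_lift y x + gamma_lift y' x.
Proof.
have [q [xE _]] := ecp_span x; rewrite !(gamma_liftE _ xE) -big_split.
by apply: eq_bigr => p _; rewrite betaDl xpureDl.
Qed.
Lemma gamma_liftDr y x x' : gamma_lift y (x + x') = gamma_lift y x + gamma_lift y x'.
Proof. by case: (spec y) => _ D; exact: D. Qed.
Lemma gamma_lift_bal y c x : gamma_lift (y *r c) x = gamma_lift y ((j (g c) : E) * x).
Proof.
have [q [xE _]] := ecp_span x; rewrite (gamma_liftE _ xE).
rewrite (@gamma_liftE y _ [seq (g c * p.1, p.2) | p <- q]).
  by rewrite big_map; apply: eq_bigr => p _; rewrite beta_bal.
rewrite [LHS]jnu_mul xE big_map lact_sum; apply: eq_bigr => p _.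
exact: av_lE.
Qed.
Lemma gamma_lift_l e y x : gamma_lift (e *l y) x = e *l gamma_lift y x.
Proof.
have [q [xE _]] := ecp_span x; rewrite !(gamma_liftE _ xE) lact_sum.
by apply: eq_bigr => p _; rewrite beta_l [RHS]tlactE.
Qed.

Hypothesis hchi : chi_stable C K.

(* By stability, v (x) c is moved by chi to sum c' (x) v' with c' in K, and
   sum j(c') gamma(v') = gamma(v) j(c). *)
Lemma gamma_lift_K y x c : gamma_lift y (x * (jk c : E)) = gamma_lift y x *r (jk c : E).
Proof.
have [q [xE _]] := ecp_span x; rewrite (gamma_liftE _ xE) /gamma_lift.
have -> : eval (x * (jk c : E)) = avr (chi C) (eval x) (i c) by exact: mul_jnu.
rewrite xE (big_morph (fun t => avr (chi C) t (i c)) (@avrD _ _ _ C _) (avr0 C _)).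
have [_ D] := spec y; rewrite (big_morph _ D (add_eq0 D)) ract_sum.
apply: eq_bigr => -[a v] _ /=; rewrite avr_av.
have [q' q'E] := hchi [:: (v, c)].
rewrite big_seq1 in q'E; rewrite [chi C _]q'E lact_sum.
under eq_bigr do rewrite av_lE.
rewrite [LHS](_ : _ = \sum_(p <- q') xpure (beta y (a * i p.1)) (gam p.2)); last first.
  by rewrite -(big_map (fun p => (a * i p.1, p.2)) xpredT (fun p => av p.1 p.2)) glE big_map.
rewrite [RHS]tractE.
(* Stability puts the coefficients in K, so they cross the tensor product over K to the right-hand
   factor. *)
transitivity (xpure (beta y a) (\sum_(p <- q') (jk p.1 : E) * gam p.2)).
  rewrite [RHS](big_morph _ (@xpureDr _ _ _ _ _ _ _ r s (beta y a)) (tpure0r _ _)).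
  by apply: eq_bigr => p _; rewrite beta_K xpure_bal.
congr (xpure _ _); apply: eval_inj.
have chiE : (chi C (va v (i c)) : AV A V) = avr (chi C) (av 1 v) (i c).
  by rewrite avr_av lact1.
(* [nabla] is the right action of 1, so it is absorbed on either side of the action of c. *)
have -> : eval (gam v * (jk c : E)) = nabla (chi C) (chi C (va v (i c)) : AV A V).
  rewrite [LHS]mul_jnu chiE /nabla avr_A mulr1.
  by rewrite [eval (gam v)]/(nabla (chi C) (av 1 v)) /nabla avr_A mul1r.
rewrite [chi C (va v (i c))]q'E (big_morph (@eval _ _ _ C) (fun _ _ => erefl) erefl).
rewrite [RHS](big_morph (fun t => nabla (chi C) t) (@avrD _ _ _ C 1) (avr0 C 1)).
by apply: eq_bigr => p _; rewrite nablaE [LHS]jnu_mul.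
Qed.
End GammaLift.

(** * Contractions of the rows and of the bar complex of E over A *)

Section CrossedProductResolution.
Variables (k : fieldType) (A : kalg k) (V : lmodType k) (C : cpsystem A V).
Variables (tw : twisted_module C) (co : cocycle C) (K : subkalg A).
Hypothesis hchi : chi_stable C K.

Local Notation E := (ecp tw co).
Local Notation j := (jnu tw co).
Local Notation i := (sk_incl K).
Local Notation jk := (jK tw co K).
Local Notation gam := (gamma tw co).
Local Notation X := (Xres tw co K).
Local Notation Y := (Yres tw co).
Local Notation P := (Pres tw co).
Local Notation Q := (Qres tw co K).
Local Notation rE := (rmod i (EAE tw co)).
Local Notation rE' := (rmod j (breg E)).

Lemma xpureE r s (y : Q r s) x : xpure y x = xpure y 1 *r x.
Proof. by rewrite [RHS]tractE; congr (xpure y _); rewrite [RHS]mul1r. Qed.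
Lemma xpure_l r s a (y : Q r s) x : a *l xpure y x = xpure (a *l y) x.
Proof. exact: tlactE. Qed.

Lemma xpureBl r s (y y' : Q r s) x : xpure (y - y') x = xpure y x - xpure y' x.
Proof. exact: tpureBl. Qed.
Lemma xpure_sumr r s (y : Q r s) (q : seq (A * V)) (F : A * V -> E) :
  xpure y (\sum_(p <- q) F p) = \sum_(p <- q) xpure y (F p).
Proof. exact: (tpure_sumr (M := Q r s) (N := rE)). Qed.

Section Sig0.
Variable s : nat.
Let beta0 (y : P s) (a : A) : Q 0 s := y *r a.
Let b1 y y' a : beta0 (y + y') a = beta0 y a + beta0 y' a.
Proof. exact: (ractDl y y' a). Qed.
Let b2 y a a' : beta0 y (a + a') = beta0 y a + beta0 y a'.
Proof. exact: (ractDr y a a'). Qed.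
Let b3 (y : P s) (c : A) a : beta0 (y *r c) a = beta0 y (kid A c * a).
Proof. exact: (ractA y c a). Qed.
Let b4 y a c : beta0 y (a * i c) = beta0 y a *r c.
Proof. exact/esym/(ractA y a (i c)). Qed.
Let b5 e y a : beta0 (e *l y) a = e *l beta0 y a.
Proof. exact: (lractA e y a). Qed.

Lemma sig0E (y : P s) x (q : seq (A * V)) : eval x = \sum_(p <- q) av p.1 p.2 ->
  sig0 K (ypure y x : Y s) = \sum_(p <- q) xpure (r := 0) (y *r p.1 : Q 0 s) (gam p.2).
Proof. by move=> xE; rewrite sig0_pure; exact: (gamma_liftE b2 b4 y xE). Qed.

Lemma klinear_sig0 : klinear jk (@sig0 _ _ _ _ tw co K s).
Proof.
apply: (tlift_klinear (M := P s) (N := rE')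
          (b := fun y x => gamma_lift (r := 0) beta0 y x)).
- exact: (gamma_liftDl b1 b2 b4).
- exact: (gamma_liftDr b2 b4).
- exact: (gamma_lift_bal b2 b3 b4).
- exact: (gamma_lift_l b2 b4 b5).
- exact: (gamma_lift_K b2 b4 hchi).
Qed.
End Sig0.

Section Sig.
Variables r s : nat.
Let beta (y : Q r s) (a : A) : Q r.+1 s := tpure y (bcls i a).
Let b1 y y' a : beta (y + y') a = beta y a + beta y' a.
Proof. exact: tpureDl. Qed.
Let b2 y a a' : beta y (a + a') = beta y a + beta y a'.
Proof. by rewrite /beta bcls_add; exact: tpureDr. Qed.
Let b3 (y : Q r s) (c : sk_alg K) a : beta (y *r c) a = beta y (i c * a).
Proof. by rewrite /beta bcls_l; exact: tpure_bal. Qed.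
Let b4 y a c : beta y (a * i c) = beta y a *r c.
Proof. by rewrite /beta bcls_r; exact/esym/tractE. Qed.
Let b5 e y a : beta (e *l y) a = e *l beta y a.
Proof. exact/esym/tlactE. Qed.

Lemma sigE (y : Q r s) x (q : seq (A * V)) : eval x = \sum_(p <- q) av p.1 p.2 ->
  sig (xpure y x : X r s) =
  (\sum_(p <- q) xpure (r := r.+1) (tpure y (bcls i p.1) : Q r.+1 s) (gam p.2))
    *~ (-1) ^+ (r + s).+1.
Proof.
move=> xE; rewrite sig_pure; congr (_ *~ _).
exact: (gamma_liftE b2 b4 y xE).
Qed.

Lemma klinear_sig : klinear jk (@sig _ _ _ _ tw co K r s).
Proof.
apply: (tlift_klinear (M := Q r s) (N := rE)
  (b := fun y x => gamma_lift (r := r.+1) beta y x *~ (-1) ^+ (r + s).+1)).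
- by move=> y y' x; rewrite (gamma_liftDl b1 b2 b4) mulrzDl.
- by move=> y x x'; rewrite (gamma_liftDr b2 b4) mulrzDl.
- by move=> y c x; rewrite (gamma_lift_bal b2 b3 b4).
- by move=> a y x; rewrite (gamma_lift_l b2 b4 b5) lactMz.
- by move=> y x c; rewrite [X in X *~ _](gamma_lift_K b2 b4 hchi) ractMz.
Qed.
End Sig.

Lemma klinear_ups s : klinear (kid E) (@ups _ _ _ _ tw co K s).
Proof.
apply: (tlift_klinear (M := Q 0 s) (N := rE) (b := fun y x => ypure (y : P s) x)).
- exact: (tpureDl (M := P s) (N := rE')).
- exact: (tpureDr (M := P s) (N := rE')).
- by move=> y c x; exact: (tpure_bal (M := P s) (N := rE') y (i c) x).
- by move=> a y x; exact/esym/(tlactE (M := P s) (N := rE')).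
- by move=> y x c; exact/esym/(tractE (M := P s) (N := rE')).
Qed.
Definition ups_hom s : bhom (X 0 s) (Y s) :=
  let: And3 hD hl hr := klinear_ups s in Bhom hD hl hr.
Lemma ups_homE s x : ups_hom s x = ups x.
Proof. by rewrite /ups_hom; case: klinear_ups. Qed.

Definition dY_hom s : bhom (Y s.+1) (Y s) := bar_dh j (breg E) (breg E) s.

Lemma klinear_d0 r s : klinear (kid E) (@d0 _ _ _ _ tw co K r.+1 s).
Proof.
apply: (klinearMz (f := bar_dh i (P s) (EAE tw co) r)); exact: klinear_bhom.
Qed.
Definition d0_hom r s : bhom (X r.+1 s) (X r s) :=
  let: And3 hD hl hr := klinear_d0 r s in Bhom hD hl hr.
Lemma d0_homE r s x : d0_hom r s x = bar_dh i (P s) (EAE tw co) r x *~ (-1) ^+ s.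
Proof. by rewrite /d0_hom; case: klinear_d0. Qed.

Lemma d0_hom_pure r s (y : Q r s) c (x : E) :
  d0_hom r s (xpure (r := r.+1) (tpure y (bcls i c) : Q r.+1 s) x) =
  (xpure (bact y c : Q r s) x - xpure y ((j c : E) * x)) *~ (-1) ^+ r *~ (-1) ^+ s.
Proof. by rewrite d0_homE; congr (_ *~ _); exact: bar_dE. Qed.

Definition muY : Y 0 -> E := tlift (M := P 0) (N := rE') (fun y x => (y : E) * x).
Lemma klinear_mu : klinear (kid E) (muY : Y 0 -> breg E).
Proof.
apply: (tlift_klinear (M := P 0) (N := rE') (b := fun y x => ((y : E) * x : breg E))).
- by move=> y y' x; exact: mulrDl.
- by move=> y x x'; exact: mulrDr.
- by move=> y c x; exact/esym/mulrA.
- by move=> a y x; exact/esym/mulrA.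
- by move=> y x c; exact: mulrA.
Qed.
Definition mu_hom : bhom (Y 0) (breg E) :=
  let: And3 hD hl hr := klinear_mu in Bhom hD hl hr.
Lemma mu_hom_pure (y : P 0) x : mu_hom (ypure y x) = (y : E) * x.
Proof.
rewrite /mu_hom; case: klinear_mu => _ _ _ /=.
apply: (tlift_pure (M := P 0) (N := rE') (b := fun y x => ((y : E) * x))).
- by move=> ? ? ?; exact: mulrDl.
- by move=> ? ? ?; exact: mulrDr.
- by move=> ? ? ?; exact/esym/mulrA.
Qed.

Section Sm.
Variable s : nat.
Let f (y : P s) (x : E) : Y s.+1 :=
  ypure (s := s.+1) (tpure y (bcls j x) : P s.+1) 1 *~ (-1) ^+ s.+1.
Let f1 y y' x : f (y + y') x = f y x + f y' x.
Proof.
rewrite /f -mulrzDl; congr (_ *~ _).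
by rewrite -[RHS](tpureDl (M := P s.+1) (N := rE')) -(tpureDl (M := P s)).
Qed.
Let f2 y x x' : f y (x + x') = f y x + f y x'.
Proof.
rewrite /f -mulrzDl; congr (_ *~ _).
by rewrite -[RHS](tpureDl (M := P s.+1) (N := rE')) -(tpureDr (M := P s)) bcls_add.
Qed.
Let f3 y c x : f (y *r c) x = f y ((j c : E) * x).
Proof. by rewrite /f bcls_l -[tpure y _](tpure_bal (M := P s)). Qed.
Let f4 a y x : f (a *l y) x = a *l f y x.
Proof.
have e : (tpure (a *l y) (bcls j x) : P s.+1) = a *l (tpure y (bcls j x) : P s.+1).
  exact/esym/tlactE.
rewrite /f lactMz e; congr (_ *~ _).
exact/esym/(tlactE (M := P s.+1) (N := rE')).
Qed.
(** The factor j(c) leaves the class as a right action of A, crosses the tensor product over A and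
    is absorbed by the last factor 1. *)
Let f5 y x c : f y (x * (j c : E)) = f y x *r (j c : E).
Proof.
rewrite /f ractMz bcls_r; congr (_ *~ _).
have -> : tpure y ((bcls j x : bbar j) *r c) = (tpure y (bcls j x) : P s.+1) *r c.
  exact/esym/tractE.
rewrite [LHS](tpure_bal (M := P s.+1) (N := rE')) [RHS](tractE (M := P s.+1) (N := rE')).
by congr (tpure _ _); rewrite [RHS]mul1r; exact: mulr1.
Qed.

Definition sY : Y s -> Y s.+1 := tlift (M := P s) (N := rE') f.
Lemma sY_pure y x : sY (ypure y x) =
  ypure (s := s.+1) (tpure y (bcls j x) : P s.+1) 1 *~ (-1) ^+ s.+1.
Proof. exact: (tlift_pure (M := P s) (N := rE') f1 f2 f3). Qed.
Lemma klinear_sY : klinear jk sY.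
Proof.
apply: (tlift_klinear (M := P s) (N := rE') f1 f2 f3 f4) => y x c.
exact: (f5 y x (i c)).
Qed.
End Sm.

Definition sE (x : E) : Y 0 := ypure (s := 0) (x : P 0) 1.
Lemma klinear_sE : klinear jk (sE : breg E -> Y 0).
Proof.
split=> [x y|a x|x c].
- exact: (tpureDl (M := P 0) (N := rE')).
- exact/esym/(tlactE (M := P 0) (N := rE')).
- rewrite [RHS](tractE (M := P 0) (N := rE')).
  rewrite [LHS](tpure_bal (M := P 0) (N := rE') x (i c)).
  by congr (tpure _ _); rewrite [RHS]mul1r; exact: mulr1.
Qed.
Lemma X_ind r s (Pr : X r s -> Prop) : Pr 0 ->
  (forall x y, Pr x -> Pr y -> Pr (x + y)) ->
  (forall (y : Q r s) x, Pr (xpure y x)) -> forall x, Pr x.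
Proof. exact: tpure_ind. Qed.
Lemma Y_ind s (Pr : Y s -> Prop) : Pr 0 ->
  (forall x y, Pr x -> Pr y -> Pr (x + y)) ->
  (forall (y : P s) x, Pr (ypure y x)) -> forall x, Pr x.
Proof. exact: tpure_ind. Qed.
Lemma X_indS r s (Pr : X r.+1 s -> Prop) : Pr 0 ->
  (forall x y, Pr x -> Pr y -> Pr (x + y)) ->
  (forall (y : Q r s) c x, Pr (xpure (tpure y (bcls i c) : Q r.+1 s) x)) ->
  forall x, Pr x.
Proof. exact: bar_ind. Qed.
Lemma Y_indS s (Pr : Y s.+1 -> Prop) : Pr 0 ->
  (forall x y, Pr x -> Pr y -> Pr (x + y)) ->
  (forall (y : P s) c x, Pr (ypure (tpure y (bcls j c) : P s.+1) x)) ->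
  forall x, Pr x.
Proof. exact: bar_ind. Qed.

Lemma sigD r s : {morph @sig _ _ _ _ tw co K r s : x y / x + y}.
Proof. by case: (klinear_sig r s). Qed.
Lemma sig_zero r s : sig (0 : X r s) = 0. Proof. exact: add_eq0 (@sigD r s). Qed.
Lemma sig0D s : {morph @sig0 _ _ _ _ tw co K s : x y / x + y}.
Proof. by case: (klinear_sig0 s). Qed.
Lemma sig0_zero s : sig0 K (0 : Y s) = 0. Proof. exact: add_eq0 (@sig0D s). Qed.
Lemma sYD s : {morph @sY s : x y / x + y}.
Proof. by case: (klinear_sY s). Qed.
Lemma sY0 s : sY (0 : Y s) = 0. Proof. exact: add_eq0 (@sYD s). Qed.
Lemma sED : {morph sE : x y / x + y}.
Proof. by case: klinear_sE. Qed.

Lemma ypureBl s (y y' : P s) x : ypure (y - y') x = ypure y x - ypure y' x.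
Proof. exact: (tpureBl (M := P s) (N := rE')). Qed.
Lemma ypure_bal s (y : P s) a x : ypure (y *r a) x = ypure y ((j a : E) * x).
Proof. exact: (tpure_bal (M := P s) (N := rE')). Qed.
Lemma ypure_sumr s (y : P s) (q : seq (A * V)) (F : A * V -> E) :
  ypure y (\sum_(p <- q) F p) = \sum_(p <- q) ypure y (F p).
Proof. exact: (tpure_sumr (M := P s) (N := rE')). Qed.

Lemma dY_hom_pure s (y : P s) c (x : E) :
  dY_hom s (ypure (tpure y (bcls j c) : P s.+1) x) =
  (ypure (bact y c : P s) x - ypure y (c * x)) *~ (-1) ^+ s.
Proof. exact: bar_dE. Qed.

(** Over A the coefficients move back, y a (x) gamma(v) = y (x) j(a) gamma(v), and the j(a) gamma(v)
    sum to x. *)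
Lemma ups_sig0 s (y : Y s) : ups_hom s (sig0 K y) = y.
Proof.
elim/Y_ind: y => [|x y ex ey|y x]; first by rewrite sig0_zero bfun0.
  by rewrite sig0D bfunD ex ey.
have [q [xE xS]] := ecp_span x; rewrite (sig0E _ xE) bfun_sum.
rewrite [in RHS]xS ypure_sumr; apply: eq_bigr => p _.
by rewrite ups_homE ups_pure ypure_bal.
Qed.

Lemma ups_d0 s (x : X 1 s) : ups_hom s (d0_hom 0 s x) = 0.
Proof.
elim/X_indS: x => [|x y ex ey|y c x]; first by rewrite !bfun0.
  by rewrite !bfunD ex ey addr0.
rewrite d0_hom_pure !bfunMz bfunB !ups_homE !ups_pure [bact y c]/((y : P s) *r c).
by rewrite ypure_bal subrr !mul0rz.
Qed.

Lemma d0_d0 r s (x : X r.+2 s) : d0_hom r s (d0_hom r.+1 s x) = 0.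
Proof. by rewrite !d0_homE bfunMz bar_dd !mul0rz. Qed.

(** On y (x) a (x) gamma(v) the second term of d^0 is y (x) j(a) gamma(v), and these sum to y (x) x.
    The sum that is left turns out to be sigma^0 upsilon in column 0 and sigma^0 d^0 in the other
    columns. *)
Lemma d0_sig r s (y : Q r s) x (q : seq (A * V)) :
  eval x = \sum_(p <- q) av p.1 p.2 -> x = \sum_(p <- q) (j p.1 : E) * gam p.2 ->
  d0_hom r s (sig (xpure y x)) =
  xpure y x - \sum_(p <- q) xpure (bact y p.1 : Q r s) (gam p.2).
Proof.
move=> xE xS; rewrite (sigE _ xE) bfunMz bfun_sum.
rewrite (eq_bigr (fun p => (xpure (bact y p.1 : Q r s) (gam p.2)
   - xpure y ((j p.1 : E) * gam p.2)) *~ (-1) ^+ (r + s))); last first.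
  by move=> p _; rewrite d0_hom_pure -mulrzA -exprD.
rewrite -mulrz_suml mulrz_signS mulrz_signK sumrB opprB; congr (_ - _).
by rewrite -xpure_sumr -xS.
Qed.

Lemma d0_sig_0 s (x : X 0 s) : d0_hom 0 s (sig x) = x - sig0 K (ups_hom s x).
Proof.
elim/X_ind: x => [|x y ex ey|y x].
- by rewrite sig_zero !bfun0 sig0_zero subr0.
- by rewrite sigD !bfunD sig0D ex ey opprD addrACA.
have [q [xE xS]] := ecp_span x.
by rewrite (d0_sig _ xE xS) ups_homE ups_pure (sig0E _ xE).
Qed.

(** By [bactE], a acts on y (x) c as y (x) ca - yc (x) a. The first terms come from sigma^0 of y (x)
    j(c) x, since multiplying x by j(c) replaces each a by ca; the second ones come from sigma^0 of
    yc (x) x. *)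
Lemma d0_sig_S r s (x : X r.+1 s) : d0_hom r.+1 s (sig x) = x - sig (d0_hom r s x).
Proof.
elim/X_indS: x => [|x y ex ey|y c x].
- by rewrite sig_zero !bfun0 sig_zero subr0.
- by rewrite sigD !bfunD sigD ex ey opprD addrACA.
have [q [xE xS]] := ecp_span x; rewrite (d0_sig _ xE xS); congr (_ - _).
have sgM z n : sig (z *~ n : X r s) = sig z *~ n by exact: (morphMz n (@sigD r s)).
have sgB y' z : sig (y' - z : X r s) = sig y' - sig z.
  by apply: (addIr (sig z)); rewrite -sigD !subrK.
rewrite d0_hom_pure !sgM sgB (sigE _ xE).
rewrite (@sigE r s y _ [seq (c * p.1, p.2) | p <- q]); last first.
  rewrite [LHS]jnu_mul xE big_map lact_sum; apply: eq_bigr => p _.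
  exact: av_lE.
rewrite big_map -mulrzBl -[RHS]mulrzA -exprD -[RHS]mulrzA -exprD.
(* The signs of sigma^0 and d^0 have exponents r + s + 1 and r + s, so their product is -1. *)
rewrite addSn exprS mulN1r -signr_odd addnn odd_double mulrN1z opprB -sumrB.
apply: eq_bigr => p _; rewrite bactE xpureBl.
by [].
Qed.

Lemma dY_dY s (y : Y s.+2) : dY_hom s (dY_hom s.+1 y) = 0.
Proof. exact: bar_dd. Qed.

Lemma mu_dY (y : Y 1) : mu_hom (dY_hom 0 y) = 0.
Proof.
elim/Y_indS: y => [|x y ex ey|y c x]; first by rewrite !bfun0.
  by rewrite !bfunD ex ey addr0.
rewrite dY_hom_pure bfunMz bfunB !mu_hom_pure.
by rewrite -[X in _ - X]/((y : E) * (c * x)) mulrA subrr mul0rz.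
Qed.

Lemma dY_sY_0 (y : Y 0) : dY_hom 0 (sY y) = y - sE (mu_hom y).
Proof.
elim/Y_ind: y => [|x y ex ey|y x].
- by rewrite sY0 !bfun0 (add_eq0 sED) subr0.
- by rewrite sYD !bfunD sED ex ey opprD addrACA.
rewrite sY_pure bfunMz dY_hom_pure mulr1 mu_hom_pure.
by rewrite expr0 expr1 mulrN1z mulr1z opprB.
Qed.

Lemma dY_sY s (y : Y s.+1) : dY_hom s.+1 (sY y) = y - sY (dY_hom s y).
Proof.
elim/Y_indS: y => [|x y ex ey|y c x].
- by rewrite sY0 !bfun0 sY0 subr0.
- by rewrite sYD !bfunD sYD ex ey opprD addrACA.
have sgM z n : sY (z *~ n : Y s) = sY z *~ n by exact: (morphMz n (@sYD s)).
have sgB y' z : sY (y' - z : Y s) = sY y' - sY z.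
  by apply: (addIr (sY z)); rewrite -sYD !subrK.
rewrite sY_pure bfunMz dY_hom_pure mulr1 dY_hom_pure sgM sgB !sY_pure.
rewrite [(-1) ^+ s.+2]exprS mulN1r mulrNz mulrz_signK bactE ypureBl.
rewrite -mulrzBl mulrz_signS mulNrz mulrz_signK.
by rewrite !opprB addrCA addrA addrC.
Qed.

Lemma mu_sE x : mu_hom (sE x) = x.
Proof. by rewrite mu_hom_pure mulr1. Qed.

Section BilinearExtension.
Variables (r s : nat) (Z : bimod E E) (f : X r s -> Z).
Hypothesis fP : klinear jk f.

Let f1 (y y' : Q r s) (x : rE) :
  f (xpure (y + y') 1) *r (x : E) = f (xpure y 1) *r (x : E) + f (xpure y' 1) *r (x : E).
Proof. by case: fP => fD _ _; rewrite xpureDl fD ractDl. Qed.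
Let f2 (y : Q r s) (x x' : rE) :
  f (xpure y 1) *r (x + x' : E) = f (xpure y 1) *r (x : E) + f (xpure y 1) *r (x' : E).
Proof. exact: ractDr. Qed.
(** Right K-linearity of [f] enters here: yc (x) 1 = (y (x) 1) j(c), so [f] passes c on to the
    factor x. *)
Let f3 (y : Q r s) (c : sk_alg K) (x : rE) :
  f (xpure (y *r c) 1) *r (x : E) = f (xpure y 1) *r (c *l x : E).
Proof.
case: fP => _ _ fr; rewrite xpure_bal mulr1 xpureE fr.
exact: ractA.
Qed.

Lemma ebilin_extE y x : ebilin_ext f (xpure y x) = f (xpure y 1) *r x.
Proof. exact: (tlift_pure f1 f2 f3). Qed.

Lemma klinear_ebilin_ext : klinear (kid E) (ebilin_ext f).
Proof.
apply: (tlift_klinear (M := Q r s) (N := rE) f1 f2 f3) => [a y x|y x c].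
- by case: fP => _ fl _; rewrite -xpure_l fl lractA.
- exact/esym/ractA.
Qed.

Lemma ebilin_ext_gen y : ebilin_ext f (xpure y 1) = f (xpure y 1).
Proof. by rewrite ebilin_extE ract1. Qed.
End BilinearExtension.

Lemma klinear_Xcast (K' : kalg k) (i' : khom K' E) r s r' s' :
  klinear i' (@Xcast _ _ _ _ tw co K r s r' s').
Proof. exact: (klinear_xcast X). Qed.

Lemma klinear_dY s : klinear jk (@dY _ _ _ _ tw co s).
Proof.
case: s => [|s]; first exact: klinear0.
exact: (klinear_bhom jk (dY_hom s)).
Qed.

Lemma klinear_kid_jK (M N : bimod E E) (f : M -> N) :
  klinear (kid E) f -> klinear jk f.
Proof. by move=> [fD fl fr]; split=> // x c; exact: (fr x (jk c)). Qed.

Lemma klinear_dstep (d : forall l r s, X r s -> X (r + l).-1 (s - l)) l r s :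
  (forall l' r' s', (l' + r' < l + r)%N -> klinear jk (@d l' r' s')) ->
  (0 < l)%N -> klinear jk (@dstep _ _ _ _ tw co K d l r s).
Proof.
move=> hd l0; rewrite /dstep; case: (_ && _).
  apply: klinear_comp (klinear_Xcast _ _ _ _ _) _.
  apply: klinear_comp (klinear_sig0 _) _; apply: klinear_comp (klinear_dY _) _.
  apply: klinear_comp (klinear_Xcast _ _ _ _ _).
  exact: klinear_kid_jK (klinear_ups s).
apply: klinearN; apply: klinear_sum_nat => m /andP[rm ml].
(* As r + m > 0, the predecessor is a true one and (r + m).-1 + (l - m) < l + r. *)
have rm1 : (0 < r + m)%N by move: rm; case: (r) => [|?]; rewrite ?addSn.
apply: klinear_comp (klinear_Xcast _ _ _ _ _) _; apply: klinear_comp (klinear_sig _ _) _.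
apply: klinear_comp (hd _ _ _ _) (hd _ _ _ _); last by rewrite ltn_add2r.
by rewrite -ltnS -addnS prednK // addnCA subnK ?(ltnW ml) // addnC.
Qed.

(** Induction on l + r, the measure of the recursion for d^l. *)
Lemma klinear_dmap l r s : klinear (kid E) (@dmap _ _ _ _ tw co K l r s).
Proof.
have [n] := ubnP (l + r)%N; elim: n l r s => // n IH [|l] r s lr.
  have -> : @dmap _ _ _ _ tw co K 0 r s = (fun x => Xcast (r + 0).-1 (s - 0) (d0 x)).
    by apply: functional_extensionality_dep => x; exact: dmap_0.
  apply: klinear_comp (klinear_Xcast (kid E) _ _ _ _) _.
  (* On column 0, [d0] is the zero map by convention. *)
  case: r lr => [|r] _; last exact: klinear_d0.
  exact: (klinearMz ((-1) ^+ s) (klinear0 (kid E) (X 0 s) (X 0 s))).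
rewrite dmap_rec //; apply: klinear_ebilin_ext; apply: klinear_dstep => // l' r' s' lt.
by apply/klinear_kid_jK/IH; apply: leq_trans lt _.
Qed.

Definition dmap_hom l r s : bhom (X r s) (X (r + l).-1 (s - l)) :=
  let: And3 hD hl hr := klinear_dmap l r s in Bhom hD hl hr.
Lemma dmap_homE l r s x : dmap_hom l r s x = @dmap _ _ _ _ tw co K l r s x.
Proof. by rewrite /dmap_hom; case: klinear_dmap. Qed.

Lemma mu_upsE (x : X 0 0) :
  mu_hom (ups_hom 0 x) = tlift (M := Q 0 0) (N := rE) (fun y z : E => y * z) x.
Proof.
have bDl (y y' z : E) : (y + y') * z = y * z + y' * z by exact: mulrDl.
have bDr (y z z' : E) : y * (z + z') = y * z + y * z' by exact: mulrDr.
have bB (y : Q 0 0) (c : sk_alg K) (z : rE) : (y *r c : E) * z = (y : E) * (c *l z : E).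
  exact/esym/mulrA.
move: x; apply: tens_eq => [x y|x y|y x]; first by rewrite !bfunD.
  exact: (tliftD (M := Q 0 0) (N := rE) bDl bDr bB).
rewrite ups_homE -[tpure y x]/(xpure y x) ups_pure mu_hom_pure.
exact/esym/(tlift_pure (M := Q 0 0) (N := rE) bDl bDr bB).
Qed.

Definition on_one r s (z : X r s) := exists y : Q r s, z = xpure y 1.

Lemma on_one_ind r s (Pr : X r s -> Prop) : Pr 0 ->
  (forall x y, Pr x -> Pr y -> Pr (x + y)) ->
  (forall z b, on_one z -> Pr (z *r b)) -> forall x, Pr x.
Proof.
move=> P0 PD Pg; elim/X_ind=> // y x; rewrite xpureE; apply: Pg.
by exists y.
Qed.

Lemma dmap_on_one l r s (z : X r s) : (0 < l)%N -> on_one z ->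
  @dmap _ _ _ _ tw co K l r s z = @dstep _ _ _ _ tw co K (@dmap _ _ _ _ tw co K) l r s z.
Proof.
move=> l0 [y ->]; rewrite dmap_rec // ebilin_ext_gen //.
by apply: klinear_dstep => // *; apply/klinear_kid_jK/klinear_dmap.
Qed.

(** The lift of f is prescribed on the elements y (x) 1 as f followed by the (E, K)-linear section;
    [ebilin_ext] makes it right E-linear. *)
Lemma rel_projective_Xres r s : rel_projective (@split_epi k _ _ _ jk) (X r s).
Proof.
move=> M N g [_ [sec secE]] f.
have hP : klinear jk (fun x => sec (f x)).
  by split=> [x y|a x|x c]; rewrite ?bfunD ?bfunl ?bfunr.
case: (klinear_ebilin_ext hP) => hD hl hr.
exists (Bhom hD hl hr) => /=; elim/X_ind=> [|x y ex ey|y x].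
- by rewrite (add_eq0 hD) !bfun0.
- by rewrite hD !bfunD ex ey.
- by rewrite (ebilin_extE hP) bfunr secE -bfunr -xpureE.
Qed.
End CrossedProductResolution.

Lemma rel_projective_dsum (k : fieldType) (L R : kalg k)
    (S : forall M N : bimod L R, bhom M N -> Prop) (I : finType) (M : I -> bimod L R) :
  (forall i, rel_projective S (M i)) -> rel_projective S (bdsum M).
Proof.
move=> proj M' N g Sg f.
pose inc i (x : M i) : bdsum M := fun i' =>
  match i =P i' with ReflectT e => ecast t (M t) e x | _ => 0 end.
have incE i x : @inc i x i = x.
  by rewrite /inc; case: eqP => // e; rewrite (eq_axiomK e).
have incN i i' x : i != i' -> @inc i x i' = 0 by rewrite /inc; case: eqP.
have incP i : klinear (kid R) (@inc i).
  split=> [x y|a x|x b]; apply: functional_extensionality_dep => i';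
    have [<-|ne] := eqVneq i i'.
  - by rewrite -[RHS]/(inc i x i + inc i y i) !incE.
  - by rewrite -[RHS]/(inc i x i' + inc i y i') !incN ?addr0.
  - by rewrite -[RHS]/(a *l inc i x i) !incE.
  - by rewrite -[RHS]/(a *l inc i x i') !incN ?lact0.
  - by rewrite -[RHS]/(inc i x i *r b) !incE.
  - by rewrite -[RHS]/(inc i x i' *r b) !incN ?ract0.
have /fin_all_exists[h hE] : forall i, exists h : bhom (M i) M', forall x, g (h x) = f (inc i x).
  move=> i; case: (klinear_comp (klinear_bhom (kid R) f) (incP i)) => hD hl hr.
  exact: (proj i _ _ g Sg (Bhom hD hl hr)).
have HP : klinear (kid R) (fun x : bdsum M => \sum_i h i (x i)).
  apply: (@klinear_sum _ _ _ _ _ (bdsum M) M' _ _ _ (fun i x => h i (x i))) => i _.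
  by split=> [x y|a x|x b]; [exact: (bfunD (h i)) | exact: (bfunl (h i)) | exact: (bfunr (h i))].
case: HP => hD hl hr; exists (Bhom hD hl hr) => x /=.
rewrite bfun_sum; under eq_bigr do rewrite hE.
rewrite -bfun_sum; congr (f _); apply: functional_extensionality_dep => i.
rewrite (big_morph (fun y : bdsum M => y i) (id1 := 0) (op1 := +%R)) //.
by rewrite (bigD1 i) //= incE big1 ?addr0 // => i' ne; rewrite incN.
Qed.

Theorem theorem2p10 (k : fieldType) (A : kalg k) (V : lmodType k)
    (C : @cpsystem k A V) (tw : @twisted_module k A V C) (co : @cocycle k A V C)
    (K : @subkalg k A) :
  @chi_stable k A V C K ->
  @inKV k A V K (eval (1 : ecp tw co)) ->
  exists (eps : bhom (Xtot tw co K 0) (breg (ecp tw co)))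
         (d : forall n, bhom (Xtot tw co K n.+1) (Xtot tw co K n)),
    [/\ forall x, eps x = mubar x,
        forall n (x : Xtot tw co K n.+1), d n x = dtot x &
        rel_projective_resolution (@split_epi k _ _ _ (jK tw co K)) eps d].
Proof.
move=> hchi _.
pose X := Xres tw co K; pose jk := jK tw co K.
have proj n : rel_projective (@split_epi k _ _ _ jk) (bdsum (fun r : 'I_n.+1 => X r (n - r)%N)).
  by apply: rel_projective_dsum => r; exact: rel_projective_Xres.
have [eps [d [epsE dE res]]] : exists (eps : bhom (Xtot tw co K 0) (breg (ecp tw co)))
    (d : forall n, bhom (Xtot tw co K n.+1) (Xtot tw co K n)),
  [/\ forall x, eps x = mu_hom tw co (ups_hom tw co K 0 (x ord0)),
      forall n (x : Xtot tw co K n.+1) (p : 'I_n.+1), d n x p =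
        \sum_(r < n.+2) \sum_((r == 0 :> nat) <= l < (n.+1 - r).+1)
          Xcast p (n - p) (dmap_hom tw co hchi l r (n.+1 - r) (x r)) &
      rel_projective_resolution (@split_epi k _ _ _ jk) eps d].
  (* [gen] becomes the set of elements y (x) 1_E, on which the recursion for d^l is stated. *)
  apply: (@perturbation_resolution k _ _ _ jk X (Yres tw co) (breg (ecp tw co))
    (dmap_hom tw co hchi) (d0_hom tw co K) (ups_hom tw co K) (dY_hom tw co) (mu_hom tw co)
    (@sig0 _ _ _ _ tw co K) (@sig _ _ _ _ tw co K) (@sY _ _ _ _ tw co) (@sE _ _ _ _ tw co)
    (@on_one _ _ _ _ tw co K)).
  - exact: klinear_sig0.
  - exact: klinear_sig.
  - exact: klinear_sY.
  - exact: klinear_sE.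
  - exact: on_one_ind.
  - exact: d0_d0.
  - exact: ups_d0.
  - exact: ups_sig0.
  - exact: d0_sig_0.
  - exact: d0_sig_S.
  - exact: dY_dY.
  - exact: mu_dY.
  - exact: dY_sY.
  - exact: dY_sY_0.
  - exact: mu_sE.
  (* The casts along r + 0 = r and s - 0 = s disappear under [embed]. *)
  - move=> r s x; rewrite dmap_homE dmap_0; etransitivity.
      by apply: embed_cast; rewrite ?addn0 ?subn0.
    by congr (embed _); rewrite /d0_hom; case: klinear_d0.
  - move=> s z gz; rewrite dmap_homE (dmap_on_one hchi) // /dstep eqxx.
    etransitivity; first by apply: embed_cast; rewrite ?subn1.
    congr (embed (sig0 K (dY _))); rewrite ups_homE; congr ups.
    exact: (xcast_id (X := X)).
  - move=> l r s z gz l0 rl; rewrite dmap_homE (dmap_on_one hchi) // /dstep.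
    (* The branch l = 1, r = 0 of [dstep] contradicts 1 < r + l. *)
    case: ifP => [/andP[/eqP l1 /eqP r0]|_]; first by rewrite l1 r0 in rl.
    congr (- _); apply: eq_bigr => m _.
    by rewrite !dmap_homE.
  - exact: proj.
exists eps, d; split=> // [x|n x].
  by rewrite epsE mu_upsE.
apply: functional_extensionality_dep => p; rewrite dE /dtot.
by under eq_bigr do under eq_bigr do rewrite dmap_homE.
Qed.
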